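(* Let $H=(H,\Delta,\varepsilon,\Phi,\alpha,\beta,S)$ and $H'=(H',\Delta',\varepsilon',\Phi',\alpha',\beta',S')$ be finite-dimensional semi-simple quasi-Hopf algebras over an algebraically closed field $k$ of characteristic zero. If the module categories $H\text{-}\mathbf{mod}$ and $H'\text{-}\mathbf{mod}$ are equivalent as $k$-linear tensor categories, then the families of Frobenius-Schur indicators $\{\chi(\nu_H)\}_{\chi\in\mathrm{Irr}(H)}$ and $\{\chi'(\nu_{H'})\}_{\chi'\in\mathrm{Irr}(H')}$ are identical (as families, i.e. counted with multiplicity).
   Context: A quasi-bialgebra over a field $k$ is $(H,\Delta,\varepsilon,\Phi)$ with $H$ a unital associative $k$-algebra, $\Delta:H\to H\otimes H$ and $\varepsilon:H\to k$ algebra maps, and $\Phi\in H\otimes H\otimes H$ invertible such that $(\varepsilon\otimes id)\Delta=id=(id\otimes\varepsilon)\Delta$; $\Phi(\Delta\otimes id)\Delta(h)\Phi^{-1}=(id\otimes\Delta)\Delta(h)$ for all $h$; $(id\otimes id\otimes\Delta)(\Phi)(\Delta\otimes id\otimes id)(\Phi)=(1\otimes\Phi)(id\otimes\Delta\otimes id)(\Phi)(\Phi\otimes1)$; $(id\otimes\varepsilon\otimes id)(\Phi)=1\otimes1$. Write $\Delta(h)=\sum h_1\otimes h_2$, $\Phi=\sum X_i\otimes Y_i\otimes Z_i$, $\Phi^{-1}=\sum\overline X_i\otimes\overline Y_i\otimes\overline Z_i$. A quasi-Hopf algebra $(H,\Delta,\varepsilon,\Phi,\alpha,\beta,S)$ is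 a quasi-bialgebra with an algebra anti-automorphism $S$ (the antipode) and $\alpha,\beta\in H$ such that for all $h\in H$: $\sum S(h_1)\alpha h_2=\varepsilon(h)\alpha$, $\sum h_1\beta S(h_2)=\varepsilon(h)\beta$, $\sum X_i\beta S(Y_i)\alpha Z_i=1$, $\sum S(\overline X_i)\alpha\overline Y_i\beta S(\overline Z_i)=1$. $H\text{-}\mathbf{mod}$ is the category of left $H$-modules; it is a tensor (monoidal) category with $H$ acting on tensor products over $k$ through $\Delta$, unit object $k$ with action through $\varepsilon$, and associativity isomorphism $(U\otimes V)\otimes W\to U\otimes(V\otimes W)$ given by the action of $\Phi$. Define $q_L=\sum S(\overline X_i)\alpha\overline Y_i\otimes\overline Z_i$ and $p_L=\sum Y_iS^{-1}(X_i\beta)\otimes Z_i$. A two-sided integral of $H$ is $l\in H$ with $hl=\varepsilon(h)l=lh$ for all $h$; it is normalized if $\varepsilon(l)=1$. A finite-dimensional semi-simple quasi-Hopf algebra has a unique normalized two-sided integral $\Lambda$ (known fact). Define $\nu_H=m(q_L\Delta(\Lambda)p_L)\in H$, where $m$ is multiplication. $\mathrm{Irr}(H)$ is the set of irreducible characters of $H$; the Frobenius-Schur indicator of $\chi\in\mathrm{Irr}(H)$ is $\chi(\nu_H)$. *)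

(* Defs.v *)
From HB Require Import structures.
From mathcomp Require Import all_boot all_order all_algebra.
From mathcomp Require Import falgebra.
From mathcomp Require Import boolp classical_sets functions.

Set Implicit Arguments.
Unset Strict Implicit.
Unset Printing Implicit Defensive.

Import GRing.Theory.

Local Open Scope ring_scope.
Local Open Scope quotient_scope.

Local Notation bilinear f := (bilinear_for *:%R *:%R f).

Section TensorProduct.
Variables (k : fieldType) (U V : lmodType k).

Definition formal_sum (W : lmodType k) (f : U -> V -> W) (s : seq (U * V)) : W :=
  \sum_(p <- s) f p.1 p.2.

(* A list [:: (u_1, v_1); ...; (u_n, v_n)] stands for the formal sum of the
   u_i (x) v_i; two of them are identified when every bilinear map takes the
   same value on both, so that the universal property holds by construction
   (tsum_linear, tsum_pure and tensor_ext below). *)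
Definition tensor_eq : rel (seq (U * V)) := fun s t =>
  `[< forall (W : lmodType k) (f : U -> V -> W), bilinear f ->
        formal_sum f s = formal_sum f t >].

Lemma tensor_eq_refl : reflexive tensor_eq.
Proof. by move=> s; apply/asboolP. Qed.

Lemma tensor_eq_sym : symmetric tensor_eq.
Proof. by move=> s t; apply/asboolP/asboolP => E W f bf; rewrite E. Qed.

Lemma tensor_eq_trans : transitive tensor_eq.
Proof.
move=> t s r /asboolP E1 /asboolP E2; apply/asboolP => W f bf.
by rewrite E1 // E2.
Qed.

Canonical tensor_equiv_rel :=
  EquivRel tensor_eq tensor_eq_refl tensor_eq_sym tensor_eq_trans.

Definition tensor : Type := {eq_quot tensor_eq}.
HB.instance Definition _ := Choice.on tensor.
HB.instance Definition _ := EqQuotient.on tensor.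

Definition pure (u : U) (v : V) : tensor := \pi_tensor [:: (u, v)].

(* For bilinear f, tsum f is the linear map on U (x) V sending u (x) v to
   f u v (i.e. Sweedler's \sum f(t_1, t_2)); for such f the choice of
   representative is irrelevant. *)
Definition tsum (W : lmodType k) (f : U -> V -> W) (t : tensor) : W :=
  formal_sum f (repr t).

Lemma tsum_pi (W : lmodType k) (f : U -> V -> W) s :
  bilinear f -> tsum f (\pi_tensor s) = formal_sum f s.
Proof.
move=> bf; rewrite /tsum.
have /eqmodP/asboolP E : repr (\pi_tensor s) = s %[mod tensor].
  by rewrite reprK.
exact: E.
Qed.

Lemma tensorP (s t : tensor) :
  (forall (W : lmodType k) (f : U -> V -> W), bilinear f ->
     tsum f s = tsum f t) -> s = t.
Proof.
move=> E; rewrite -[s]reprK -[t]reprK; apply/eqmodP/asboolP => W f bf.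
exact: E.
Qed.

Definition tadd (s t : tensor) : tensor := \pi_tensor (repr s ++ repr t).
Definition tscale (a : k) (t : tensor) : tensor :=
  \pi_tensor [seq (a *: p.1, p.2) | p <- repr t].
Definition tzero : tensor := \pi_tensor [::].

Lemma tsum_add (W : lmodType k) (f : U -> V -> W) s t :
  bilinear f -> tsum f (tadd s t) = tsum f s + tsum f t.
Proof. by move=> bf; rewrite tsum_pi // /formal_sum big_cat. Qed.

Lemma tsum_scale (W : lmodType k) (f : U -> V -> W) a t :
  bilinear f -> tsum f (tscale a t) = a *: tsum f t.
Proof.
move=> bf; rewrite tsum_pi // /formal_sum big_map scaler_sumr.
apply: eq_bigr => p _ /=.
exact: (GRing.scalable_linear (bf.1 p.2)).
Qed.

Lemma tsum_zero (W : lmodType k) (f : U -> V -> W) : bilinear f -> tsum f tzero = 0.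
Proof. by move=> bf; rewrite tsum_pi // /formal_sum big_nil. Qed.

Fact taddA : associative tadd.
Proof. by move=> r s t; apply: tensorP => W f bf; rewrite !tsum_add // addrA. Qed.
Fact taddC : commutative tadd.
Proof. by move=> s t; apply: tensorP => W f bf; rewrite !tsum_add // addrC. Qed.
Fact tadd0 : left_id tzero tadd.
Proof.
by move=> t; apply: tensorP => W f bf; rewrite !tsum_add // tsum_zero // add0r.
Qed.
Fact taddN : left_inverse tzero (tscale (-1)) tadd.
Proof.
move=> t; apply: tensorP => W f bf.
by rewrite tsum_add // tsum_scale // tsum_zero // scaleN1r addNr.
Qed.

HB.instance Definition _ :=
  GRing.isZmodule.Build tensor taddA taddC tadd0 taddN.

Fact tscaleA a b t : tscale a (tscale b t) = tscale (a * b) t.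
Proof. by apply: tensorP => W f bf; rewrite !tsum_scale // scalerA. Qed.
Fact tscale1 : left_id 1 tscale.
Proof. by move=> t; apply: tensorP => W f bf; rewrite tsum_scale // scale1r. Qed.
Fact tscaleDr : right_distributive tscale +%R.
Proof.
move=> a s t; apply: tensorP => W f bf.
by rewrite tsum_scale // !tsum_add // !tsum_scale // scalerDr.
Qed.
Fact tscaleDl t : {morph tscale^~ t : a b / a + b}.
Proof.
move=> a b; apply: tensorP => W f bf.
by rewrite tsum_scale // !tsum_add // !tsum_scale // scalerDl.
Qed.

HB.instance Definition _ :=
  GRing.Zmodule_isLmodule.Build k tensor tscaleA tscale1 tscaleDr tscaleDl.

Lemma tsum_pure (W : lmodType k) (f : U -> V -> W) u v :
  bilinear f -> tsum f (pure u v) = f u v.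
Proof. by move=> bf; rewrite tsum_pi // /formal_sum big_seq1. Qed.

Lemma tsum_linear (W : lmodType k) (f : U -> V -> W) :
  bilinear f -> linear (tsum f).
Proof. by move=> bf a s t; rewrite tsum_add // tsum_scale. Qed.

Lemma pure_bilinear : bilinear pure.
Proof.
split=> [v|u] a x y; apply: tensorP => W f bf;
  rewrite tsum_add // tsum_scale // !tsum_pure //.
- exact: (bf.1 v a x y).
- exact: (bf.2 u a x y).
Qed.

Lemma tensor_sum_pure (t : tensor) : t = \sum_(p <- repr t) pure p.1 p.2.
Proof.
apply: tensorP => W f bf.
have lf := tsum_linear bf.
pose F := HB.pack_for {linear tensor -> W} (tsum f)
  (GRing.isLinear.Build k tensor W *:%R (tsum f) lf).
rewrite -[RHS]/(F _) linear_sum {1}/tsum /formal_sum.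
by apply: eq_bigr => p _; rewrite -(tsum_pure p.1 p.2 bf).
Qed.

Lemma tensor_ext (W : lmodType k) (f g : tensor -> W) :
  linear f -> linear g ->
  (forall u v, f (pure u v) = g (pure u v)) -> f =1 g.
Proof.
move=> lf lg E t.
pose F := HB.pack_for {linear tensor -> W} f
  (GRing.isLinear.Build k tensor W *:%R f lf).
pose G := HB.pack_for {linear tensor -> W} g
  (GRing.isLinear.Build k tensor W *:%R g lg).
rewrite -[f t]/(F t) -[g t]/(G t) (tensor_sum_pure t) !linear_sum.
by apply: eq_bigr => p _; exact: E.
Qed.

End TensorProduct.

Arguments tensor {k} (U V)%_type_scope.
Arguments tsum {k U V W} f t.
Arguments pure {k U V} u v.

Reserved Notation "U ⊗ V" (at level 45, left associativity).
Notation "U ⊗ V" := (tensor U V) : type_scope.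
Notation "u ⊗ v" := (pure u v) : ring_scope.

Section LinearMaps.
Variables (k : fieldType) (U V W : lmodType k).

Lemma linear_id : linear (@idfun U).
Proof. by []. Qed.

Lemma linear_cmp (f : U -> V) (g : V -> W) :
  linear f -> linear g -> linear (fun x => g (f x)).
Proof. by move=> lf lg a x y; rewrite lf lg. Qed.

Lemma linear_comb (c : k) (f g : U -> V) :
  linear f -> linear g -> linear (fun x => c *: f x + g x).
Proof.
move=> lf lg a x y; rewrite lf lg !scalerDr !scalerA [c * a]mulrC.
by rewrite addrACA.
Qed.

End LinearMaps.

Section TensorMap.
Variables (k : fieldType) (U U' V V' : lmodType k).
Implicit Types (f : U -> U') (g : V -> V').

Definition tmap f g : U ⊗ V -> (U' ⊗ V')%type := tsum (fun u v => f u ⊗ g v).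

Lemma tmap_bilinear f g :
  linear f -> linear g -> bilinear (fun u v => f u ⊗ g v).
Proof.
move=> lf lg; split=> [v|u] a x y.
- by rewrite lf ((pure_bilinear U' V').1 (g v)).
- by rewrite lg ((pure_bilinear U' V').2 (f u)).
Qed.

Lemma tmap_linear f g : linear f -> linear g -> linear (tmap f g).
Proof. by move=> lf lg; apply/tsum_linear/tmap_bilinear. Qed.

Lemma tmap_pure f g u v : linear f -> linear g -> tmap f g (u ⊗ v) = f u ⊗ g v.
Proof. by move=> lf lg; rewrite /tmap tsum_pure //; apply: tmap_bilinear. Qed.

End TensorMap.

Section Associativity.
Variables (k : fieldType) (U V W : lmodType k).

Definition tassoc : U ⊗ V ⊗ W -> (U ⊗ (V ⊗ W))%type :=
  tsum (fun uv w => tsum (fun u v => u ⊗ (v ⊗ w)) uv).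

Definition tassocV : U ⊗ (V ⊗ W) -> (U ⊗ V ⊗ W)%type :=
  tsum (fun u vw => tsum (fun v w => (u ⊗ v) ⊗ w) vw).

Let b1 (w : W) : bilinear (fun (u : U) (v : V) => u ⊗ (v ⊗ w)).
Proof.
split=> [v|u] a x y; first by rewrite (pure_bilinear _ _).1.
by rewrite (pure_bilinear _ _).1 (pure_bilinear _ _).2.
Qed.

Let b2 (u : U) : bilinear (fun (v : V) (w : W) => (u ⊗ v) ⊗ w).
Proof.
split=> [w|v] a x y; last by rewrite (pure_bilinear _ _).2.
by rewrite (pure_bilinear _ _).2 (pure_bilinear _ _).1.
Qed.

Let B1 : bilinear (fun uv (w : W) => tsum (fun (u : U) (v : V) => u ⊗ (v ⊗ w)) uv).
Proof.
split=> [w|uv] a x y; first exact: tsum_linear (b1 w) a x y.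
move: uv; apply: tensor_ext => [||u v]; first exact: tsum_linear.
- by apply: linear_comb; apply: tsum_linear.
- by rewrite !tsum_pure // !(pure_bilinear _ _).2.
Qed.

Let B2 : bilinear (fun (u : U) vw => tsum (fun (v : V) (w : W) => (u ⊗ v) ⊗ w) vw).
Proof.
split=> [vw|u] a x y; last exact: tsum_linear (b2 u) a x y.
move: vw; apply: tensor_ext => [||v w]; first exact: tsum_linear.
- by apply: linear_comb; apply: tsum_linear.
- by rewrite !tsum_pure // !(pure_bilinear _ _).1.
Qed.

Lemma tassoc_linear : linear tassoc.
Proof. exact: tsum_linear. Qed.

Lemma tassocV_linear : linear tassocV.
Proof. exact: tsum_linear. Qed.

Lemma tassoc_pure u v w : tassoc (u ⊗ v ⊗ w) = u ⊗ (v ⊗ w).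
Proof. by rewrite /tassoc !tsum_pure. Qed.

Lemma tassocV_pure u v w : tassocV (u ⊗ (v ⊗ w)) = u ⊗ v ⊗ w.
Proof. by rewrite /tassocV !tsum_pure. Qed.

End Associativity.

Arguments tassoc {k U V W} t : rename.
Arguments tassocV {k U V W} t : rename.

Section TensorExt3.
Variables (k : fieldType) (U V W X : lmodType k).

Lemma tensor_ext3 (f g : (U ⊗ V ⊗ W)%type -> X) : linear f -> linear g ->
  (forall u v w, f (u ⊗ v ⊗ w) = g (u ⊗ v ⊗ w)) -> f =1 g.
Proof.
move=> lf lg E; apply: tensor_ext => // uv w; move: uv.
apply: tensor_ext => // a x y; rewrite (pure_bilinear _ _).1 ?lf ?lg //.
Qed.

Lemma tensor_ext3r (f g : U ⊗ (V ⊗ W) -> X) : linear f -> linear g ->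
  (forall u v w, f (u ⊗ (v ⊗ w)) = g (u ⊗ (v ⊗ w))) -> f =1 g.
Proof.
move=> lf lg E; apply: tensor_ext => // u; apply: tensor_ext => // a x y.
- by rewrite (pure_bilinear _ _).2 lf.
- by rewrite (pure_bilinear _ _).2 lg.
Qed.

End TensorExt3.

Lemma tassocK (k : fieldType) (U V W : lmodType k) :
  cancel (@tassoc k U V W) tassocV.
Proof.
apply: tensor_ext3 => [||u v w]; last by rewrite tassoc_pure tassocV_pure.
- exact: linear_cmp (@tassoc_linear _ _ _ _) (@tassocV_linear _ _ _ _).
- exact: linear_id.
Qed.

Lemma tassocVK (k : fieldType) (U V W : lmodType k) :
  cancel (@tassocV k U V W) tassoc.
Proof.
apply: tensor_ext3r => [||u v w]; last by rewrite tassocV_pure tassoc_pure.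
- exact: linear_cmp (@tassocV_linear _ _ _ _) (@tassoc_linear _ _ _ _).
- exact: linear_id.
Qed.

(* The action of A (x) B on U (x) V deduced from actions rho : A x U -> U and
   sigma : B x V -> V. *)
Section TensorAction.
Variables (k : fieldType) (A B U V : lmodType k).
Implicit Types (rho : A -> U -> U) (sigma : B -> V -> V).

Definition tact rho sigma (t : A ⊗ B) (x : U ⊗ V) : (U ⊗ V)%type :=
  tsum (fun a b => tmap (rho a) (sigma b) x) t.

Lemma tact_aux rho sigma x : bilinear rho -> bilinear sigma ->
  bilinear (fun a b => tmap (rho a) (sigma b) x).
Proof.
move=> br bs; split=> [b|a] c y z; move: x; apply: tensor_ext => [||u v].
- by apply: tmap_linear; [apply: br.2 | apply: bs.2].
- by apply: linear_comb; apply: tmap_linear; (apply: br.2 || apply: bs.2).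
- rewrite !tmap_pure; try by [apply: br.2 | apply: bs.2].
  by rewrite (br.1 u) (pure_bilinear _ _).1.
- by apply: tmap_linear; [apply: br.2 | apply: bs.2].
- by apply: linear_comb; apply: tmap_linear; (apply: br.2 || apply: bs.2).
- rewrite !tmap_pure; try by [apply: br.2 | apply: bs.2].
  by rewrite (bs.1 v) (pure_bilinear _ _).2.
Qed.

Lemma tact_bilinear rho sigma :
  bilinear rho -> bilinear sigma -> bilinear (tact rho sigma).
Proof.
move=> br bs; split=> [x|t]; first exact/tsum_linear/tact_aux.
move=> c x y; move: t; apply: tensor_ext => [||a b].
- exact/tsum_linear/tact_aux.
- by apply: linear_comb; apply/tsum_linear/tact_aux.
- rewrite /tact !tsum_pure; try exact: tact_aux.
  by rewrite (tmap_linear (br.2 _) (bs.2 _)).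
Qed.

Lemma tact_pure rho sigma a b u v : bilinear rho -> bilinear sigma ->
  tact rho sigma (a ⊗ b) (u ⊗ v) = rho a u ⊗ sigma b v.
Proof.
move=> br bs; rewrite /tact tsum_pure ?tmap_pure //; last exact: tact_aux.
- exact: br.2.
- exact: bs.2.
Qed.

End TensorAction.

Section TensorAlgebra.
Variables (k : fieldType) (A B : algType k).

Lemma mul_bilinear (C : algType k) : bilinear (@GRing.mul C).
Proof.
split=> [y|x] a u v; first by rewrite /= mulrDl scalerAl.
by rewrite /= mulrDr scalerAr.
Qed.

Definition tmul : A ⊗ B -> A ⊗ B -> (A ⊗ B)%type :=
  tact (@GRing.mul A) (@GRing.mul B).
Definition tone : (A ⊗ B)%type := 1 ⊗ 1.

Let tmulb : bilinear tmul.
Proof. by apply: tact_bilinear; apply: mul_bilinear. Qed.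

Let tmul_pure a b a' b' : tmul (a ⊗ b) (a' ⊗ b') = (a * a') ⊗ (b * b').
Proof. by rewrite /tmul tact_pure //; apply: mul_bilinear. Qed.

Lemma tact_mul_gen (U V : lmodType k) (rho : A -> U -> U) (sigma : B -> V -> V) :
  bilinear rho -> bilinear sigma ->
  (forall a a' u, rho (a * a') u = rho a (rho a' u)) ->
  (forall b b' v, sigma (b * b') v = sigma b (sigma b' v)) ->
  forall s t x,
    tact rho sigma (tmul s t) x = tact rho sigma s (tact rho sigma t x).
Proof.
move=> br bs mr ms s t x.
have tb := tact_bilinear br bs.
move: s; apply: tensor_ext => [||a b].
- exact: linear_cmp (tmulb.1 t) (tb.1 x).
- exact: tb.1.
move: t; apply: tensor_ext => [||a' b'].
- exact: linear_cmp (tmulb.2 _) (tb.1 x).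
- exact: linear_cmp (tb.1 x) (tb.2 _).
move: x; apply: tensor_ext => [||u v].
- exact: tb.2.
- exact: linear_cmp (tb.2 _) (tb.2 _).
by rewrite tmul_pure !tact_pure // mr ms.
Qed.

Fact tmulA : associative tmul.
Proof.
move=> s t x; apply/esym.
by apply: (tact_mul_gen (mul_bilinear A) (mul_bilinear B)) => *; rewrite mulrA.
Qed.

Fact tmul1 : left_id tone tmul.
Proof.
apply: tensor_ext => [||u v]; [exact: tmulb.2 | exact: linear_id |].
by rewrite tmul_pure !mul1r.
Qed.

Fact tmulr1 : right_id tone tmul.
Proof.
apply: tensor_ext => [||u v]; [exact: tmulb.1 | exact: linear_id |].
by rewrite tmul_pure !mulr1.
Qed.

Fact tmulDl : left_distributive tmul +%R.
Proof.
by move=> s t x; have := tmulb.1 x 1 s t; rewrite /= !scale1r.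
Qed.

Fact tmulDr : right_distributive tmul +%R.
Proof.
by move=> s t x; have := tmulb.2 s 1 t x; rewrite /= !scale1r.
Qed.

End TensorAlgebra.

(* Existence of a linear functional not vanishing at 1, needed only to see
   that A (x) B is not the zero ring. *)
Lemma exists_functional (k : fieldType) (A : algType k) :
  exists f : A -> k^o, linear f /\ f 1 = 1.
Proof.
pose sub (M : set A) :=
  (forall a x y, M x -> M y -> M (a *: x + y)) /\ ~ M 1.
have [F Fsub Ftot|M [[Mlin M1] Mmax]] := @Zorn_bigcup A sub.
  split=> [a x y [X FX Xx] [Y FY Yy]|[X FX X1]].
    have [XY|YX] := Ftot _ _ FX FY.
    - by exists Y => //; apply: (Fsub _ FY).1 => //; apply: XY.
    - by exists X => //; apply: (Fsub _ FX).1 => //; apply: YX.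
  by have [_] := Fsub _ FX; apply.
have M0 : M 0.
  apply: contrapT => nM0; pose N : set A := [set 0]%classic.
  have [[y My]|Mempty] := pselect (exists x, M x).
    apply: nM0; have := Mlin (-1) y y My My.
    by rewrite scaleN1r addNr.
  apply: (Mmax N).
    split=> [x Mx|E]; last by apply: nM0; apply: (E 0).
    by case: Mempty; exists x.
  split=> [a x y -> ->|/eqP]; first by rewrite scaler0 addr0.
  by rewrite oner_eq0.
have dec x : exists c : k, M (x - c *: 1).
  have [Mx|nMx] := pselect (M x); first by exists 0; rewrite scale0r subr0.
  pose N : set A := [set y | exists c, M (y - c *: x)]%classic.
  have N1 : N 1.
    apply: contrapT => nN1; apply: (Mmax N).
      split=> [y My|NM]; first by exists 0; rewrite scale0r subr0.
      by apply: nMx; apply: NM; exists 1; rewrite scale1r subrr.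
    split=> // a y z [c My] [d Mz]; exists (a * c + d).
    have := Mlin a _ _ My Mz; rewrite scalerBr scalerA scalerDl opprD.
    by rewrite addrACA.
  case: N1 => c Mc; have c0 : c != 0.
    by apply: contra_notN M1 => /eqP c0; rewrite c0 scale0r subr0 in Mc.
  exists c^-1; have := Mlin (- c^-1) _ _ Mc M0.
  by rewrite addr0 scalerBr scalerA mulNr mulVf // !scaleNr scale1r opprK addrC.
have uniq c d x : M (x - c *: 1) -> M (x - d *: 1) -> c = d.
  move=> Mc Md; apply/eqP; rewrite -subr_eq0; apply/negPn/negP => cd.
  apply: M1; have := Mlin (-1) _ _ Mc Md.
  rewrite scaleN1r opprB addrA subrK -scalerBl => Mcd.
  have := Mlin (c - d)^-1 _ _ Mcd M0.
  by rewrite addr0 scalerA mulVf // scale1r.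
pose f x : k^o := xget 0 [set c | M (x - c *: 1)]%classic.
have fP x : M (x - f x *: 1) := xgetPex 0 (dec x).
exists f; split=> [a x y|].
  apply: (uniq _ _ (a *: x + y) (fP _)).
  have := Mlin a _ _ (fP x) (fP y); rewrite scalerBr scalerA scalerDl opprD.
  by rewrite addrACA.
by apply: (uniq _ _ 1 (fP _)); rewrite scale1r subrr.
Qed.

Section TensorAlgebraInstances.
Variables (k : fieldType) (A B : algType k).

HB.instance Definition _ := GRing.Zmodule_isPzRing.Build (tensor A B)
  (@tmulA k A B) (@tmul1 k A B) (@tmulr1 k A B) (@tmulDl k A B) (@tmulDr k A B).

Fact tone_neq0 : (1 : tensor A B) != 0.
Proof.
have [f [lf f1]] := exists_functional A.
have [g [lg g1]] := exists_functional B.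
have bfg : bilinear (fun a b => f a * g b : k^o).
  split=> [b|a] c x y.
  - by rewrite lf mulrDl -mulrA.
  - by rewrite lg mulrDr /GRing.scale /= mulrCA.
apply/eqP => E; have := tsum_pure 1 1 bfg.
have -> : 1 ⊗ 1 = 0 :> tensor A B := E.
have -> : tsum (fun a b => f a * g b : k^o) (0 : tensor A B) = 0.
  exact: tsum_zero bfg.
by move=> /eqP; rewrite f1 g1 mulr1 eq_sym oner_eq0.
Qed.

HB.instance Definition _ :=
  GRing.PzSemiRing_isNonZero.Build (tensor A B) tone_neq0.

Fact tscalerAl a (s t : tensor A B) : a *: (s * t) = (a *: s) * t.
Proof.
have [lm _] := tact_bilinear (mul_bilinear A) (mul_bilinear B).
exact/esym/(GRing.scalable_linear (lm t)).
Qed.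

Fact tscalerAr a (s t : tensor A B) : a *: (s * t) = s * (a *: t).
Proof.
have [_ rm] := tact_bilinear (mul_bilinear A) (mul_bilinear B).
exact/esym/(GRing.scalable_linear (rm s)).
Qed.

HB.instance Definition _ :=
  GRing.Lmodule_isLalgebra.Build k (tensor A B) tscalerAl.
HB.instance Definition _ :=
  GRing.Lalgebra_isAlgebra.Build k (tensor A B) tscalerAr.

Lemma tensor_mul_pure a b a' b' :
  (a ⊗ b) * (a' ⊗ b') = (a * a') ⊗ (b * b') :> tensor A B.
Proof. exact: (tact_pure _ _ _ _ (mul_bilinear A) (mul_bilinear B)). Qed.

Lemma tensor_oneE : 1 = 1 ⊗ 1 :> tensor A B.
Proof. by []. Qed.

End TensorAlgebraInstances.
(* The tensor powers of H are bracketed to the left; tassoc and tassocV make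
   explicit the identifications that are usually left implicit. *)
Record quasi_bialgebra (k : fieldType) (H : algType k) := QuasiBialgebra {
  comul : {lrmorphism H -> (H ⊗ H)%type};
  counit : {lrmorphism H -> k^o};
  assoc : (H ⊗ H ⊗ H)%type;
  assoc_inv : (H ⊗ H ⊗ H)%type;
  assocK : assoc_inv * assoc = 1;
  assocVK : assoc * assoc_inv = 1;
  counitl : forall h, tsum (fun a b => counit a *: b) (comul h) = h;
  counitr : forall h, tsum (fun a b => counit b *: a) (comul h) = h;
  quasi_coassoc : forall h,
    tassoc (assoc * tmap comul idfun (comul h) * assoc_inv) =
    tmap idfun comul (comul h);
  assoc_pentagon :
    tassocV (tmap idfun comul assoc) * tmap (tmap comul idfun) idfun assoc =
    tmap tassocV idfun (tassocV (1 ⊗ assoc)) *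
      tmap tassocV idfun (tmap (tmap idfun comul) idfun assoc) *
      (assoc ⊗ 1);
  assoc_counit :
    tmap (tsum (fun x y => counit y *: x)) idfun assoc = 1 ⊗ 1
}.

Record quasi_hopf (k : fieldType) (H : algType k) := QuasiHopf {
  qh_bialgebra :> quasi_bialgebra H;
  antipode : {linear H -> H};
  antipode_inv : H -> H;
  antipodeK : cancel antipode antipode_inv;
  antipodeVK : cancel antipode_inv antipode;
  antipode1 : antipode 1 = 1;
  antipodeM : forall x y, antipode (x * y) = antipode y * antipode x;
  alpha : H;
  beta : H;
  antipode_alpha : forall h,
    tsum (fun a b => antipode a * alpha * b) (comul qh_bialgebra h) =
    counit qh_bialgebra h *: alpha;
  antipode_beta : forall h,
    tsum (fun a b => a * beta * antipode b) (comul qh_bialgebra h) =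
    counit qh_bialgebra h *: beta;
  antipode_assoc :
    tsum (fun xy z =>
        tsum (fun x y => x * beta * antipode y * alpha * z) xy)
      (assoc qh_bialgebra) = 1;
  antipode_assoc_inv :
    tsum (fun xy z =>
        tsum (fun x y => antipode x * alpha * y * beta * antipode z) xy)
      (assoc_inv qh_bialgebra) = 1
}.

Section Modules.
Variables (k : fieldType) (H : algType k).

(* A left H-module, as a k-vector space with a bilinear action of H. *)
Record hmod := HMod {
  hcar :> lmodType k;
  hact : H -> hcar -> hcar;
  hact_linearl : forall u, linear (hact^~ u);
  hact_linearr : forall h, linear (hact h);
  hact1 : forall u, hact 1 u = u;
  hactM : forall h h' u, hact (h * h') u = hact h (hact h' u)
}.

Lemma hact_bilinear (U : hmod) : bilinear (@hact U).
Proof. by split; [apply: hact_linearl | apply: hact_linearr]. Qed.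

Lemma hactZl (U : hmod) a h (u : U) : hact (a *: h) u = a *: hact h u.
Proof. exact: (GRing.scalable_linear (hact_linearl u)). Qed.

Lemma hactZr (U : hmod) a h (u : U) : hact h (a *: u) = a *: hact h u.
Proof. exact: (GRing.scalable_linear (hact_linearr h)). Qed.

Record hhom (U V : hmod) := HHom {
  hhom_fun :> {linear U -> V};
  hhom_act : forall h u, hhom_fun (hact h u) = hact h (hhom_fun u)
}.

Lemma hhom_ext (U V : hmod) (f g : hhom U V) : f =1 g -> f = g.
Proof.
case: f g => [[f [[fN] [fS]]] fP] [[g [[gN] [gS]]] gP] /= /funext E.
move: E fN fS fP gN gS gP => /= -> fN fS fP gN gS gP.
move: fP gP; rewrite (Prop_irrelevance fN gN) (Prop_irrelevance fS gS).
by move=> fP gP; rewrite (Prop_irrelevance fP gP).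
Qed.

Definition hid (U : hmod) : hhom U U := @HHom U U idfun (fun h u => erefl).

Fact hcomp_act (U V W : hmod) (g : hhom V W) (f : hhom U V) h u :
  (g \o f) (hact h u) = hact h ((g \o f) u).
Proof. by rewrite /= !hhom_act. Qed.

Definition hcomp (U V W : hmod) (g : hhom V W) (f : hhom U V) : hhom U W :=
  @HHom U W (g \o f) (hcomp_act g f).

Definition hiso (U V : hmod) (f : hhom U V) : Prop :=
  exists g : hhom V U, hcomp g f =1 hid U /\ hcomp f g =1 hid V.

Definition mk_hhom (U V : hmod) (f : U -> V) (lf : linear f)
    (hf : forall h u, f (hact h u) = hact h (f u)) : hhom U V :=
  @HHom U V (HB.pack_for {linear U -> V} f
               (GRing.isLinear.Build k U V *:%R f lf)) hf.

Definition submodule (U : hmod) (N : set U) : Prop :=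
  [/\ N 0, forall u v, N u -> N v -> N (u + v) &
      forall h u, N u -> N (hact h u)].

Definition simple_hmod (U : hmod) : Prop :=
  (exists u : U, u != 0) /\
  forall N : set U, submodule N -> N = [set 0]%classic \/ N = setT.

(* chi is the character of the finite-dimensional module U: the trace of the
   matrix of the action in some (equivalently, any) system of coordinates. *)
Definition has_character (U : hmod) (chi : H -> k) : Prop :=
  exists (n : nat) (e : {linear U -> 'cV[k]_n}) (rho : H -> 'M[k]_n),
    [/\ bijective e, forall h u, e (hact h u) = rho h *m e u &
        forall h, chi h = \tr (rho h)].

Definition Irr : set (H -> k) :=
  [set chi | exists U : hmod, simple_hmod U /\ has_character U chi]%classic.

End Modules.

Arguments Irr {k} H.

Section ModuleTensor.
Variables (k : fieldType) (H : algType k) (Q : quasi_bialgebra H).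

Let comul_linear : linear (comul Q). Proof. exact: linearP. Qed.

Section Obj.
Variables (U V : hmod H).

Definition htens_act (h : H) : U ⊗ V -> (U ⊗ V)%type :=
  tact (@hact k H U) (@hact k H V) (comul Q h).

Let tb := tact_bilinear (hact_bilinear U) (hact_bilinear V).

Fact htens_linearl x : linear (htens_act^~ x).
Proof. exact: linear_cmp comul_linear (tb.1 x). Qed.
Fact htens_linearr h : linear (htens_act h).
Proof. exact: tb.2. Qed.
Fact htens_act1 x : htens_act 1 x = x.
Proof.
rewrite /htens_act rmorph1; move: x; apply: tensor_ext => [||u v].
- exact: tb.2.
- exact: linear_id.
rewrite tact_pure ?hact1 //; exact: hact_bilinear.
Qed.
Fact htens_actM h h' x : htens_act (h * h') x = htens_act h (htens_act h' x).
Proof.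
rewrite /htens_act rmorphM.
exact: (tact_mul_gen (hact_bilinear U) (hact_bilinear V) (@hactM k H U)
  (@hactM k H V)).
Qed.

Definition htens : hmod H :=
  HMod htens_linearl htens_linearr htens_act1 htens_actM.

End Obj.

Fact hunit_linearl (c : k^o) : linear (fun h : H => counit Q h * c : k^o).
Proof. by move=> a x y; rewrite linearP mulrDl -scalerAl. Qed.
Fact hunit_linearr (h : H) : linear (fun c : k^o => counit Q h * c : k^o).
Proof. by move=> a x y; rewrite mulrDr -scalerAr. Qed.
Fact hunit_act1 (c : k^o) : counit Q 1 * c = c.
Proof. by rewrite rmorph1 mul1r. Qed.
Fact hunit_actM h h' (c : k^o) :
  counit Q (h * h') * c = counit Q h * (counit Q h' * c).
Proof. by rewrite rmorphM mulrA. Qed.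

Definition hunit : hmod H :=
  HMod hunit_linearl hunit_linearr hunit_act1 hunit_actM.

Lemma hhom_linear (U V : hmod H) (f : hhom U V) : linear f.
Proof. exact: linearP. Qed.

Section Morphisms.
Variables (U U' V V' : hmod H) (f : hhom U U') (g : hhom V V').

Fact htens_hom_act h (x : htens U V) :
  tmap f g (hact h x) = hact h (tmap f g x : htens U' V').
Proof.
rewrite /= /htens_act; move: (comul Q h) => t.
have tb := tact_bilinear (hact_bilinear U) (hact_bilinear V).
have tb' := tact_bilinear (hact_bilinear U') (hact_bilinear V').
have lm := tmap_linear (hhom_linear f) (hhom_linear g).
move: t; apply: tensor_ext => [||a b].
- exact: linear_cmp (tb.1 x) lm.
- exact: tb'.1.
move: x; apply: tensor_ext => [||u v].
- exact: linear_cmp (tb.2 _) lm.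
- exact: linear_cmp lm (tb'.2 _).
rewrite !(tmap_pure, tact_pure) ?hhom_act //;
  by [apply: hact_bilinear | apply: hhom_linear].
Qed.

Definition htens_hom : hhom (htens U V) (htens U' V') :=
  @mk_hhom k H (htens U V) (htens U' V') (tmap f g)
    (tmap_linear (hhom_linear f) (hhom_linear g)) htens_hom_act.

End Morphisms.

Section Associator.
Variables U V W : hmod H.

(* (u (x) v) (x) w |-> \sum X u (x) (Y v (x) Z w), for assoc = \sum X (x) Y (x) Z. *)
Definition hassoc_fun (x : U ⊗ V ⊗ W) : (U ⊗ (V ⊗ W))%type :=
  tassoc (tact (tact (@hact k H U) (@hact k H V)) (@hact k H W) (assoc Q) x).

Let bU := hact_bilinear U.
Let bV := hact_bilinear V.
Let bW := hact_bilinear W.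
Let bUV := tact_bilinear bU bV.
Let bVW := tact_bilinear bV bW.
Let bUV_W := tact_bilinear bUV bW.
Let bU_VW := tact_bilinear bU bVW.

Let tact_assoc t x :
  tassoc (tact (tact (@hact k H U) (@hact k H V)) (@hact k H W) t x) =
  tact (@hact k H U) (tact (@hact k H V) (@hact k H W)) (tassoc t) (tassoc x).
Proof.
have tl := @tassoc_linear k.
move: t; apply: tensor_ext3 => [||a b c].
- exact: linear_cmp (bUV_W.1 x) (tl _ _ _).
- exact: linear_cmp (tl _ _ _) (bU_VW.1 _).
move: x; apply: tensor_ext3 => [||u v w].
- exact: linear_cmp (bUV_W.2 _) (tl _ _ _).
- exact: linear_cmp (tl _ _ _) (bU_VW.2 _).
by rewrite !(tact_pure, tassoc_pure).
Qed.

Let tact_comull (h : H ⊗ H) (x : U ⊗ V ⊗ W) :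
  tact (@hact k H (htens U V)) (@hact k H W) h x =
  tact (tact (@hact k H U) (@hact k H V)) (@hact k H W)
    (tmap (comul Q) idfun h) x.
Proof.
have bt := tact_bilinear (hact_bilinear (htens U V)) bW.
have lt := tmap_linear comul_linear (@linear_id k H).
move: h; apply: tensor_ext => [||a b].
- exact: bt.1.
- exact: linear_cmp lt (bUV_W.1 x).
rewrite (tmap_pure _ _ comul_linear (@linear_id k H)).
move: x; apply: tensor_ext => [||y w].
- exact: bt.2.
- exact: bUV_W.2.
by rewrite !tact_pure //; apply: hact_bilinear.
Qed.

Let tact_comulr (h : H ⊗ H) (x : U ⊗ (V ⊗ W)) :
  tact (@hact k H U) (@hact k H (htens V W)) h x =
  tact (@hact k H U) (tact (@hact k H V) (@hact k H W))
    (tmap idfun (comul Q) h) x.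
Proof.
have bt := tact_bilinear bU (hact_bilinear (htens V W)).
have lt := tmap_linear (@linear_id k H) comul_linear.
move: h; apply: tensor_ext => [||a b].
- exact: bt.1.
- exact: linear_cmp lt (bU_VW.1 x).
rewrite (tmap_pure _ _ (@linear_id k H) comul_linear).
move: x; apply: tensor_ext => [||y w].
- exact: bt.2.
- exact: bU_VW.2.
by rewrite !tact_pure //; apply: hact_bilinear.
Qed.

Let tact3M (s t : (H ⊗ H ⊗ H)%type) (x : U ⊗ V ⊗ W) :
  tact (tact (@hact k H U) (@hact k H V)) (@hact k H W) (s * t) x =
  tact (tact (@hact k H U) (@hact k H V)) (@hact k H W) s
    (tact (tact (@hact k H U) (@hact k H V)) (@hact k H W) t x).
Proof.
apply: (tact_mul_gen bUV bW); last exact: hactM.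
exact: tact_mul_gen bU bV (@hactM k H U) (@hactM k H V).
Qed.

Fact hassoc_linear : linear hassoc_fun.
Proof. exact: linear_cmp (bUV_W.2 _) (@tassoc_linear k _ _ _). Qed.

Fact hassoc_act h (x : htens (htens U V) W) :
  hassoc_fun (hact h x) = hact h (hassoc_fun x : htens U (htens V W)).
Proof.
rewrite /hassoc_fun /= /htens_act.
rewrite [in LHS]/hact -/(@hact k H _) tact_comull tact_comulr -quasi_coassoc.
rewrite -tact_assoc -!tact3M; congr (tassoc (tact _ _ _ _)).
by rewrite -!mulrA assocK mulr1.
Qed.

Definition hassoc : hhom (htens (htens U V) W) (htens U (htens V W)) :=
  @mk_hhom k H (htens (htens U V) W) (htens U (htens V W)) hassoc_fun
    hassoc_linear hassoc_act.

End Associator.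

Section Unitors.
Variable V : hmod H.

Definition hunitl_fun : hunit ⊗ V -> V := tsum (fun (c : k^o) v => c *: v).
Definition hunitr_fun : V ⊗ hunit -> V := tsum (fun v (c : k^o) => c *: v).

Let bl : bilinear (fun (c : k^o) (v : V) => c *: v).
Proof.
split=> [v|c] a x y /=; last by rewrite scalerDr !scalerA mulrC.
by rewrite scalerDl scalerA.
Qed.
Let br : bilinear (fun (v : V) (c : k^o) => c *: v).
Proof.
split=> [c|v] a x y /=; first by rewrite scalerDr !scalerA mulrC.
by rewrite scalerDl scalerA.
Qed.

Fact hunitl_linear : linear hunitl_fun. Proof. exact: tsum_linear. Qed.
Fact hunitr_linear : linear hunitr_fun. Proof. exact: tsum_linear. Qed.

Let el : bilinear (fun a b : H => counit Q a *: b).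
Proof.
split=> [v|c] a x y /=; last by rewrite scalerDr !scalerA mulrC.
by rewrite linearP scalerDl scalerA.
Qed.
Let er : bilinear (fun a b : H => counit Q b *: a).
Proof.
split=> [c|v] a x y /=; first by rewrite scalerDr !scalerA mulrC.
by rewrite linearP scalerDl scalerA.
Qed.

Fact hunitl_act h (x : htens hunit V) :
  hunitl_fun (hact h x) = hact h (hunitl_fun x).
Proof.
rewrite -[in RHS](counitl Q h) /= /htens_act.
have tb := tact_bilinear (hact_bilinear hunit) (hact_bilinear V).
move: (comul Q h); apply: tensor_ext => [||a b].
- exact: linear_cmp (tb.1 x) hunitl_linear.
- exact: linear_cmp (tsum_linear el) (hact_linearl _).
rewrite tsum_pure //.
move: x; apply: tensor_ext => [||c v].
- exact: linear_cmp (tb.2 _) hunitl_linear.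
- exact: linear_cmp hunitl_linear (hact_linearr _).
rewrite tact_pure; try exact: hact_bilinear.
rewrite /hunitl_fun !tsum_pure //.
by rewrite hactZl hactZr scalerA.
Qed.

Fact hunitr_act h (x : htens V hunit) :
  hunitr_fun (hact h x) = hact h (hunitr_fun x).
Proof.
rewrite -[in RHS](counitr Q h) /= /htens_act.
have tb := tact_bilinear (hact_bilinear V) (hact_bilinear hunit).
move: (comul Q h); apply: tensor_ext => [||a b].
- exact: linear_cmp (tb.1 x) hunitr_linear.
- exact: linear_cmp (tsum_linear er) (hact_linearl _).
rewrite tsum_pure //.
move: x; apply: tensor_ext => [||v c].
- exact: linear_cmp (tb.2 _) hunitr_linear.
- exact: linear_cmp hunitr_linear (hact_linearr _).
rewrite tact_pure; try exact: hact_bilinear.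
rewrite /hunitr_fun !tsum_pure //.
by rewrite hactZl hactZr scalerA.
Qed.

Definition hunitl : hhom (htens hunit V) V :=
  @mk_hhom k H (htens hunit V) V hunitl_fun hunitl_linear hunitl_act.
Definition hunitr : hhom (htens V hunit) V :=
  @mk_hhom k H (htens V hunit) V hunitr_fun hunitr_linear hunitr_act.

End Unitors.

End ModuleTensor.

Section Functors.
Variable k : fieldType.

Record hfunctor (H H' : algType k) := HFunctor {
  fobj :> hmod H -> hmod H';
  fmor : forall U V : hmod H, hhom U V -> hhom (fobj U) (fobj V);
  fmor_id : forall U, fmor (hid U) =1 hid (fobj U);
  fmor_comp : forall U V W (g : hhom V W) (f : hhom U V),
    fmor (hcomp g f) =1 hcomp (fmor g) (fmor f)
}.

Arguments fmor {H H'} F {U V} f : rename.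

Definition fid (H : algType k) : hfunctor H H :=
  @HFunctor H H (fun U => U) (fun U V f => f) (fun U u => erefl)
    (fun U V W g f u => erefl).

Fact fcomp_id (H H' H'' : algType k) (G : hfunctor H' H'')
    (F : hfunctor H H') U : fmor G (fmor F (hid U)) =1 hid (G (F U)).
Proof. by rewrite (hhom_ext (@fmor_id _ _ F U)); apply: fmor_id. Qed.

Fact fcomp_comp (H H' H'' : algType k) (G : hfunctor H' H'')
    (F : hfunctor H H') U V W (g : hhom V W) (f : hhom U V) :
  fmor G (fmor F (hcomp g f)) =1
  hcomp (fmor G (fmor F g)) (fmor G (fmor F f)).
Proof. by rewrite (hhom_ext (@fmor_comp _ _ F _ _ _ g f)); apply: fmor_comp. Qed.

Definition fcomp (H H' H'' : algType k) (G : hfunctor H' H'')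
    (F : hfunctor H H') : hfunctor H H'' :=
  @HFunctor H H'' (fun U => G (F U)) (fun U V f => fmor G (fmor F f))
    (@fcomp_id H H' H'' G F) (@fcomp_comp H H' H'' G F).

Definition nat_iso (H H' : algType k) (F G : hfunctor H H') : Prop :=
  exists eta : forall U, hhom (F U) (G U),
    (forall U, hiso (eta U)) /\
    (forall U V (f : hhom U V),
       hcomp (eta V) (fmor F f) =1 hcomp (fmor G f) (eta U)).

Definition equivalence (H H' : algType k) (F : hfunctor H H') : Prop :=
  exists G : hfunctor H' H,
    nat_iso (fcomp G F) (fid H) /\ nat_iso (fcomp F G) (fid H').

(* F (a f + g) = a F f + F g, where s stands for a f + g. *)
Definition klinear (H H' : algType k) (F : hfunctor H H') : Prop :=
  forall (U V : hmod H) (a : k) (f g s : hhom U V),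
    (forall u, s u = a *: f u + g u) ->
    forall x, fmor F s x = a *: fmor F f x + fmor F g x.

(* ten2 U V : F U (x) F V -> F (U (x) V) and ten0 : k -> F k. *)
Record tensor_structure (H H' : algType k) (Q : quasi_bialgebra H)
    (Q' : quasi_bialgebra H') (F : hfunctor H H') := TensorStructure {
  ten2 : forall U V, hhom (htens Q' (F U) (F V)) (F (htens Q U V));
  ten0 : hhom (hunit Q') (F (hunit Q));
  ten2_iso : forall U V, hiso (ten2 U V);
  ten0_iso : hiso ten0;
  ten2_nat : forall U U' V V' (f : hhom U U') (g : hhom V V'),
    hcomp (ten2 U' V') (htens_hom Q' (fmor F f) (fmor F g)) =1
    hcomp (fmor F (htens_hom Q f g)) (ten2 U V);
  ten2_assoc : forall U V W,
    hcomp (fmor F (hassoc Q U V W))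
      (hcomp (ten2 (htens Q U V) W) (htens_hom Q' (ten2 U V) (hid (F W)))) =1
    hcomp (ten2 U (htens Q V W))
      (hcomp (htens_hom Q' (hid (F U)) (ten2 V W))
         (hassoc Q' (F U) (F V) (F W)));
  ten_unitl : forall V,
    hcomp (fmor F (hunitl Q V))
      (hcomp (ten2 (hunit Q) V) (htens_hom Q' ten0 (hid (F V)))) =1
    hunitl Q' (F V);
  ten_unitr : forall V,
    hcomp (fmor F (hunitr Q V))
      (hcomp (ten2 V (hunit Q)) (htens_hom Q' (hid (F V)) ten0)) =1
    hunitr Q' (F V)
}.

Definition tensor_equivalent (H H' : algType k) (Q : quasi_bialgebra H)
    (Q' : quasi_bialgebra H') : Prop :=
  exists F : hfunctor H H',
    [/\ klinear F, equivalence F & inhabited (tensor_structure Q Q' F)].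

End Functors.

Section Semisimple.
Variables (k : fieldType) (H : falgType k).

Definition left_ideal (I : {vspace H}) : Prop :=
  forall h x, x \in I -> h * x \in I.

Definition minimal_left_ideal (I : {vspace H}) : Prop :=
  [/\ left_ideal I, I != 0%VS &
      forall J, left_ideal J -> (J <= I)%VS -> J = 0%VS \/ J = I].

Definition semisimple : Prop :=
  exists (n : nat) (I : 'I_n -> {vspace H}),
    [/\ forall i, minimal_left_ideal (I i), directv (\sum_i I i)%VS &
        (\sum_i I i)%VS = fullv].

End Semisimple.

Section Indicator.
Variables (k : fieldType) (H : algType k) (Q : quasi_hopf H).

Definition normalized_integral (l : H) : Prop :=
  (forall h, h * l = counit Q h *: l /\ l * h = counit Q h *: l) /\
  counit Q l = 1.

(* When H is finite-dimensional and semisimple there is exactly one normalized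
   two-sided integral, so that xget returns it. *)
Definition integral : H := xget 0 [set l | normalized_integral l]%classic.

Definition q_L : (H ⊗ H)%type :=
  tsum (fun xy z => tsum (fun x y => (antipode Q x * alpha Q * y) ⊗ z) xy)
    (assoc_inv Q).

Definition p_L : (H ⊗ H)%type :=
  tsum (fun xy z =>
      tsum (fun x y => (y * antipode_inv Q (x * beta Q)) ⊗ z) xy)
    (assoc Q).

Definition nu : H := tsum (fun x y => x * y) (q_L * comul Q integral * p_L).

End Indicator.

(* Main.v *)
(* Let V be a simple H-module. The integral acts on V (x) V as the projection
   \sum_i b_i d_i onto the invariants, for dual bases b_i : k -> V (x) V of the
   invariants and d_i : V (x) V -> k of the invariant functionals. For invariant d,
   p_L satisfies d(p_L (u (x) h v)) = d(p_L (S^-1(h) u (x) v)) and, by the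
   pentagon, d(p_L (u (x) alpha v)) = d(u (x) v). Writing chi(nu) as a trace on
   V (x) V, these identities turn it into the sum of the traces of the zigzags
     V -> V (x) (V (x) V) -> (V (x) V) (x) V -> V
   built from b_i, Phi^-1 and d_i. By Schur's lemma the i-th zigzag is a scalar a_i,
   so chi(nu) = (\sum_i a_i) dim V. A tensor equivalence F transports b_i, d_i and
   hence a_i; and dim F(V) = dim V because dim F(W) and dim W differ by a factor
   bounded independently of W, and W can be taken to be any tensor power of V. *)

Require Import Defs.
From HB Require Import structures.
From mathcomp Require Import all_boot all_order all_algebra falgebra.
From mathcomp Require Import boolp classical_sets functions.
From mathcomp Require Import zify.

Set Implicit Arguments.
Unset Strict Implicit.
Unset Printing Implicit Defensive.

Import GRing.Theory VectorInternalTheory.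
Local Open Scope ring_scope.
Local Notation bilinear f := (bilinear_for *:%R *:%R f).

(** * Simple modules over a semisimple algebra *)

(** A tensor equivalence need not commute with the forgetful functors to vector spaces. An indicator
    is therefore split into scalars expressed by morphisms of modules, which F transports formally,
    and a dimension, which needs a separate argument. No dual modules appear: V is paired with
    itself, and the families of b_i and d_i may be empty, in which case chi(nu) = 0.

    The bound on dimensions comes from F(H). Since H is a sum of c minimal left ideals and F sends
    simple modules to simple modules, F(H) is generated by c elements. A vector w of W is determined
    by the images of these elements under F(h |-> h w), whence dim W <= c dim F(W). The opposite
    bound comes from the inverse functor.

    Semisimplicity is used as a decomposition of 1 into elements of minimal left ideals. This gives
    the integral, the splitting of nonzero maps onto a simple module, and, in characteristic zero,
    the fact that a character determines its simple module. Algebraic closure gives Schur's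
    lemma. *)

Definition mk_linear (k : fieldType) (U V : lmodType k) (f : U -> V)
    (lf : linear f) : {linear U -> V} :=
  HB.pack_for {linear U -> V} f (GRing.isLinear.Build k U V *:%R f lf).

Lemma inj_linear0 (k : fieldType) (U V : lmodType k) (f : {linear U -> V}) :
  (forall u, f u = 0 -> u = 0) -> injective f.
Proof.
by move=> f0 x y E; apply/eqP; rewrite -subr_eq0; apply/eqP/f0; rewrite linearB E subrr.
Qed.

Lemma can2_is_linear (k : fieldType) (U V : lmodType k) (f : U -> V) (g : V -> U) :
  linear f -> cancel f g -> cancel g f -> linear g.
Proof. by move=> lf fg gf a x y; apply: (can_inj fg); rewrite lf !gf. Qed.

Lemma bijP (T T' : Type) (f : T -> T') :
  injective f -> (forall y, exists x, f x = y) -> bijective f.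
Proof.
move=> fI fS; pose g y := sval (cid (fS y)).
have gK : cancel g f by move=> y; apply: (svalP (cid (fS y))).
by exists g => // x; apply: fI; rewrite gK.
Qed.

(** * Dimension as the existence of linear coordinates *)

Section FiniteDimension.
Variable k : fieldType.

(** A relation rather than a function, because the carrier of an [hmod] is a bare [lmodType]; this
    applies in particular to the values of a functor. *)
Definition has_dim (U : lmodType k) (n : nat) : Prop :=
  exists e : {linear U -> 'cV[k]_n}, bijective e.

Lemma has_dim_iso (U V : lmodType k) n (f : {linear U -> V}) :
  bijective f -> has_dim V n -> has_dim U n.
Proof. by move=> bf [e be]; exists (e \o f); apply: bij_comp. Qed.

(** The maps [g j] together embed U into the sum of c copies of V, whose coordinates form an n x c
    matrix. *)
Lemma has_dim_le (U V : lmodType k) (m n c : nat) (g : 'I_c -> {linear U -> V}) :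
  has_dim U m -> has_dim V n ->
  (forall u, (forall j, g j u = 0) -> u = 0) -> (m <= n * c)%N.
Proof.
move=> [e [e' eK e'K]] [f bf] g0.
have le' := can2_is_linear (fun a => linearP e a) eK e'K.
pose h (x : 'cV[k]_m) : 'M[k]_(n, c) := \matrix_(i, j) f (g j (e' x)) i 0.
have lh : linear h.
  by move=> a x y; apply/matrixP => i j; rewrite !mxE le' !linearP !mxE.
pose F := linfun (mk_linear lh).
have hE x : F x = h x by rewrite lfunE.
have F0 : lker F == 0%VS.
  apply/lker0P => x y; rewrite !hE => E; apply: (can_inj e'K).
  apply/eqP; rewrite -subr_eq0; apply/eqP/g0 => j.
  have [f' fK _] := bf; apply: (can_inj fK); rewrite linear0.
  apply/matrixP => i i'; rewrite (ord1 i') !linearB mxE.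
  by move/matrixP/(_ i j): E; rewrite !mxE => ->; rewrite subrr.
have := limg_dim_eq (U := fullv) (f := F); rewrite (eqP F0) capv0 => /(_ erefl) E.
have := dimvS (subvf (limg F)).
by rewrite E !dimvf /dim /= muln1.
Qed.

Lemma has_dim_inj (U V : lmodType k) (m n : nat) (g : {linear U -> V}) :
  has_dim U m -> has_dim V n -> injective g -> (m <= n)%N.
Proof.
move=> dU dV gI; rewrite -[n]muln1.
apply: (has_dim_le (g := fun _ : 'I_1 => g)) => // u /(_ ord0) E.
by apply: gI; rewrite E linear0.
Qed.

Lemma has_dim_uniq (U : lmodType k) (m n : nat) :
  has_dim U m -> has_dim U n -> m = n.
Proof.
move=> dm dn; apply/eqP; rewrite eqn_leq.
by rewrite (has_dim_inj (g := idfun) dm dn) ?(has_dim_inj (g := idfun) dn dm).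
Qed.

Lemma has_dim1 : has_dim k^o 1.
Proof.
have l1 : linear (fun c : k^o => c%:M : 'cV[k]_1).
  by move=> a x y; apply/matrixP => i j; rewrite !ord1 !mxE.
exists (mk_linear l1); exists (fun M : 'cV[k]_1 => M 0 0) => [x|M].
  by rewrite /= mxE eqxx.
by apply/matrixP => i j; rewrite !ord1 mxE eqxx.
Qed.

(** Take the least n admitting a linear map from k^n onto V. A kernel vector with nonzero j-th
    coordinate would make the j-th generator redundant, so by minimality this map is injective. *)
Lemma has_dim_onto (W : vectType k) (V : lmodType k) (f : {linear W -> V}) :
  (forall v, exists w, f w = v) -> exists n, has_dim V n.
Proof.
move=> fS.
pose P n := `[< exists g : {linear 'cV[k]_n -> V}, forall v, exists x, g x = v >].
have exP : exists n, P n.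
  exists (dim W); apply/asboolP.
  exists (f \o r2v \o trmx) => v; have [w <-] := fS v.
  by exists (v2r w)^T; rewrite /= trmxK v2rK.
have [n /asboolP[g gS] nmin] := ex_minnP exP; exists n.
have gI : injective g.
  apply: inj_linear0 => x gx0; apply/eqP/negPn/negP => x0.
  have [j xj] : exists j, x j 0 != 0.
    apply: contrapT => nx; move/eqP: x0; apply; apply/matrixP => i i'.
    rewrite (ord1 i') mxE; apply/eqP/negPn/negP => xi; by apply: nx; exists i.
  case: n g gS nmin x gx0 {x0} j xj => [|n] g gS nmin x gx0; first by case.
  move=> j xj.
  have lr : linear (fun y : 'cV[k]_n =>
      \col_i (if unlift j i is Some i' then y i' 0 else 0) : 'cV[k]_n.+1).
    move=> a y z; apply/matrixP => i i'; rewrite !mxE.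
    by case: unliftP => [i1|] _; rewrite ?mxE // mulr0 addr0.
  suff /nmin : P n by rewrite ltnn.
  apply/asboolP; exists (g \o mk_linear lr) => v.
  have [z <-] := gS v.
  (* Subtracting a multiple of the kernel vector x kills the j-th coordinate of z and keeps its
     image. *)
  pose z' := z - (z j 0 / x j 0) *: x.
  exists (\col_i z' (lift j i) 0).
  have E : mk_linear lr (\col_i z' (lift j i) 0) = z'.
    apply/matrixP => i i'; rewrite (ord1 i') !mxE.
    by case: unliftP => [i1|] ->; rewrite ?mxE // divfK // subrr.
  by rewrite -[LHS]/(g (mk_linear lr _)) E linearB linearZ /= gx0 scaler0 subr0.
have [g' gK g'K] := bijP gI gS.
by exists (mk_linear (can2_is_linear (fun a => linearP g a) gK g'K)); exists g.
Qed.

End FiniteDimension.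

(** * Morphisms, simple modules and characters *)

Section ModuleHoms.
Variables (k : fieldType) (H : algType k).
Implicit Types U V W : hmod H.

HB.instance Definition _ U h :=
  GRing.isLinear.Build k U U *:%R (@hact k H U h) (hact_linearr h).

Lemma hactDl U h h' (u : U) : hact (h + h') u = hact h u + hact h' u.
Proof. by have := hact_linearl u 1 h h'; rewrite !scale1r. Qed.

Lemma hact0l U (u : U) : hact (0 : H) u = 0.
Proof. by rewrite -(scale0r (0 : H)) hactZl scale0r. Qed.

Lemma hact_suml U (I : Type) (r : seq I) (P : pred I) (F : I -> H) (u : U) :
  hact (\sum_(i <- r | P i) F i) u = \sum_(i <- r | P i) hact (F i) u.
Proof.
by elim/big_rec2: _ => [|i y x _ <-]; rewrite ?hact0l // hactDl.
Qed.

Fact hcmb_act U V (a : k) (f g : hhom U V) h u :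
  a *: f (hact h u) + g (hact h u) = hact h (a *: f u + g u).
Proof. by rewrite !hhom_act linearD linearZ. Qed.

Definition hcmb U V a (f g : hhom U V) : hhom U V :=
  mk_hhom (linear_comb a (fun b => linearP f b) (fun b => linearP g b))
    (hcmb_act a f g).

Fact hzero_act U V h (u : U) : (0 : V) = hact h (0 : V).
Proof. by rewrite linear0. Qed.

Fact hzero_linear U V : linear (fun _ : U => 0 : V).
Proof. by move=> a x y; rewrite scaler0 addr0. Qed.

Definition hzero U V : hhom U V := mk_hhom (@hzero_linear U V) (@hzero_act U V).

Lemma hiso_bij U V (f : hhom U V) : hiso f <-> bijective f.
Proof.
split=> [[g [gf fg]]|[g gf fg]]; first by exists g.
have lg := can2_is_linear (fun a => linearP f a) gf fg.
have hg h v : g (hact h v) = hact h (g v).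
  by apply: (can_inj gf); rewrite hhom_act !fg.
by exists (mk_hhom lg hg).
Qed.

Fact hreg_linearl (u : H) : linear (fun h => h * u).
Proof. exact: (mul_bilinear H).1. Qed.
Fact hreg_linearr (h : H) : linear (fun u => h * u).
Proof. exact: (mul_bilinear H).2. Qed.
Fact hreg_actM (h h' u : H) : h * h' * u = h * (h' * u).
Proof. by rewrite mulrA. Qed.

Definition hreg : hmod H := HMod hreg_linearl hreg_linearr (@mul1r H) hreg_actM.

(** The orbit map encodes an element of U as a morphism, to which functors can be applied; u is
    recovered as the image of 1. *)
Definition horb U (u : U) : hhom hreg U :=
  @mk_hhom k H hreg U (fun h : H => hact h u) (hact_linearl u) (fun h h' => hactM h h' u).

Lemma submodule_image U V (f : hhom U V) : submodule [set v | exists u, f u = v]%classic.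
Proof.
split=> [|x y [u <-] [v <-]|h x [u <-]]; first by exists 0; rewrite linear0.
- by exists (u + v); rewrite linearD.
- by exists (hact h u); rewrite hhom_act.
Qed.

Lemma simple_onto U V (f : hhom U V) u :
  simple_hmod V -> f u != 0 -> forall v, exists u, f u = v.
Proof.
move=> [_ Vs] fu v; case: (Vs _ (submodule_image f)) => E.
  have : [set v | exists u, f u = v]%classic (f u) by exists u.
  by rewrite E => /eqP; rewrite (negPf fu).
by have : [set: V]%classic v by []; rewrite -E.
Qed.

Lemma simple_mono U V (f : hhom U V) u :
  simple_hmod U -> f u != 0 -> injective f.
Proof.
move=> [_ Us] fu; apply: inj_linear0 => w fw.
have : submodule [set w | f w = 0]%classic.
  split=> [|x y /= fx fy|h x /= fx]; first exact: linear0.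
  - by rewrite linearD fx fy addr0.
  - by rewrite hhom_act fx linear0.
case/Us => E.
  by have : [set w | f w = 0]%classic w by []; rewrite E.
by have : [set: U]%classic u by []; rewrite -E => /= /eqP; rewrite (negPf fu).
Qed.

Lemma simple_iso U V (f : hhom U V) u :
  simple_hmod U -> simple_hmod V -> f u != 0 -> hiso f.
Proof.
move=> Us Vs fu; apply/hiso_bij/bijP; first exact: simple_mono fu.
exact: simple_onto fu.
Qed.

Lemma simple_cyclic U (u v : U) :
  simple_hmod U -> u != 0 -> exists h, hact h u = v.
Proof.
move=> Us u0; apply: (simple_onto (f := horb u) (u := 1 : H)) => //.
by rewrite /= hact1.
Qed.

Lemma cyclic_simple U :
  (exists u : U, u != 0) ->
  (forall u v : U, u != 0 -> exists h, hact h u = v) -> simple_hmod U.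
Proof.
move=> U0 cyc; split=> // N [N0 ND Nact].
have [[u [Nu u0]]|nN] := pselect (exists u, N u /\ u != 0).
  right; apply/seteqP; split=> // v _.
  by have [h <-] := cyc u v u0; apply: Nact.
left; apply/seteqP; split=> [u Nu|u ->] //=.
by apply: contrapT => /eqP u0; apply: nN; exists u.
Qed.

End ModuleHoms.

Section Characters.
Variables (k : fieldType) (H : algType k).
Implicit Types U V : hmod H.

Lemma has_dim_character U n : has_dim U n ->
  exists chi : H -> k, has_character U chi.
Proof.
move=> [e be]; have [e' eK e'K] := be.
have lf h : linear (fun x : 'rV[k]_n => (e (hact h (e' x^T)))^T).
  move=> a x y; have le' := can2_is_linear (fun a => linearP e a) eK e'K.
  by rewrite linearP le' !linearP.
pose rho h : 'M[k]_n := (lin1_mx (mk_linear (lf h)))^T.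
exists (fun h => \tr (rho h)), n, e, rho; split=> // h u.
have := mul_rV_lin1 (mk_linear (lf h)) (e u)^T.
by rewrite /= trmxK eK => /(congr1 trmx); rewrite trmxK trmx_mul trmxK.
Qed.

(** With T and S the matrices of f and of its inverse, rho h = S rho2(h) T and T S = 1, so the
    traces agree. The transposes are due to [lin1_mx], which acts on row vectors. *)
Lemma character_iso U V (f : hhom U V) chi psi : hiso f ->
  has_character U chi -> has_character V psi -> chi = psi.
Proof.
move=> /hiso_bij bf [m [e [rho [be re ce]]]] [n [e2 [rho2 [be2 re2 ce2]]]].
have E : m = n.
  apply: (@has_dim_uniq _ U); first by exists e.
  by apply: (has_dim_iso bf); exists e2.
subst n; apply/funext => h; rewrite ce ce2.
have [e' eK e'K] := be; have [e2' e2K e2'K] := be2; have [f' fK f'K] := bf.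
have le' := can2_is_linear (fun a => linearP e a) eK e'K.
have lT : linear (fun x : 'rV[k]_m => (e2 (f (e' x^T)))^T).
  by move=> a x y; rewrite linearP le' !linearP.
pose T := (lin1_mx (mk_linear lT))^T.
have TE x : T *m x = e2 (f (e' x)).
  apply: trmx_inj; rewrite trmx_mul trmxK mul_rV_lin1 /= trmxK //.
have lS : linear (fun x : 'rV[k]_m => (e (f' (e2' x^T)))^T).
  have le2' := can2_is_linear (fun a => linearP e2 a) e2K e2'K.
  have lf' := can2_is_linear (fun a => linearP f a) fK f'K.
  by move=> a x y; rewrite linearP le2' lf' !linearP.
pose S := (lin1_mx (mk_linear lS))^T.
have SE x : S *m x = e (f' (e2' x)).
  apply: trmx_inj; rewrite trmx_mul trmxK mul_rV_lin1 /= trmxK //.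
have ext (A B : 'M[k]_m) : (forall x : 'cV_m, A *m x = B *m x) -> A = B.
  move=> AB; apply: trmx_inj; apply/row_matrixP => i; rewrite !rowE.
  by apply: trmx_inj; rewrite !trmx_mul !trmxK AB.
have -> : rho h = S *m (rho2 h *m T).
  apply: ext => x; rewrite -!mulmxA TE -re2 -hhom_act SE e2K fK.
  by rewrite re e'K.
rewrite mxtrace_mulC -mulmxA (_ : T *m S = 1%:M) ?mulmx1 //.
by apply: ext => x; rewrite -mulmxA SE TE eK f'K e2'K mul1mx.
Qed.

Lemma character_uniq U chi psi :
  has_character U chi -> has_character U psi -> chi = psi.
Proof. by apply: (character_iso (f := hid U)); exists (hid U). Qed.

End Characters.

(** * Consequences of the decomposition of 1 along minimal left ideals *)

Section SemisimpleAlgebra.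
Variables (k : fieldType) (H : falgType k).
Implicit Types U V : hmod H.

(** H x is a nonzero left ideal contained in I, hence equal to I. *)
Lemma minimal_cyclic (I : {vspace H}) x y :
  minimal_left_ideal I -> x \in I -> x != 0 -> y \in I -> exists g, y = g * x.
Proof.
move=> [Il _ Im] xI x0 yI.
have Jl : left_ideal (limg (amulr x)).
  move=> h z /memv_imgP[g _ ->]; rewrite lfunE /= mulrA.
  have -> : h * g * x = amulr x (h * g) by rewrite lfunE.
  refine (memv_img _ _); exact: memvf.
have xJ : x \in limg (amulr x).
  have {1}-> : x = amulr x 1 by rewrite lfunE /= mul1r.
  refine (memv_img _ _); exact: memvf.
have JI : (limg (amulr x) <= I)%VS.
  by apply/subvP => z /memv_imgP[g _ ->]; rewrite lfunE /=; apply: Il.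
case: (Im _ Jl JI) => E.
  by move: xJ; rewrite E memv0 (negPf x0).
by move: yI; rewrite -E => /memv_imgP[g _ ->]; exists g; rewrite lfunE.
Qed.

Lemma semisimple_one : semisimple H ->
  exists (n : nat) (I : 'I_n -> {vspace H}) (e : 'I_n -> H),
    [/\ forall i, minimal_left_ideal (I i), forall i, e i \in I i &
        \sum_i e i = 1].
Proof.
move=> [n [I [Im _ If]]]; exists n, I.
have /memv_sumP[e eI ->] : 1 \in (\sum_i I i)%VS by rewrite If memvf.
by exists e; split=> // i; apply: eI.
Qed.

(* A simple module generated by u is isomorphic to each minimal left ideal that
   does not kill it; s is the inverse isomorphism, which splits h |-> h u. *)
Lemma simple_section (I : {vspace H}) e U (u : U) :
  minimal_left_ideal I -> e \in I -> simple_hmod U -> hact e u != 0 ->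
  exists s : hhom U (hreg H),
    (forall z, hact (s z : H) u = z) /\ s (hact e u) = e.
Proof.
move=> Im eI Us eu0.
have u0 : u != 0 by apply: contra_neq eu0 => ->; rewrite linear0.
have [Il _ _] := Im.
have inj x y : x \in I -> y \in I -> hact x u = hact y u -> x = y.
  move=> xI yI xy; apply/eqP; rewrite -subr_eq0; apply/negPn/negP => d0.
  have [g E] := minimal_cyclic Im (rpredB xI yI) d0 eI.
  move/eqP: eu0; apply; rewrite E hactM hactDl xy -scaleN1r hactZl scaleN1r.
  by rewrite subrr linear0.
have ex z : exists x, x \in I /\ hact x u = z.
  have [h <-] := simple_cyclic z Us eu0; exists (h * e); split; first exact: Il.
  by rewrite hactM.
pose s z := sval (cid (ex z)).
have sI z : s z \in I by case: (svalP (cid (ex z))).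
have sK z : hact (s z) u = z by case: (svalP (cid (ex z))).
have ls : linear (s : U -> hreg H).
  move=> a x y; apply: inj => //; first by rewrite rpredD ?rpredZ.
  by rewrite hact_linearl !sK.
have hs h z : (s : U -> hreg H) (hact h z) = hact h (s z : hreg H).
  by apply: inj; [exact: sI | exact: Il | rewrite /= hactM !sK].
by exists (mk_hhom ls hs); split=> //=; apply: inj.
Qed.

Lemma simple_projective U (u : U) :
  semisimple H -> simple_hmod U -> u != 0 ->
  exists s : hhom U (hreg H), forall z, hact (s z : H) u = z.
Proof.
move=> /semisimple_one[n [I [e [Im eI e1]]]] Us u0.
have [i eu] : exists i, hact (e i) u != 0.
  apply: contrapT => ne; move/eqP: u0; apply.
  rewrite -[u]hact1 -e1 hact_suml big1 // => i _.
  by apply/eqP/negPn/negP => ei; apply: ne; exists i.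
by have [s [sK _]] := simple_section (Im i) (eI i) Us eu; exists s.
Qed.

Lemma simple_has_dim U : simple_hmod U -> exists n, has_dim U n.
Proof.
move=> Us; have [[u u0] _] := Us.
apply: (@has_dim_onto k H U (horb u)) => v.
by have [h hu] := simple_cyclic v Us u0; exists h.
Qed.

Lemma simple_has_character U : simple_hmod U ->
  exists chi : H -> k, has_character U chi.
Proof. by move=> /simple_has_dim[n /has_dim_character]. Qed.

Lemma has_dim_neq0 U n : has_dim U n -> (exists u : U, u != 0) -> (0 < n)%N.
Proof.
move=> [e [e' eK _]] [u u0]; case: n e e' eK => // e e' eK.
by move/eqP: u0; case; apply: (can_inj eK); apply/matrixP => -[].
Qed.

(* The sum of the components of 1 that do not kill U acts as 1 on U, and as 0
   on each simple module that is not isomorphic to U. *)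
Lemma character_inj U V chi : [pchar k] =i pred0 -> semisimple H ->
  simple_hmod U -> simple_hmod V ->
  has_character U chi -> has_character V chi -> exists f : hhom U V, hiso f.
Proof.
move=> k0 /semisimple_one[n [I [e [Im eI e1]]]] Us Vs cU cV.
apply: contrapT => nUV.
pose J i := `[< exists u : U, hact (e i) u != 0 >].
pose z := \sum_(i | J i) e i.
have zU (u : U) : hact z u = u.
  rewrite -[RHS]hact1 -e1 !hact_suml big_mkcond; apply: eq_bigr => i _.
  case: ifPn => // /asboolPn nJ; apply/esym/eqP/negPn/negP => eu.
  by apply: nJ; exists u.
have zV (v : V) : hact z v = 0.
  rewrite hact_suml big1 // => i /asboolP[u eu].
  apply/eqP/negPn/negP => ev; apply: nUV.
  have [s [sK se]] := simple_section (Im i) (eI i) Us eu.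
  exists (hcomp (horb v) s); apply: (simple_iso (u := hact (e i) u)) => //.
  by rewrite /= se.
have [m [f [rho [[f' fK f'K] fr cr]]]] := cU.
have [m2 [f2 [rho2 [[f2' f2K f2'K] fr2 cr2]]]] := cV.
have m0 : (0 < m)%N.
  by apply: has_dim_neq0 (proj1 Us); exists f; exists f'.
have mxE0 p (A B : 'M[k]_p) : (forall x : 'cV_p, A *m x = B *m x) -> A = B.
  move=> AB; apply: trmx_inj; apply/row_matrixP => i; rewrite !rowE.
  by apply: trmx_inj; rewrite !trmx_mul !trmxK AB.
have r1 : rho z = 1%:M.
  by apply: mxE0 => x; rewrite -[x]f'K -fr zU mul1mx.
have r2 : rho2 z = 0.
  by apply: mxE0 => x; rewrite -[x]f2'K -fr2 zV linear0 mul0mx.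
(* The two expressions for chi(z) give dim U = 0 in k, which characteristic zero excludes. *)
have := cr z; rewrite cr2 r1 r2 mxtrace0 mxtrace1 => /eqP.
by rewrite eq_sym ((pcharf0P k).1 k0) eqn0Ngt m0.
Qed.

End SemisimpleAlgebra.

Section Integral.
Variables (k : fieldType) (H : falgType k) (Q : quasi_bialgebra H).

(* The integral is the sum of the components of 1 in the minimal left ideals
   on which H acts through the counit. *)
Lemma exists_integral : semisimple H -> exists l : H,
  (forall h, h * l = counit Q h *: l /\ l * h = counit Q h *: l) /\
  counit Q l = 1.
Proof.
move=> /semisimple_one[n [I [e [Im eI e1]]]].
pose eps := counit Q.
pose T i := `[< forall h x, x \in I i -> h * x = eps h *: x >].
(* A nonzero x of this kind would generate [I i], and H would act on all of it through the
   counit. *)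
have nT1 i x : ~~ T i -> x \in I i -> (forall h, h * x = eps h *: x) -> x = 0.
  move=> /asboolPn nT xI hx; apply/eqP/negPn/negP => x0; apply: nT => h y yI.
  have [g ->] := minimal_cyclic (Im i) xI x0 yI.
  by rewrite mulrA !hx rmorphM scalerA.
(* Some h x - eps(h) x in [I i] is nonzero, hence generates [I i]; the counit kills it, and so all
   of [I i]. *)
have nT2 i y : ~~ T i -> y \in I i -> eps y = 0.
  move=> /asboolPn nT yI; apply: contrapT => /eqP ey; apply: nT => h x xI.
  apply/eqP; rewrite -subr_eq0; apply/negPn/negP => x0.
  have [Il _ _] := Im i.
  have xI' : h * x - eps h *: x \in I i by rewrite rpredB ?rpredZ ?Il.
  have [g E] := minimal_cyclic (Im i) xI' x0 yI.
  move/eqP: ey; apply; rewrite E rmorphM rmorphB rmorphM /= linearZ.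
  by rewrite subrr mulr0.
pose l := \sum_(i | T i) e i.
have hl h : h * l = eps h *: l.
  rewrite mulr_sumr scaler_sumr; apply: eq_bigr => i /asboolP; exact.
have l1 : 1 = l + \sum_(i | ~~ T i) e i by rewrite -e1 (bigID T).
exists l; split=> [h|]; last first.
  have -> : l = 1 - \sum_(i | ~~ T i) e i by rewrite [1]l1 addrK.
  rewrite linearB rmorph1 linear_sum big1 ?subr0 // => i nTi.
  exact: nT2 (eI i).
(* Expanding 1 gives l h = l h l + sum of the l h e_i over the i outside T. Each l h e_i lies in
   [I i] and H acts on it through the counit, so it vanishes by [nT1]. *)
split=> //; rewrite -{1}[h]mulr1 {1}l1 mulrDr hl mulrDr -scalerAr.
have ll : l * l = l.
  rewrite hl (_ : eps l = 1) ?scale1r //.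
  have -> : l = 1 - \sum_(i | ~~ T i) e i by rewrite [1]l1 addrK.
  rewrite linearB rmorph1 linear_sum big1 ?subr0 // => i nTi.
  exact: nT2 (eI i).
rewrite ll mulrA mulr_sumr big1 ?addr0 // => i nTi.
have [Il _ _] := Im i.
by apply: (nT1 i) => // [|g]; rewrite ?Il // !mulrA hl -!scalerAl.
Qed.

End Integral.

(** * Identities in a quasi-Hopf algebra *)

Section Linearity.
Variable k : fieldType.

(** This lemma and the similar ones below have the shape of [linear], so that rewriting with them
    closes the linearity goals left when an identity is reduced to pure tensors. *)
Lemma mulPl (A : algType k) (c : k) (x y z : A) :
  (c *: x + y) * z = c *: (x * z) + y * z.
Proof. by rewrite mulrDl scalerAl. Qed.

Lemma mulPr (A : algType k) (c : k) (x y z : A) :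
  z * (c *: x + y) = c *: (z * x) + z * y.
Proof. by rewrite mulrDr scalerAr. Qed.

Lemma purePl (U V : lmodType k) (c : k) (x y : U) (v : V) :
  (c *: x + y) ⊗ v = c *: (x ⊗ v) + y ⊗ v.
Proof. exact: (pure_bilinear U V).1. Qed.

Lemma purePr (U V : lmodType k) (c : k) (x y : V) (u : U) :
  u ⊗ (c *: x + y) = c *: (u ⊗ x) + u ⊗ y.
Proof. exact: (pure_bilinear U V).2. Qed.

Lemma pureZl (U V : lmodType k) (c : k) (u : U) (v : V) :
  (c *: u) ⊗ v = c *: (u ⊗ v).
Proof. exact: (GRing.scalable_linear ((pure_bilinear U V).1 v)). Qed.

Lemma pureZr (U V : lmodType k) (c : k) (u : U) (v : V) :
  u ⊗ (c *: v) = c *: (u ⊗ v).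
Proof. exact: (GRing.scalable_linear ((pure_bilinear U V).2 u)). Qed.

Lemma scalePl (V : lmodType k) (c a b : k) (v : V) :
  (c * a + b) *: v = c *: (a *: v) + b *: v.
Proof. by rewrite scalerDl scalerA. Qed.

Lemma scalePr (V : lmodType k) (c a : k) (u v : V) :
  a *: (c *: u + v) = c *: (a *: u) + a *: v.
Proof. by rewrite scalerDr !scalerA mulrC. Qed.

Definition trilinear (U V W X : lmodType k) (f : U -> V -> W -> X) :=
  [/\ forall v w, linear (fun u => f u v w), forall u w, linear (fun v => f u v w)
    & forall u v, linear (f u v)].

Definition tsum3 (U V W X : lmodType k) (f : U -> V -> W -> X) (t : (U ⊗ V ⊗ W)%type) : X :=
  tsum (fun uv w => tsum (fun u v => f u v w) uv) t.

Section Tsum3.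
Variables (U V W X : lmodType k) (f : U -> V -> W -> X).
Hypothesis tf : trilinear f.

Let b (w : W) : bilinear (fun u v => f u v w).
Proof. by case: tf => f1 f2 f3; split=> [v|u]; [apply: f1 | apply: f2]. Qed.

Let B : bilinear (fun uv (w : W) => tsum (fun u v => f u v w) uv).
Proof.
split=> [w|uv] a x y; first exact: tsum_linear (b w) a x y.
move: uv; apply: tensor_ext => [||u v]; first exact: tsum_linear.
- by apply: linear_comb; apply: tsum_linear.
- by rewrite !tsum_pure //; case: tf => _ _ f3; apply: f3.
Qed.

Lemma tsum3_linear : linear (tsum3 f).
Proof. exact: tsum_linear. Qed.

Lemma tsum3E u v w : tsum3 f (u ⊗ v ⊗ w) = f u v w.
Proof. by rewrite /tsum3 !tsum_pure. Qed.

End Tsum3.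

Lemma tensor_ext4 (U V W X Y : lmodType k) (f g : (U ⊗ V ⊗ W ⊗ X)%type -> Y) :
  linear f -> linear g ->
  (forall u v w x, f (u ⊗ v ⊗ w ⊗ x) = g (u ⊗ v ⊗ w ⊗ x)) -> f =1 g.
Proof.
move=> lf lg E; apply: tensor_ext => // uvw x; move: uvw.
by apply: tensor_ext3 => [a s t|a s t|//]; rewrite purePl ?lf ?lg.
Qed.

End Linearity.

Section TensorInterface.
Variables (k : fieldType) (H : algType k).

Definition quadrilinear (X : lmodType k) (f : H -> H -> H -> H -> X) :=
  [/\ forall b c d, linear (fun a => f a b c d),
      forall a c d, linear (fun b => f a b c d),
      forall a b d, linear (fun c => f a b c d)
    & forall a b c, linear (f a b c)].

(* The tensor powers of H, known only through their universal property: on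
   the concrete iterated tensor products, unification is very slow. *)
Record tensor2 := Tensor2 {
  A2 :> algType k;
  pure2 : H -> H -> A2;
  lift2 : forall X : lmodType k, (H -> H -> X) -> A2 -> X;
  pure2_bilinear : bilinear pure2;
  lift2_linear : forall (X : lmodType k) (f : H -> H -> X), bilinear f -> linear (lift2 f);
  lift2E : forall (X : lmodType k) (f : H -> H -> X) a b,
    bilinear f -> lift2 f (pure2 a b) = f a b;
  ext2 : forall (X : lmodType k) (f g : A2 -> X), linear f -> linear g ->
    (forall a b, f (pure2 a b) = g (pure2 a b)) -> f =1 g;
  pure2M : forall a b a' b',
    pure2 a b * pure2 a' b' = pure2 (a * a') (b * b');
  pure2_1 : pure2 1 1 = 1
}.

Record tensor3 := Tensor3 {
  A3 :> algType k;
  pure3 : H -> H -> H -> A3;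
  lift3 : forall X : lmodType k, (H -> H -> H -> X) -> A3 -> X;
  pure3_trilinear : trilinear pure3;
  lift3_linear : forall (X : lmodType k) (f : H -> H -> H -> X), trilinear f -> linear (lift3 f);
  lift3E : forall (X : lmodType k) (f : H -> H -> H -> X) a b c,
    trilinear f -> lift3 f (pure3 a b c) = f a b c;
  ext3 : forall (X : lmodType k) (f g : A3 -> X), linear f -> linear g ->
    (forall a b c, f (pure3 a b c) = g (pure3 a b c)) -> f =1 g;
  pure3M : forall a b c a' b' c',
    pure3 a b c * pure3 a' b' c' = pure3 (a * a') (b * b') (c * c');
  pure3_1 : pure3 1 1 1 = 1
}.

Record tensor4 := Tensor4 {
  A4 :> algType k;
  pure4 : H -> H -> H -> H -> A4;
  lift4 : forall X : lmodType k, (H -> H -> H -> H -> X) -> A4 -> X;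
  pure4_quadrilinear : quadrilinear pure4;
  lift4_linear : forall (X : lmodType k) (f : H -> H -> H -> H -> X),
    quadrilinear f -> linear (lift4 f);
  lift4E : forall (X : lmodType k) (f : H -> H -> H -> H -> X) a b c d,
    quadrilinear f -> lift4 f (pure4 a b c d) = f a b c d;
  ext4 : forall (X : lmodType k) (f g : A4 -> X), linear f -> linear g ->
    (forall a b c d, f (pure4 a b c d) = g (pure4 a b c d)) -> f =1 g;
  pure4M : forall a b c d a' b' c' d',
    pure4 a b c d * pure4 a' b' c' d' = pure4 (a * a') (b * b') (c * c') (d * d');
  pure4_1 : pure4 1 1 1 1 = 1
}.

Arguments lift2 t {X} f.
Arguments lift2_linear t {X f}.
Arguments lift2E t {X f}.
Arguments lift3 t {X} f.
Arguments lift3_linear t {X f}.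
Arguments lift3E t {X f}.
Arguments lift4 t {X} f.
Arguments lift4_linear t {X f}.
Arguments lift4E t {X f}.

Lemma pure2P1 (T : tensor2) c x y b :
  pure2 T (c *: x + y) b = c *: pure2 T x b + pure2 T y b.
Proof. exact: (pure2_bilinear T).1. Qed.
Lemma pure2P2 (T : tensor2) c x y a :
  pure2 T a (c *: x + y) = c *: pure2 T a x + pure2 T a y.
Proof. exact: (pure2_bilinear T).2. Qed.
Lemma pure3P1 (T : tensor3) t x y b c :
  pure3 T (t *: x + y) b c = t *: pure3 T x b c + pure3 T y b c.
Proof. by case: (pure3_trilinear T) => l _ _; apply: l. Qed.
Lemma pure3P2 (T : tensor3) t x y a c :
  pure3 T a (t *: x + y) c = t *: pure3 T a x c + pure3 T a y c.
Proof. by case: (pure3_trilinear T) => _ l _; apply: l. Qed.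
Lemma pure3P3 (T : tensor3) t x y a b :
  pure3 T a b (t *: x + y) = t *: pure3 T a b x + pure3 T a b y.
Proof. by case: (pure3_trilinear T) => _ _ l; apply: l. Qed.
Lemma pure4P1 (T : tensor4) t x y b c d :
  pure4 T (t *: x + y) b c d = t *: pure4 T x b c d + pure4 T y b c d.
Proof. by case: (pure4_quadrilinear T) => l _ _ _; apply: l. Qed.
Lemma pure4P2 (T : tensor4) t x y a c d :
  pure4 T a (t *: x + y) c d = t *: pure4 T a x c d + pure4 T a y c d.
Proof. by case: (pure4_quadrilinear T) => _ l _ _; apply: l. Qed.
Lemma pure4P3 (T : tensor4) t x y a b d :
  pure4 T a b (t *: x + y) d = t *: pure4 T a b x d + pure4 T a b y d.
Proof. by case: (pure4_quadrilinear T) => _ _ l _; apply: l. Qed.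
Lemma pure4P4 (T : tensor4) t x y a b c :
  pure4 T a b c (t *: x + y) = t *: pure4 T a b c x + pure4 T a b c y.
Proof. by case: (pure4_quadrilinear T) => _ _ _ l; apply: l. Qed.

Lemma lift2_param (T : tensor2) (W X : lmodType k) (f : W -> H -> H -> X) t :
  (forall w, bilinear (f w)) -> (forall a b, linear (fun w => f w a b)) ->
  linear (fun w => lift2 T (f w) t).
Proof.
move=> bf lf c x y; move: t; apply: ext2 => [||a b]; try exact: lift2_linear.
  by apply: linear_comb; apply: lift2_linear.
by rewrite !lift2E // lf.
Qed.

End TensorInterface.

Arguments pure2 {k H} t.
Arguments lift2 {k H} t {X} f.
Arguments lift2_linear {k H} t {X f}.
Arguments lift2E {k H} t {X f}.
Arguments pure3 {k H} t.
Arguments lift3 {k H} t {X} f.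
Arguments lift3_linear {k H} t {X f}.
Arguments lift3E {k H} t {X f}.
Arguments pure4 {k H} t.
Arguments lift4 {k H} t {X} f.
Arguments lift4_linear {k H} t {X f}.
Arguments lift4E {k H} t {X f}.

Definition pureP := (pure2P1, pure2P2, pure3P1, pure3P2, pure3P3,
  pure4P1, pure4P2, pure4P3, pure4P4, mulPl, mulPr, scalePl, scalePr).

(** * Contracting the pentagon with the antipode axioms *)

Section QuasiHopfCalculus.
Variables (k : fieldType) (H : algType k).
Variables (T2 : tensor2 H) (T3 : tensor3 H) (T4 : tensor4 H).
Variables (S Si : H -> H) (alpha beta : H) (eps : H -> k) (D : H -> T2).
Variables Phi PhiV : T3.

Local Notation p2 := (pure2 T2).
Local Notation p3 := (pure3 T3).
Local Notation p4 := (pure4 T4).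

(** [cop1] and [cop2] apply the coproduct to the leg that they name; [cop12], [cop23], [cop34] name
    the two legs that it produces. Thus [cop23] is id (x) D (x) id. *)
Definition cop1 : T2 -> T3 :=
  lift2 T2 (fun a b => lift2 T2 (fun a1 a2 => p3 a1 a2 b) (D a)).
Definition cop2 : T2 -> T3 :=
  lift2 T2 (fun a b => lift2 T2 (fun b1 b2 => p3 a b1 b2) (D b)).
Definition cop12 : T3 -> T4 :=
  lift3 T3 (fun a b c => lift2 T2 (fun a1 a2 => p4 a1 a2 b c) (D a)).
Definition cop23 : T3 -> T4 :=
  lift3 T3 (fun a b c => lift2 T2 (fun b1 b2 => p4 a b1 b2 c) (D b)).
Definition cop34 : T3 -> T4 :=
  lift3 T3 (fun a b c => lift2 T2 (fun c1 c2 => p4 a b c1 c2) (D c)).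
Definition padl : T3 -> T4 := lift3 T3 (fun a b c => p4 1 a b c).
Definition padr : T3 -> T4 := lift3 T3 (fun a b c => p4 a b c 1).

Hypothesis SK : cancel S Si.
Hypothesis S_linear : linear S.
Hypothesis Si_linear : linear Si.
Hypothesis S1 : S 1 = 1.
Hypothesis SM : forall x y, S (x * y) = S y * S x.
Hypothesis SiM : forall x y, Si (x * y) = Si y * Si x.
Hypothesis epsP : forall a x y, eps (a *: x + y) = a * eps x + eps y.
Hypothesis eps1 : eps 1 = 1.
Hypothesis epsM : forall x y, eps (x * y) = eps x * eps y.
Hypothesis D_linear : linear D.
Hypothesis D1 : D 1 = 1.
Hypothesis D_counitl : forall h, lift2 T2 (fun a b => eps a *: b) (D h) = h.
Hypothesis D_counitr : forall h, lift2 T2 (fun a b => eps b *: a) (D h) = h.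
Hypothesis D_alpha :
  forall h, lift2 T2 (fun a b => S a * alpha * b) (D h) = eps h *: alpha.
Hypothesis D_beta :
  forall h, lift2 T2 (fun a b => a * beta * S b) (D h) = eps h *: beta.
Hypothesis PhiVK : Phi * PhiV = 1.
Hypothesis PhiVP : PhiV * Phi = 1.
Hypothesis PhiV_antipode :
  lift3 T3 (fun x y z => S x * alpha * y * beta * S z) PhiV = 1.
Hypothesis coassoc : forall h, Phi * cop1 (D h) = cop2 (D h) * Phi.
Hypothesis pentagon :
  cop34 Phi * cop12 Phi = padl Phi * cop23 Phi * padr Phi.
Hypothesis Phi_counit : lift3 T3 (fun a b c => eps b *: p2 a c) Phi = 1.

Let simP := (pureP, S_linear, Si_linear, epsP, D_linear).

Ltac ml := by move=> ? ? ?; rewrite /= ?simP.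
Ltac mlin := by split=> * ? ? ?; rewrite /= ?simP.

Ltac cop :=
  split=> *; rewrite /=;
  first [ by apply: lift2_param => *; [mlin | ml]
        | by refine (linear_cmp D_linear (lift2_linear T2 _)); mlin ].

Let cop1_bi : bilinear (fun a b => lift2 T2 (fun a1 a2 => p3 a1 a2 b) (D a)).
Proof. cop. Qed.
Let cop2_bi : bilinear (fun a b => lift2 T2 (fun b1 b2 => p3 a b1 b2) (D b)).
Proof. cop. Qed.
Let cop12_tri :
  trilinear (fun a b c => lift2 T2 (fun a1 a2 => p4 a1 a2 b c) (D a)).
Proof. cop. Qed.
Let cop23_tri :
  trilinear (fun a b c => lift2 T2 (fun b1 b2 => p4 a b1 b2 c) (D b)).
Proof. cop. Qed.
Let cop34_tri :
  trilinear (fun a b c => lift2 T2 (fun c1 c2 => p4 a b c1 c2) (D c)).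
Proof. cop. Qed.
Let padl_tri : trilinear (fun a b c => p4 1 a b c). Proof. mlin. Qed.
Let padr_tri : trilinear (fun a b c => p4 a b c 1). Proof. mlin. Qed.

Let cop1P := lift2_linear T2 cop1_bi : linear cop1.
Let cop2P := lift2_linear T2 cop2_bi : linear cop2.
Let cop12P := lift3_linear T3 cop12_tri : linear cop12.
Let cop23P := lift3_linear T3 cop23_tri : linear cop23.
Let cop34P := lift3_linear T3 cop34_tri : linear cop34.
Let padlP := lift3_linear T3 padl_tri : linear padl.
Let padrP := lift3_linear T3 padr_tri : linear padr.

(** This lemma and its analogues serve to recognize the maps that the axioms of a quasi-bialgebra
    build from [tmap] and [tassocV]. *)
Lemma cop1_eq (F : T2 -> T3) : linear F ->
  (forall a b, F (p2 a b) = lift2 T2 (fun a1 a2 => p3 a1 a2 b) (D a)) -> F =1 cop1.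
Proof.
move=> lF FE; apply: ext2 => [||a b]; [exact: lF | exact: cop1P |].
by rewrite FE /cop1 lift2E.
Qed.

Lemma cop2_eq (F : T2 -> T3) : linear F ->
  (forall a b, F (p2 a b) = lift2 T2 (fun b1 b2 => p3 a b1 b2) (D b)) -> F =1 cop2.
Proof.
move=> lF FE; apply: ext2 => [||a b]; [exact: lF | exact: cop2P |].
by rewrite FE /cop2 lift2E.
Qed.

Lemma cop12_eq (F : T3 -> T4) : linear F ->
  (forall a b c, F (p3 a b c) = lift2 T2 (fun a1 a2 => p4 a1 a2 b c) (D a)) -> F =1 cop12.
Proof.
move=> lF FE; apply: ext3 => [||a b c]; [exact: lF | exact: cop12P |].
by rewrite FE /cop12 lift3E.
Qed.

Lemma cop23_eq (F : T3 -> T4) : linear F ->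
  (forall a b c, F (p3 a b c) = lift2 T2 (fun b1 b2 => p4 a b1 b2 c) (D b)) -> F =1 cop23.
Proof.
move=> lF FE; apply: ext3 => [||a b c]; [exact: lF | exact: cop23P |].
by rewrite FE /cop23 lift3E.
Qed.

Lemma cop34_eq (F : T3 -> T4) : linear F ->
  (forall a b c, F (p3 a b c) = lift2 T2 (fun c1 c2 => p4 a b c1 c2) (D c)) -> F =1 cop34.
Proof.
move=> lF FE; apply: ext3 => [||a b c]; [exact: lF | exact: cop34P |].
by rewrite FE /cop34 lift3E.
Qed.

Lemma padl_eq (F : T3 -> T4) : linear F ->
  (forall a b c, F (p3 a b c) = p4 1 a b c) -> F =1 padl.
Proof.
move=> lF FE; apply: ext3 => [||a b c]; [exact: lF | exact: padlP |].
by rewrite FE /padl lift3E.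
Qed.

Lemma padr_eq (F : T3 -> T4) : linear F ->
  (forall a b c, F (p3 a b c) = p4 a b c 1) -> F =1 padr.
Proof.
move=> lF FE; apply: ext3 => [||a b c]; [exact: lF | exact: padrP |].
by rewrite FE /padr lift3E.
Qed.

(** In [ce3_i] and [ce4_i] the counit removes the i-th leg. *)
Let ce3_1 : T3 -> T2 := lift3 T3 (fun a b c => eps a *: p2 b c).
Let ce3_2 : T3 -> T2 := lift3 T3 (fun a b c => eps b *: p2 a c).
Let ce3_3 : T3 -> T2 := lift3 T3 (fun a b c => eps c *: p2 a b).
Let ce4_2 : T4 -> T3 := lift4 T4 (fun a b c d => eps b *: p3 a c d).
Let ce4_3 : T4 -> T3 := lift4 T4 (fun a b c d => eps c *: p3 a b d).

Let ce3_1t : trilinear (fun a b c => eps a *: p2 b c). Proof. mlin. Qed.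
Let ce3_2t : trilinear (fun a b c => eps b *: p2 a c). Proof. mlin. Qed.
Let ce3_3t : trilinear (fun a b c => eps c *: p2 a b). Proof. mlin. Qed.
Let ce4_2t : quadrilinear (fun a b c d => eps b *: p3 a c d). Proof. mlin. Qed.
Let ce4_3t : quadrilinear (fun a b c d => eps c *: p3 a b d). Proof. mlin. Qed.
Let ce3_1P : linear ce3_1 := lift3_linear T3 ce3_1t.
Let ce3_2P : linear ce3_2 := lift3_linear T3 ce3_2t.
Let ce3_3P : linear ce3_3 := lift3_linear T3 ce3_3t.
Let ce4_2P : linear ce4_2 := lift4_linear T4 ce4_2t.
Let ce4_3P : linear ce4_3 := lift4_linear T4 ce4_3t.
Let ce3_1E a b c : ce3_1 (p3 a b c) = eps a *: p2 b c := lift3E T3 _ _ _ ce3_1t.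
Let ce3_2E a b c : ce3_2 (p3 a b c) = eps b *: p2 a c := lift3E T3 _ _ _ ce3_2t.
Let ce3_3E a b c : ce3_3 (p3 a b c) = eps c *: p2 a b := lift3E T3 _ _ _ ce3_3t.
Let ce4_2E a b c d : ce4_2 (p4 a b c d) = eps b *: p3 a c d :=
  lift4E T4 _ _ _ _ ce4_2t.
Let ce4_3E a b c d : ce4_3 (p4 a b c d) = eps c *: p3 a b d :=
  lift4E T4 _ _ _ _ ce4_3t.

Let linP := (simP, cop1P, cop2P, cop12P, cop23P, cop34P, padlP, padrP,
  ce3_1P, ce3_2P, ce3_3P, ce4_2P, ce4_3P).

Ltac lin := by move=> ? ? ?; rewrite ?linP.

Let ce4_2M s t : ce4_2 (s * t) = ce4_2 s * ce4_2 t.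
Proof.
move: t; apply: ext4 => [||a b c d]; [lin|lin|].
move: s; apply: ext4 => [||a' b' c' d']; [lin|lin|].
by rewrite pure4M !ce4_2E epsM -scalerAl -scalerAr scalerA pure3M.
Qed.

Let ce4_3M s t : ce4_3 (s * t) = ce4_3 s * ce4_3 t.
Proof.
move: t; apply: ext4 => [||a b c d]; [lin|lin|].
move: s; apply: ext4 => [||a' b' c' d']; [lin|lin|].
by rewrite pure4M !ce4_3E epsM -scalerAl -scalerAr scalerA pure3M.
Qed.

Let lift2_comp (X Y : lmodType k) (F : X -> Y) (f : H -> H -> X) t :
  linear F -> bilinear f -> F (lift2 T2 f t) = lift2 T2 (fun a b => F (f a b)) t.
Proof.
move=> lF bf.
have bF : bilinear (fun a b => F (f a b)).
  by split=> [b|a] c x y; rewrite /= ?bf.1 ?bf.2 /= ?lF // (bf.1 b) lF.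
move: t; apply: ext2 => [||a b].
- exact: linear_cmp (lift2_linear T2 bf) lF.
- exact: lift2_linear.
by rewrite !lift2E.
Qed.

Let lift2_counitl (X : lmodType k) (F : H -> X) h : linear F ->
  lift2 T2 (fun a b => eps a *: F b) (D h) = F h.
Proof.
move=> lF; rewrite -[in RHS](D_counitl h) lift2_comp //; last by mlin.
congr (lift2 T2 _ _); apply/funext => a; apply/funext => b.
by rewrite (GRing.scalable_linear lF).
Qed.

Let lift2_counitr (X : lmodType k) (F : H -> X) h : linear F ->
  lift2 T2 (fun a b => eps b *: F a) (D h) = F h.
Proof.
move=> lF; rewrite -[in RHS](D_counitr h) lift2_comp //; last by mlin.
congr (lift2 T2 _ _); apply/funext => a; apply/funext => b.
by rewrite (GRing.scalable_linear lF).
Qed.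

(** The axiom concerns the middle leg; the outer legs follow from the pentagon. Removing its second
    leg by the counit leaves Phi = (1 (x) [ce3_1 Phi]) Phi, and Phi can be cancelled. *)
Lemma assoc_counitl : ce3_1 Phi = 1.
Proof.
have E34 s : ce4_2 (cop34 s) = cop2 (ce3_2 s).
  move: s; apply: ext3 => [||a b c]; [lin|lin|].
  rewrite /cop34 lift3E // lift2_comp //; [|mlin].
  rewrite ce3_2E (GRing.scalable_linear cop2P) /cop2 lift2E //.
  rewrite [RHS](lift2_comp (F := fun w => eps b *: w)); [|lin|mlin].
  by congr (lift2 T2 _ _); do 2!apply/funext => ?; rewrite ce4_2E.
have E12 s : ce4_2 (cop12 s) = s.
  move: s; apply: ext3 => [||a b c]; [lin|lin|].
  rewrite /cop12 lift3E // lift2_comp //; [|mlin].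
  rewrite -(@lift2_counitr _ (fun a => p3 a b c)); last lin.
  by congr (lift2 T2 _ _); do 2!apply/funext => ?; rewrite ce4_2E.
have E23 s : ce4_2 (cop23 s) = s.
  move: s; apply: ext3 => [||a b c]; [lin|lin|].
  rewrite /cop23 lift3E // lift2_comp //; [|mlin].
  rewrite -(@lift2_counitl _ (fun b => p3 a b c)); last lin.
  by congr (lift2 T2 _ _); do 2!apply/funext => ?; rewrite ce4_2E.
pose ins3 (x : T2) : T3 := lift2 T2 (fun a b => p3 a b 1) x.
pose ins1 (x : T2) : T3 := lift2 T2 (fun a b => p3 1 a b) x.
have ins3P : linear ins3 by apply: lift2_linear; mlin.
have ins1P : linear ins1 by apply: lift2_linear; mlin.
have Er s : ce4_2 (padr s) = ins3 (ce3_2 s).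
  move: s; apply: ext3 => [||a b c]; [lin|by move=> ? ? ?; rewrite ce3_2P ins3P|].
  rewrite /padr lift3E // ce4_2E ce3_2E (GRing.scalable_linear ins3P).
  by rewrite /ins3 lift2E //; mlin.
have El s : ce4_2 (padl s) = ins1 (ce3_1 s).
  move: s; apply: ext3 => [||a b c]; [lin|by move=> ? ? ?; rewrite ce3_1P ins1P|].
  rewrite /padl lift3E // ce4_2E ce3_1E (GRing.scalable_linear ins1P).
  by rewrite /ins1 lift2E //; mlin.
have := congr1 ce4_2 pentagon; rewrite !ce4_2M E34 E12 E23 Er El.
have cop21 : cop2 1 = 1.
  by rewrite -pure2_1 /cop2 lift2E // D1 -pure2_1 lift2E ?pure3_1 //; mlin.
have ins31 : ins3 1 = 1 by rewrite -pure2_1 /ins3 lift2E ?pure3_1 //; mlin.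
rewrite (_ : ce3_2 Phi = 1) // cop21 mul1r ins31 mulr1 => E.
have {}E : 1 = ins1 (ce3_1 Phi).
  by rewrite -PhiVK {1}E -mulrA PhiVK mulr1.
have K x : ce3_1 (ins1 x) = x.
  move: x; apply: ext2 => [||a b]; [by move=> ? ? ?; rewrite ins1P ce3_1P|lin|].
  by rewrite /ins1 lift2E ?ce3_1E ?eps1 ?scale1r //; mlin.
rewrite -[LHS]K -E -pure3_1 ce3_1E eps1 scale1r pure2_1 //.
Qed.

(** Same argument with the third leg of the pentagon, which leaves Phi = Phi ([ce3_3 Phi] (x) 1). *)
Lemma assoc_counitr : ce3_3 Phi = 1.
Proof.
have E12 s : ce4_3 (cop12 s) = cop1 (ce3_2 s).
  move: s; apply: ext3 => [||a b c]; [lin|lin|].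
  rewrite /cop12 lift3E // lift2_comp //; [|mlin].
  rewrite ce3_2E (GRing.scalable_linear cop1P) /cop1 lift2E //.
  rewrite [RHS](lift2_comp (F := fun w => eps b *: w)); [|lin|mlin].
  by congr (lift2 T2 _ _); do 2!apply/funext => ?; rewrite ce4_3E.
have E34 s : ce4_3 (cop34 s) = s.
  move: s; apply: ext3 => [||a b c]; [lin|lin|].
  rewrite /cop34 lift3E // lift2_comp //; [|mlin].
  rewrite -(@lift2_counitl _ (fun c => p3 a b c)); last lin.
  by congr (lift2 T2 _ _); do 2!apply/funext => ?; rewrite ce4_3E.
have E23 s : ce4_3 (cop23 s) = s.
  move: s; apply: ext3 => [||a b c]; [lin|lin|].
  rewrite /cop23 lift3E // lift2_comp //; [|mlin].
  rewrite -(@lift2_counitr _ (fun b => p3 a b c)); last lin.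
  by congr (lift2 T2 _ _); do 2!apply/funext => ?; rewrite ce4_3E.
pose ins3 (x : T2) : T3 := lift2 T2 (fun a b => p3 a b 1) x.
pose ins1 (x : T2) : T3 := lift2 T2 (fun a b => p3 1 a b) x.
have ins3P : linear ins3 by apply: lift2_linear; mlin.
have ins1P : linear ins1 by apply: lift2_linear; mlin.
have Er s : ce4_3 (padr s) = ins3 (ce3_3 s).
  move: s; apply: ext3 => [||a b c]; [lin|by move=> ? ? ?; rewrite ce3_3P ins3P|].
  rewrite /padr lift3E // ce4_3E ce3_3E (GRing.scalable_linear ins3P).
  by rewrite /ins3 lift2E //; mlin.
have El s : ce4_3 (padl s) = ins1 (ce3_2 s).
  move: s; apply: ext3 => [||a b c]; [lin|by move=> ? ? ?; rewrite ce3_2P ins1P|].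
  rewrite /padl lift3E // ce4_3E ce3_2E (GRing.scalable_linear ins1P).
  by rewrite /ins1 lift2E //; mlin.
have := congr1 ce4_3 pentagon; rewrite !ce4_3M E34 E12 E23 Er El.
have cop11 : cop1 1 = 1.
  by rewrite -pure2_1 /cop1 lift2E // D1 -pure2_1 lift2E ?pure3_1 //; mlin.
have ins11 : ins1 1 = 1 by rewrite -pure2_1 /ins1 lift2E ?pure3_1 //; mlin.
rewrite (_ : ce3_2 Phi = 1) // cop11 ins11 mulr1 mul1r => E.
have {}E : 1 = ins3 (ce3_3 Phi).
  by rewrite -PhiVP {1}E mulrA PhiVP mul1r.
have K x : ce3_3 (ins3 x) = x.
  move: x; apply: ext2 => [||a b]; [by move=> ? ? ?; rewrite ins3P ce3_3P|lin|].
  by rewrite /ins3 lift2E ?ce3_3E ?eps1 ?scale1r //; mlin.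
by rewrite -[LHS]K -E -pure3_1 ce3_3E eps1 scale1r pure2_1.
Qed.

(** [pL Phi] is the element [p_L]. A variable argument allows the rules below to be checked on pure
    tensors. *)
Definition pL (s : T3) : T2 := lift3 T3 (fun x y z => p2 (y * Si (x * beta)) z) s.

Let pL_tri : trilinear (fun x y z => p2 (y * Si (x * beta)) z). Proof. mlin. Qed.
Let pLP : linear pL := lift3_linear T3 pL_tri.
Let pLE x y z : pL (p3 x y z) = p2 (y * Si (x * beta)) z := lift3E T3 _ _ _ pL_tri.

Let alpha_bi : bilinear (fun a b => S a * alpha * b). Proof. mlin. Qed.
Let beta_bi : bilinear (fun a b => a * beta * S b). Proof. mlin. Qed.

Let contract_alpha (X : lmodType k) (F : H -> X) (f : H -> H -> X) h : linear F ->
  (forall a b, f a b = F (S a * alpha * b)) ->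
  lift2 T2 f (D h) = eps h *: F alpha.
Proof.
move=> lF fE; rewrite -(GRing.scalable_linear lF) -D_alpha lift2_comp //.
by congr (lift2 T2 _ _); do 2!apply/funext => ?.
Qed.

Let contract_beta (X : lmodType k) (F : H -> X) (f : H -> H -> X) h : linear F ->
  (forall a b, f a b = F (a * beta * S b)) ->
  lift2 T2 f (D h) = eps h *: F beta.
Proof.
move=> lF fE; rewrite -(GRing.scalable_linear lF) -D_beta lift2_comp //.
by congr (lift2 T2 _ _); do 2!apply/funext => ?.
Qed.

Let ce2_1 : T2 -> T2 := lift2 T2 (fun a b => eps a *: p2 1 b).
Let ce2_1b : bilinear (fun a b => eps a *: p2 1 b). Proof. mlin. Qed.
Let ce2_1P : linear ce2_1 := lift2_linear T2 ce2_1b.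

(** Since [Si] reverses products, y a2 Si(x a1 beta) = y Si(a1 beta S(a2)) Si(x), and [D_beta]
    absorbs the coproduct. *)
Let pL_cop1 s c : pL (s * cop1 c) = pL s * ce2_1 c.
Proof.
move: s; apply: ext3 => [||x y z].
- by move=> ? ? ?; rewrite mulPl pLP.
- by move=> ? ? ?; rewrite pLP mulPl.
move: c; apply: ext2 => [||a b]; first by move=> ? ? ?; rewrite cop1P mulPr pLP.
  by move=> ? ? ?; rewrite ce2_1P mulPr.
rewrite /cop1 /ce2_1 !lift2E //.
rewrite (lift2_comp (F := fun w => pL (p3 x y z * w))); [|by move=> ? ? ?; rewrite mulPr pLP|mlin].
rewrite (contract_beta (F := fun w => p2 (y * Si w * Si x) (z * b))).
- by rewrite pLE -scalerAr pure2M mulr1 SiM mulrA.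
- by move=> ? ? ?; rewrite ?simP.
by move=> a1 a2; rewrite pure3M pLE !SiM SK !mulrA.
Qed.

Let pL_shift h (r : T2) s : pL (lift2 T2 (fun b1 b2 => p3 h b1 b2) r * s) =
  r * pL s * p2 (Si h) 1.
Proof.
have b3 : bilinear (fun b1 b2 => p3 h b1 b2) by mlin.
move: s; apply: ext3 => [||x y z]; [by move=> ? ? ?; rewrite mulPr pLP|by move=> ? ? ?; rewrite pLP mulPr mulPl|].
move: r; apply: ext2 => [||a b].
- by move=> ? ? ?; rewrite (lift2_linear T2 b3) mulPl pLP.
- by move=> ? ? ?; rewrite !mulPl.
rewrite lift2E // pure3M !pLE !pure2M mulr1 -(mulrA h) [Si (h * _)]SiM.
by rewrite !mulrA.
Qed.

Section Functional.
Variable delta : T2 -> k^o.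
Hypothesis delta_linear : linear delta.
Hypothesis delta_inv : forall h w, delta (D h * w) = eps h * delta w.

(** Evaluate delta(pL(Phi (D (x) id) D(h))) in two ways. Directly, [pL_cop1] leaves the factor 1 (x)
    h. After quasi-coassociativity, [pL_shift] produces D(h2) on the left, which delta absorbs, and
    Si(h1) (x) 1 on the right. *)
Lemma functional_pL h : delta (pL Phi * p2 1 h) = delta (pL Phi * p2 (Si h) 1).
Proof.
have E1 : delta (pL (Phi * cop1 (D h))) = delta (pL Phi * p2 1 h).
  rewrite pL_cop1 /ce2_1 lift2_counitl //.
  by move=> ? ? ?; rewrite pureP.
have bl : bilinear (fun a b => D b * pL Phi * p2 (Si a) 1) by mlin.
have E2 c : pL (cop2 c * Phi) = lift2 T2 (fun a b => D b * pL Phi * p2 (Si a) 1) c.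
  move: c; apply: ext2 => [||a b]; first by move=> ? ? ?; rewrite cop2P mulPl pLP.
    exact: lift2_linear.
  by rewrite /cop2 !lift2E // pL_shift.
rewrite -E1 coassoc E2 lift2_comp //.
rewrite -(lift2_counitr (F := fun a => delta (pL Phi * p2 (Si a) 1))).
  by congr (lift2 T2 _ _); do 2!apply/funext => ?; rewrite -mulrA delta_inv.
by move=> ? ? ?; rewrite Si_linear pureP mulPr delta_linear.
Qed.

(** This is [Si] applied to S(a) alpha b beta S(c), so the antipode axiom for the inverse associator
    gives [n3 PhiV = 1]. *)
Let n3 : T3 -> H := lift3 T3 (fun a b c => c * Si (S a * alpha * b * beta)).
Let n3t : trilinear (fun a b c => c * Si (S a * alpha * b * beta)). Proof. mlin. Qed.
Let n3E a b c : n3 (p3 a b c) = c * Si (S a * alpha * b * beta) := lift3E T3 _ _ _ n3t.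
Let n3P : linear n3 := lift3_linear T3 n3t.

(* n4 absorbs a coproduct placed on the left of its legs (1, 2) or on the right
   of its legs (2, 3), and delta absorbs one on the left of the legs (3, 4);
   hence only two factors of the pentagon survive delta \o n4. *)
Let n4 : T4 -> T2 := lift4 T4 (fun a b c d => p2 (c * Si (S a * alpha * b * beta)) d).
Let n4t : quadrilinear (fun a b c d => p2 (c * Si (S a * alpha * b * beta)) d).
Proof. mlin. Qed.
Let n4E a b c d : n4 (p4 a b c d) = p2 (c * Si (S a * alpha * b * beta)) d :=
  lift4E T4 _ _ _ _ n4t.
Let n4P : linear n4 := lift4_linear T4 n4t.

Let ins14 : T2 -> T4 := lift2 T2 (fun a b => p4 a 1 1 b).
Let ins14b : bilinear (fun a b => p4 a 1 1 b). Proof. mlin. Qed.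
Let ins14P : linear ins14 := lift2_linear T2 ins14b.
Let ins12 : T2 -> T4 := lift2 T2 (fun a b => p4 a b 1 1).
Let ins12b : bilinear (fun a b => p4 a b 1 1). Proof. mlin. Qed.
Let ins12P : linear ins12 := lift2_linear T2 ins12b.
Let ins34 : T2 -> T4 := lift2 T2 (fun a b => p4 1 1 a b).
Let ins34b : bilinear (fun a b => p4 1 1 a b). Proof. mlin. Qed.
Let ins34P : linear ins34 := lift2_linear T2 ins34b.

Let linQ := (linP, pLP, n3P, n4P, ins14P, ins12P, ins34P, delta_linear).
Ltac lin2 := by move=> ? ? ?; rewrite /= ?linQ.

Let n4_cop23 t s : n4 (t * cop23 s) = n4 (t * ins14 (ce3_2 s)).
Proof.
move: s; apply: ext3 => [||x y z]; [lin2|lin2|].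
rewrite ce3_2E (GRing.scalable_linear ins14P) -scalerAr (GRing.scalable_linear n4P).
move: t; apply: ext4 => [||a b c d]; [lin2|lin2|].
rewrite /cop23 lift3E // (lift2_comp (F := fun w => n4 (p4 a b c d * w))); [|lin2|mlin].
rewrite (contract_beta (F := fun w => p2 (c * Si w * Si (S (a * x) * alpha * b)) (d * z))).
- by rewrite /ins14 lift2E // pure4M n4E !mulr1 [in RHS]SiM /= !mulrA.
- by move=> ? ? ?; rewrite ?simP.
by move=> y1 y2; rewrite pure4M n4E !SiM !SK !mulrA.
Qed.

Let n4_cop12 t s : n4 (cop12 s * t) = n4 (ins34 (ce3_1 s) * t).
Proof.
move: s; apply: ext3 => [||x y z]; [lin2|lin2|].
rewrite ce3_1E (GRing.scalable_linear ins34P) -scalerAl (GRing.scalable_linear n4P).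
move: t; apply: ext4 => [||a b c d]; [lin2|lin2|].
rewrite /cop12 lift3E // (lift2_comp (F := fun w => n4 (w * p4 a b c d))); [|lin2|mlin].
rewrite (contract_alpha (F := fun w => p2 (y * c * Si (S a * w * b * beta)) (z * d))).
- by rewrite /ins34 lift2E // pure4M n4E !mul1r.
- by move=> ? ? ?; rewrite ?simP.
by move=> x1 x2; rewrite pure4M n4E SM !mulrA.
Qed.

Let delta_cop34 t s : delta (n4 (cop34 s * t)) = delta (n4 (ins12 (ce3_3 s) * t)).
Proof.
move: s; apply: ext3 => [||x y z]; [lin2|lin2|].
rewrite ce3_3E (GRing.scalable_linear ins12P) -scalerAl (GRing.scalable_linear n4P).
rewrite (GRing.scalable_linear delta_linear).
have E (r : T2) : n4 (lift2 T2 (fun c1 c2 => p4 x y c1 c2) r * t) = r * n4 (p4 x y 1 1 * t).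
  have b4 : bilinear (fun c1 c2 => p4 x y c1 c2) by mlin.
  move: t; apply: ext4 => [||a b c d]; [lin2|lin2|].
  move: r; apply: ext2 => [||r1 r2]; [|lin2|].
    by move=> ? ? ?; rewrite (lift2_linear T2 b4) /= mulPl n4P.
  by rewrite lift2E // !pure4M !n4E pure2M !mul1r !mulrA.
by rewrite /cop34 lift3E // E delta_inv /ins12 lift2E.
Qed.

(** After the coproducts are absorbed, one side of the pentagon contributes n3(Phi^-1) (x) 1 = 1 and
    the other pL(Phi) (Si(alpha) (x) 1). By [functional_pL], delta does not distinguish the latter
    from pL(Phi) (1 (x) alpha). *)
Lemma functional_pL_alpha : delta (pL Phi * p2 1 alpha) = delta 1.
Proof.
have padrM s t : padr (s * t) = padr s * padr t.
  move: t; apply: ext3 => [||a b c]; [lin2|lin2|].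
  move: s; apply: ext3 => [||a' b' c']; [lin2|lin2|].
  by rewrite pure3M /padr !lift3E // pure4M mulr1.
have padr1 : padr 1 = 1 by rewrite -pure3_1 /padr lift3E // pure4_1.
have ins1 : [/\ ins12 1 = 1, ins14 1 = 1 & ins34 1 = 1].
  by rewrite -pure2_1 /ins12 /ins14 /ins34 !lift2E // pure4_1.
have [i12 i14 i34] := ins1.
(* Moving the last factor across makes Phi^-1 (x) 1 appear and puts each coproduct at the end where
   [n4] or delta absorbs it. *)
have E : cop34 Phi * (cop12 Phi * padr PhiV) = padl Phi * cop23 Phi.
  by rewrite mulrA pentagon -mulrA -padrM PhiVK padr1 mulr1.
have := congr1 (fun w => delta (n4 w)) E.
rewrite /= delta_cop34 assoc_counitr i12 mul1r n4_cop12 assoc_counitl i34 mul1r.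
rewrite n4_cop23 (_ : ce3_2 Phi = 1) // i14 mulr1.
have -> s : n4 (padr s) = p2 (n3 s) 1.
  move: s; apply: ext3 => [||a b c]; [lin2|lin2|].
  by rewrite /padr lift3E // n4E n3E.
have -> s : n4 (padl s) = pL s * p2 (Si alpha) 1.
  move: s; apply: ext3 => [||a b c]; [lin2|lin2|].
  by rewrite /padl lift3E // n4E pLE pure2M S1 mul1r mulr1 -(mulrA alpha) SiM mulrA.
have Si1 : Si 1 = 1 by rewrite -{1}S1 SK.
have -> : n3 PhiV = 1.
  have lt : trilinear (fun x y z => S x * alpha * y * beta * S z) by mlin.
  have -> s : n3 s = Si (lift3 T3 (fun x y z => S x * alpha * y * beta * S z) s).
    move: s; apply: ext3 => [||a b c]; first lin2.
      exact: linear_cmp (lift3_linear T3 lt) Si_linear.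
    by rewrite n3E lift3E // [in RHS]SiM SK.
  by rewrite PhiV_antipode.
by rewrite pure2_1 functional_pL => ->.
Qed.

End Functional.

End QuasiHopfCalculus.

(** * Application to the iterated tensor products of H *)

Section ConcreteTensor.
Variables (k : fieldType) (H : algType k).

Definition ctensor2 : tensor2 H.
Proof.
refine (@Tensor2 k H (H ⊗ H)%type (fun a b => a ⊗ b) (fun X f => tsum f) _ _ _ _ _ _).
- exact: pure_bilinear.
- by move=> X f; apply: tsum_linear.
- by move=> X f a b; apply: tsum_pure.
- by move=> X f g; apply: tensor_ext.
- by move=> a b a' b'; apply: tensor_mul_pure.
- by [].
Defined.

Definition ctensor3 : tensor3 H.
Proof.
refine (@Tensor3 k H (H ⊗ H ⊗ H)%type (fun a b c => a ⊗ b ⊗ c)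
  (fun X f => tsum3 f) _ _ _ _ _ _).
- by split=> * ? ? ?; rewrite ?purePl ?purePr // purePl.
- by move=> X f; apply: tsum3_linear.
- by move=> X f a b c tf; exact: (tsum3E tf).
- by move=> X f g; apply: tensor_ext3.
- move=> a b c a' b' c'; rewrite /= tensor_mul_pure.
  by congr (_ ⊗ _); apply: tensor_mul_pure.
- by [].
Defined.

Definition tsum4 (X : lmodType k) (f : H -> H -> H -> H -> X)
    (t : (H ⊗ H ⊗ H ⊗ H)%type) : X :=
  tsum (fun abc d => tsum3 (fun a b c => f a b c d) abc) t.

Lemma tsum4_bilinear (X : lmodType k) (f : H -> H -> H -> H -> X) :
  quadrilinear f -> bilinear (fun abc d => tsum3 (fun a b c => f a b c d) abc).
Proof.
move=> [f1 f2 f3 f4].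
have tf d : trilinear (fun a b c => f a b c d).
  by split=> *; [apply: f1 | apply: f2 | apply: f3].
split=> [d|abc] c x y; first exact: tsum3_linear (tf d) c x y.
move: abc; apply: tensor_ext3 => [||u v w]; first exact: tsum3_linear.
- by apply: linear_comb; apply: tsum3_linear.
by rewrite !tsum3E // f4.
Qed.

Definition ctensor4 : tensor4 H.
Proof.
refine (@Tensor4 k H (H ⊗ H ⊗ H ⊗ H)%type (fun a b c d => a ⊗ b ⊗ c ⊗ d)
  (fun X f => tsum4 f) _ _ _ _ _ _).
- split=> *.
  + by move=> ? ? ?; rewrite !purePl.
  + by move=> ? ? ?; rewrite purePr !purePl.
  + by move=> ? ? ?; rewrite purePr !purePl.
  + by move=> ? ? ?; rewrite purePr.
- by move=> X f qf; apply/tsum_linear/tsum4_bilinear.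
- move=> X f a b c d qf; rewrite /tsum4 tsum_pure; last exact: tsum4_bilinear.
  by case: qf => f1 f2 f3 f4; rewrite tsum3E //; split=> *.
- by move=> X f g; apply: tensor_ext4.
- move=> a b c d a' b' c' d'; rewrite /= tensor_mul_pure.
  congr (_ ⊗ _); rewrite -[LHS]/(_ * _) tensor_mul_pure.
  by congr (_ ⊗ _); apply: tensor_mul_pure.
- by [].
Defined.

End ConcreteTensor.

Section Instance.
Variables (k : fieldType) (H : algType k) (Q : quasi_hopf H).

Let T2 := ctensor2 H.
Let T3 := ctensor3 H.
Let T4 := ctensor4 H.
Let D : H -> T2 := comul Q.
Let eps : H -> k := counit Q.

Let D_linear : linear D. Proof. exact: linearP. Qed.
Let comulP : linear (comul Q). Proof. exact: linearP. Qed.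
Let idP (V : lmodType k) : linear (@idfun V). Proof. by []. Qed.
Let assocVP (U V W : lmodType k) : linear (@tassocV k U V W).
Proof. exact: tassocV_linear. Qed.

Let lift2_map (X : lmodType k) (F : (H ⊗ H)%type -> X) (f : H -> H -> X) t :
  linear F -> (forall a b, F (a ⊗ b) = f a b) -> F t = lift2 T2 f t.
Proof.
move=> lF FE; have bf : bilinear f.
  by split=> [b|a] c x y; rewrite /= -!FE ?purePl ?purePr lF.
move: t; apply: tensor_ext => [||a b] //; first exact: tsum_linear.
by rewrite FE [RHS]tsum_pure.
Qed.

Let cop1E : tmap (comul Q) idfun =1 cop1 T3 D.
Proof.
move=> t; refine (@cop1_eq k H T2 T3 D D_linear
  (tmap (comul Q) idfun) _ _ t) => // [|a b].
  exact: tmap_linear.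
rewrite [LHS](tmap_pure _ _ comulP (@idP _)).
by apply: (lift2_map (F := fun r => r ⊗ b)) => // c x y; rewrite purePl.
Qed.

Let cop2E : (fun c => tassocV (tmap idfun (comul Q) c)) =1 cop2 T3 D.
Proof.
move=> t; refine (@cop2_eq k H T2 T3 D D_linear
  (fun c => tassocV (tmap idfun (comul Q) c)) _ _ t) => // [|a b].
  exact: linear_cmp (tmap_linear (@idP _) comulP) (@assocVP _ _ _).
rewrite (tmap_pure _ _ (@idP _) comulP).
apply: (lift2_map (F := fun r => tassocV (a ⊗ r))) => [c x y|x y].
  by rewrite purePr (@assocVP).
by rewrite tassocV_pure.
Qed.

Let cop12E : tmap (tmap (comul Q) idfun) idfun =1 @cop12 k H T2 T3 T4 D.
Proof.
have l1 := tmap_linear comulP (@idP H).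
move=> t; refine (@cop12_eq k H T2 T3 T4 D D_linear
  (tmap (tmap (comul Q) idfun) idfun) _ _ t) => // [|a b c].
  exact: tmap_linear.
rewrite [LHS](tmap_pure _ _ l1 (@idP _)) (tmap_pure _ _ comulP (@idP _)).
by apply: (lift2_map (F := fun r => r ⊗ b ⊗ c)) => // d x y; rewrite !purePl.
Qed.

Let cop23E : (fun t => tmap tassocV idfun (tmap (tmap idfun (comul Q)) idfun t))
  =1 @cop23 k H T2 T3 T4 D.
Proof.
have l1 := tmap_linear (@idP H) comulP.
have l2 := tmap_linear l1 (@idP H).
have l3 := tmap_linear (@assocVP H H H) (@idP H).
move=> t; refine (@cop23_eq k H T2 T3 T4 D D_linear
  (fun t => tmap tassocV idfun (tmap (tmap idfun (comul Q)) idfun t)) _ _ t) => // [|a b c].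
  exact: linear_cmp l2 l3.
rewrite (tmap_pure _ _ l1 (@idP _)) (tmap_pure _ _ (@assocVP _ _ _) (@idP _)).
rewrite (tmap_pure _ _ (@idP _) comulP).
apply: (lift2_map (F := fun r => tassocV (a ⊗ r) ⊗ c)) => [d x y|x y].
  by rewrite purePr (@assocVP) purePl.
by rewrite tassocV_pure.
Qed.

Let cop34E : (fun t => tassocV (tmap idfun (comul Q) t)) =1 @cop34 k H T2 T3 T4 D.
Proof.
have l1 := tmap_linear (@idP (H ⊗ H)%type) comulP.
move=> t; refine (@cop34_eq k H T2 T3 T4 D D_linear
  (fun t => tassocV (tmap idfun (comul Q) t)) _ _ t) => // [|a b c].
  exact: linear_cmp l1 (@assocVP _ _ _).
rewrite (tmap_pure _ _ (@idP _) comulP).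
apply: (lift2_map (F := fun r => tassocV (a ⊗ b ⊗ r))) => [d x y|x y].
  by rewrite purePr (@assocVP).
by rewrite tassocV_pure.
Qed.

Let padlE : (fun t => tmap tassocV idfun (tassocV ((1 : H) ⊗ t))) =1 @padl k H T3 T4.
Proof.
have l3 := tmap_linear (@assocVP H H H) (@idP H).
move=> t; refine (@padl_eq k H T3 T4
  (fun t => tmap tassocV idfun (tassocV ((1 : H) ⊗ t))) _ _ t) => // [|a b c].
  by move=> d x y; rewrite purePr (@assocVP) l3.
rewrite tassocV_pure (tmap_pure _ _ (@assocVP _ _ _) (@idP _)).
by rewrite tassocV_pure.
Qed.

Let padrE : (fun t : (H ⊗ H ⊗ H)%type => t ⊗ (1 : H)) =1 @padr k H T3 T4.
Proof. by move=> t; refine (@padr_eq k H T3 T4 (fun t => t ⊗ (1 : H)) _ _ t) => // d x y;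
  rewrite purePl.
Qed.

Let pent : @cop34 k H T2 T3 T4 D (assoc Q) * @cop12 k H T2 T3 T4 D (assoc Q) =
  @padl k H T3 T4 (assoc Q) * @cop23 k H T2 T3 T4 D (assoc Q) * @padr k H T3 T4 (assoc Q).
Proof.
rewrite -cop34E -cop12E -cop23E -padlE -padrE.
exact: assoc_pentagon.
Qed.

Let coass h : assoc Q * cop1 T3 D (D h) = cop2 T3 D (D h) * assoc Q.
Proof.
rewrite -cop1E -cop2E -[LHS]/(assoc Q * tmap (comul Q) idfun (comul Q h)).
rewrite -[RHS]/(tassocV (tmap idfun (comul Q) (comul Q h)) * assoc Q).
by rewrite -quasi_coassoc tassocK -mulrA assocK mulr1.
Qed.

Let midE : lift3 T3 (fun a b c => eps b *: pure2 T2 a c) (assoc Q) = 1.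
Proof.
have br : bilinear (fun a b : H => eps b *: a).
  by split=> [b|a] c x y; rewrite /= /eps ?linearP ?scalePl ?scalePr.
have rP := tsum_linear br.
have tri : trilinear (fun a b c => eps b *: pure2 T2 a c).
  by split=> * ? ? ?; rewrite ?linearP ?pureP // /eps linearP scalePl.
rewrite -[RHS](assoc_counit Q).
move: (assoc Q); apply: tensor_ext3 => [||a b c].
- exact: (lift3_linear T3 tri).
- exact: tmap_linear.
rewrite [RHS](tmap_pure _ _ rP (@idP _)) tsum_pure // pureZl.
exact: (lift3E T3 a b c tri).
Qed.

Lemma antipode_inv_linear : linear (antipode_inv Q).
Proof.
exact: can2_is_linear (fun a => linearP (antipode Q) a) (@antipodeK _ _ Q)
  (@antipodeVK _ _ Q).
Qed.

Lemma antipode_invM x y :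
  antipode_inv Q (x * y) = antipode_inv Q y * antipode_inv Q x.
Proof. by apply: (can_inj (@antipodeK _ _ Q)); rewrite antipodeM !antipodeVK. Qed.

Section Functional.
Variable delta : (H ⊗ H)%type -> k^o.
Hypothesis delta_linear : linear delta.
Hypothesis delta_inv :
  forall h w, delta (comul Q h * w) = counit Q h * delta w.

(** To be used with delta(t) = d(t (u (x) v)), where d is an invariant functional on V (x) V. *)
Lemma invariant_p_L h :
  delta (p_L Q * (1 ⊗ h)) = delta (p_L Q * (antipode_inv Q h ⊗ 1)).
Proof.
have epsP a x y : eps (a *: x + y) = a * eps x + eps y by exact: linearP.
exact: (@functional_pL k H T2 T3 (antipode Q) (antipode_inv Q) (beta Q) eps D
  (assoc Q) (@antipodeK _ _ Q) (fun a => linearP (antipode Q) a)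
  antipode_inv_linear antipode_invM epsP D_linear (counitl Q) (counitr Q)
  (@antipode_beta _ _ Q) coass delta delta_linear delta_inv h).
Qed.

Lemma invariant_p_L_alpha : delta (p_L Q * (1 ⊗ alpha Q)) = delta 1.
Proof.
have epsP a x y : eps (a *: x + y) = a * eps x + eps y by exact: linearP.
have eps1 : eps 1 = 1 by exact: rmorph1.
have epsM x y : eps (x * y) = eps x * eps y by exact: rmorphM.
have D1 : D 1 = 1 by exact: rmorph1.
exact: (@functional_pL_alpha k H T2 T3 T4 (antipode Q) (antipode_inv Q)
  (alpha Q) (beta Q) eps D (assoc Q) (assoc_inv Q)
  (@antipodeK _ _ Q) (fun a => linearP (antipode Q) a)
  antipode_inv_linear (antipode1 Q) (@antipodeM _ _ Q) antipode_invM
  epsP eps1 epsM D_linear D1 (counitl Q) (counitr Q)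
  (@antipode_alpha _ _ Q) (@antipode_beta _ _ Q)
  (assocVK Q) (assocK Q) (antipode_assoc_inv Q) coass pent midE
  delta delta_linear delta_inv).
Qed.

End Functional.

End Instance.

(** * The indicator of a simple module *)

Section TensorAct.
Variables (k : fieldType) (H : algType k).
Implicit Types U V W : hmod H.

Definition act2 U V (t : (H ⊗ H)%type) (x : (U ⊗ V)%type) : (U ⊗ V)%type :=
  tact (@hact k H U) (@hact k H V) t x.

Definition act3 U V W (t : (H ⊗ H ⊗ H)%type) (x : (U ⊗ V ⊗ W)%type) :
    (U ⊗ V ⊗ W)%type :=
  tact (tact (@hact k H U) (@hact k H V)) (@hact k H W) t x.

Lemma act2Pl U V (x : (U ⊗ V)%type) : linear (fun t => act2 t x).
Proof. exact: (tact_bilinear (hact_bilinear U) (hact_bilinear V)).1. Qed.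

Lemma act2Pr U V t : linear (@act2 U V t).
Proof. exact: (tact_bilinear (hact_bilinear U) (hact_bilinear V)).2. Qed.

Lemma act2E U V a b (u : U) (v : V) : act2 (a ⊗ b) (u ⊗ v) = hact a u ⊗ hact b v.
Proof. exact: tact_pure (hact_bilinear U) (hact_bilinear V). Qed.

Lemma act2M U V s t (x : (U ⊗ V)%type) : act2 (s * t) x = act2 s (act2 t x).
Proof.
exact: (tact_mul_gen (hact_bilinear U) (hact_bilinear V) (@hactM k H U) (@hactM k H V)).
Qed.

Lemma act3Pl U V W (x : (U ⊗ V ⊗ W)%type) : linear (fun t => act3 t x).
Proof.
exact: (tact_bilinear (tact_bilinear (hact_bilinear U) (hact_bilinear V)) (hact_bilinear W)).1.
Qed.

Lemma act3Pr U V W t : linear (@act3 U V W t).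
Proof.
exact: (tact_bilinear (tact_bilinear (hact_bilinear U) (hact_bilinear V)) (hact_bilinear W)).2.
Qed.

Lemma act3E U V W a b c (u : U) (v : V) (w : W) :
  act3 (a ⊗ b ⊗ c) (u ⊗ v ⊗ w) = hact a u ⊗ hact b v ⊗ hact c w.
Proof.
rewrite /act3 !tact_pure //; try exact: hact_bilinear.
exact: (tact_bilinear (hact_bilinear U) (hact_bilinear V)).
Qed.

Lemma act3M U V W s t (x : (U ⊗ V ⊗ W)%type) : act3 (s * t) x = act3 s (act3 t x).
Proof.
have bUV := tact_bilinear (hact_bilinear U) (hact_bilinear V).
apply: (tact_mul_gen bUV (hact_bilinear W)); last exact: hactM.
exact: tact_mul_gen (hact_bilinear U) (hact_bilinear V) (@hactM k H U) (@hactM k H V).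
Qed.

Lemma act31 U V W (x : (U ⊗ V ⊗ W)%type) : act3 1 x = x.
Proof.
move: x; apply: tensor_ext3 => [||u v w]; [exact: act3Pr | exact: linear_id |].
by rewrite act3E !hact1.
Qed.

HB.instance Definition _ U V t :=
  GRing.isLinear.Build k (U ⊗ V)%type (U ⊗ V)%type *:%R (@act2 U V t) (@act2Pr U V t).

End TensorAct.

Section DualData.
Variables (k : fieldType) (H : algType k) (Q : quasi_bialgebra H).

(* Families b, d of morphisms k -> V (x) V and V (x) V -> k which are dual bases
   of the invariants, such that the endomorphism
   V -> V (x) (V (x) V) -> (V (x) V) (x) V -> V defined by b_i and d_i is the scalar
   a_i; the inverse of the associator is avoided by means of w_i. *)
Definition dual_data (V : hmod H) (n : nat) (a : 'I_n -> k) : Prop :=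
  exists (b : 'I_n -> hhom (hunit Q) (htens Q V V))
         (d : 'I_n -> hhom (htens Q V V) (hunit Q))
         (w : 'I_n -> hhom (htens Q V (hunit Q)) (htens Q (htens Q V V) V)),
  [/\ forall i j, hcomp (d i) (b j) =1 fun c => (i == j)%:R *: c,
      forall y : hhom (hunit Q) (htens Q V V),
        (forall i, hcomp (d i) y =1 hzero _ _) -> y =1 hzero _ _,
      forall i, hcomp (hassoc Q V V V) (w i) =1 htens_hom Q (hid V) (b i)
    & forall i, hcomp (hunitl Q V) (hcomp (htens_hom Q (d i) (hid V)) (w i)) =1
        fun x => a i *: hunitr Q V x].

End DualData.

Section Basis.
Variables (k : fieldType) (V : lmodType k) (n : nat) (e : {linear V -> 'cV[k]_n}).
Hypothesis e_bij : bijective e.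

Let e' : 'cV[k]_n -> V := sval (cid (let: Bijective g gK Kg := e_bij in
  ex_intro (fun g => cancel e g /\ cancel g e) g (conj gK Kg))).
Let eK : cancel e e'. Proof. by rewrite /e'; case: cid => g []. Qed.
Let e'K : cancel e' e. Proof. by rewrite /e'; case: cid => g []. Qed.
Let e'_linear : linear e'.
Proof. exact: can2_is_linear (fun a => linearP e a) eK e'K. Qed.

Definition vec (l : 'I_n) : V := e' (delta_mx l 0).
Definition coef (l : 'I_n) (v : V) : k := e v l 0.

Lemma coef_linear l : linear (coef l : V -> k^o).
Proof. by move=> a x y; rewrite /coef linearP !mxE. Qed.

Lemma coef_vec l m : coef l (vec m) = (l == m)%:R.
Proof. by rewrite /coef /vec e'K mxE eqxx andbT. Qed.

Lemma vec_sum v : v = \sum_l coef l v *: vec l.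
Proof.
rewrite -[LHS]eK; pose E := mk_linear e'_linear.
have -> : e v = \sum_l coef l v *: delta_mx l 0.
  apply/matrixP => i j; rewrite (ord1 j) summxE (bigD1 i) //= !mxE !eqxx mulr1.
  by rewrite big1 ?addr0 // => l li; rewrite !mxE eq_sym (negPf li) mulr0.
rewrite -[LHS]/(E _) linear_sum; apply: eq_bigr => l _.
by rewrite linearZ.
Qed.

End Basis.

(** * The character of nu as a sum of traces of zigzags *)

Section TraceFormula.
Variables (k : fieldType) (H : algType k) (Q : quasi_hopf H) (V : hmod H).
Variables (n : nat) (e : {linear V -> 'cV[k]_n}) (e_bij : bijective e).

Local Notation vec := (vec e_bij).
Local Notation coef := (coef e).

Definition coef2 l m (x : (V ⊗ V)%type) : k :=
  tsum (fun u v => coef l u * coef m v : k^o) x.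

Lemma coef2_bilinear l m : bilinear (fun u v => coef l u * coef m v : k^o).
Proof.
split=> [v|u] c x y; rewrite /= coef_linear.
  by rewrite mulrDl -mulrA.
by rewrite mulrDr /GRing.scale /= mulrCA.
Qed.

Lemma coef2P l m : linear (coef2 l m : (V ⊗ V)%type -> k^o).
Proof. exact/tsum_linear/coef2_bilinear. Qed.

Lemma coef2E l m u v : coef2 l m (u ⊗ v) = coef l u * coef m v.
Proof. exact: tsum_pure (coef2_bilinear l m). Qed.

Definition tswap : (V ⊗ V)%type -> (V ⊗ V)%type := tsum (fun u v => v ⊗ u).

Lemma tswap_bilinear : bilinear (fun u v : V => v ⊗ u).
Proof. by split=> [v|u] c x y; rewrite /= ?purePl ?purePr. Qed.

Lemma tswapP : linear tswap.
Proof. exact/tsum_linear/tswap_bilinear. Qed.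

Lemma tswapE u v : tswap (u ⊗ v) = v ⊗ u.
Proof. exact: tsum_pure tswap_bilinear. Qed.

Lemma tswap_sum x : tswap x = \sum_l \sum_m coef2 l m x *: (vec m ⊗ vec l).
Proof.
move: x; apply: tensor_ext => [||u v]; first exact: tswapP.
  move=> c x y; rewrite scaler_sumr -big_split; apply: eq_bigr => l _ /=.
  rewrite scaler_sumr -big_split; apply: eq_bigr => m _ /=.
  by rewrite coef2P scalerDl scalerA.
rewrite tswapE {1}(vec_sum e_bij v) {1}(vec_sum e_bij u).
pose pl u := mk_linear ((pure_bilinear V V).1 u).
pose pr u := mk_linear ((pure_bilinear V V).2 u).
rewrite exchange_big -[LHS]/(pl _ _) linear_sum; apply: eq_bigr => m _ /=.
rewrite -[LHS]/(pr _ _) linear_sum; apply: eq_bigr => l _ /=.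
by rewrite pureZl pureZr coef2E scalerA mulrC.
Qed.

Lemma character_trace chi h : has_character V chi ->
  chi h = \sum_l coef l (hact h (vec l)).
Proof.
move=> [m [f [rho [bf rf cf]]]].
have E : n = m by apply: (@has_dim_uniq _ V); [exists e | exists f].
subst m.
have [rho2 re] : exists rho2 : H -> 'M[k]_n, forall h u, e (hact h u) = rho2 h *m e u.
  pose M h : 'M[k]_n := \matrix_(i, j) coef i (hact h (vec j)).
  exists M => g u; rewrite {1}(vec_sum e_bij u) !linear_sum.
  apply/matrixP => i j; rewrite (ord1 j) summxE !mxE; apply: eq_bigr => l _.
  by rewrite !linearZ /= !mxE mulrC.
have c2 : has_character V (fun h => \tr (rho2 h)) by exists n, e, rho2; split.
have -> : chi = (fun h => \tr (rho2 h)).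
  by apply: character_uniq c2; exists n, f, rho.
apply: eq_bigr => l _; rewrite /coef re mxE.
rewrite (bigD1 l) //= -/(coef l (vec l)) coef_vec eqxx mulr1.
rewrite big1 ?addr0 // => j jl.
by rewrite -/(coef j (vec l)) coef_vec (negPf jl) mulr0.
Qed.

(** The trace of x y on V is the trace of x (x) y composed with the flip of V (x) V; hence the
    exchanged indices. *)
Lemma character_mul chi (t : (H ⊗ H)%type) : has_character V chi ->
  chi (tsum (fun x y => x * y) t) =
  \sum_l \sum_m coef2 l m (act2 t (vec m ⊗ vec l)).
Proof.
move=> hc; have bm := mul_bilinear H.
rewrite (character_trace _ hc).
have lh : linear (fun t => \sum_l coef l (hact (tsum (fun x y : H => x * y) t) (vec l)) : k^o).
  move=> c x y; rewrite scaler_sumr -big_split; apply: eq_bigr => l _ /=.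
  by rewrite (tsum_linear bm) hact_linearl coef_linear.
move: t; apply: (tensor_ext lh) => [c x y|x y].
  rewrite scaler_sumr -big_split; apply: eq_bigr => l _ /=.
  rewrite scaler_sumr -big_split; apply: eq_bigr => m _ /=.
  by rewrite act2Pl coef2P.
rewrite tsum_pure //; apply: eq_bigr => l _; rewrite hactM.
rewrite {1}(vec_sum e_bij (hact y (vec l))) linear_sum.
pose cl := mk_linear (coef_linear e l).
rewrite -[LHS]/(cl _) linear_sum; apply: eq_bigr => m _ /=.
rewrite linearZ [LHS](GRing.scalable_linear (coef_linear e l)) act2E coef2E.
by rewrite [RHS]mulrC.
Qed.

Section Zigzag.
Variable d : (V ⊗ V)%type -> k^o.
Hypothesis d_linear : linear d.
Hypothesis d_inv : forall h x, d (act2 (comul Q h) x) = counit Q h * d x.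

(** The zigzag of the overview is the case where t is the inverse associator and x = b_i(1). With t
    and x free, the trace formula can be checked on pure tensors. *)
Definition zigzag (t : (H ⊗ H ⊗ H)%type) (x : (V ⊗ V)%type) (v : V) : V :=
  tsum (fun uv w => (d uv : k) *: w) (act3 t (tassocV (v ⊗ x))).

Let zb : bilinear (fun (uv : (V ⊗ V)%type) (w : V) => (d uv : k) *: w).
Proof. by split=> [w|uv] c x y; rewrite /= ?d_linear ?scalePl ?scalePr. Qed.

Lemma zigzagE a b c u v w :
  zigzag (a ⊗ b ⊗ c) (v ⊗ w) u = (d (hact a u ⊗ hact b v) : k) *: hact c w.
Proof. by rewrite /zigzag tassocV_pure act3E tsum_pure. Qed.

Let q3 : (H ⊗ H ⊗ H)%type -> (H ⊗ H)%type :=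
  tsum3 (fun x y z : H => (antipode Q x * alpha Q * y) ⊗ z).
Let q3t : trilinear (fun x y z : H => (antipode Q x * alpha Q * y) ⊗ z).
Proof.
by split=> * ? ? ?; rewrite ?linearP !(mulPl, mulPr, purePl, purePr).
Qed.

(* Moving S(X) and alpha across d by means of p_L turns the left-hand side into
   d(XZw (x) Yv), which is the trace of u |-> d(Xu (x) Yv) Zw. *)
Lemma zigzag_trace (x : (V ⊗ V)%type) :
  d (act2 (p_L Q) (tswap (act2 (q_L Q) x))) =
  \sum_l coef l (zigzag (assoc_inv Q) x (vec l)).
Proof.
rewrite -[q_L Q]/(q3 _).
have q3P : linear q3 := tsum3_linear q3t.
have zP t v : linear (fun x => zigzag t x v).
  move=> c y z; rewrite /zigzag purePr (@tassocV_linear k V V V) act3Pr.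
  by rewrite (tsum_linear zb).
have zPl v y : linear (fun t => zigzag t y v).
  by move=> c s t; rewrite /zigzag act3Pl (tsum_linear zb).
have cl l := coef_linear e l.
move: (assoc_inv Q); apply: tensor_ext3 => [c s t|c s t|X Y Z].
- by rewrite q3P act2Pl tswapP act2Pr d_linear.
- rewrite scaler_sumr -big_split; apply: eq_bigr => l _ /=.
  by rewrite zPl cl.
rewrite /q3 (tsum3E q3t).
move: x; apply: tensor_ext => [c s t|c s t|v w].
- by rewrite act2Pr tswapP act2Pr d_linear.
- rewrite scaler_sumr -big_split; apply: eq_bigr => l _ /=.
  by rewrite zP cl.
pose delta u v (t : (H ⊗ H)%type) := d (act2 t (u ⊗ v)).
have deltaP u1 u2 : linear (delta u1 u2).
  by move=> c s t; rewrite /delta act2Pl d_linear.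
have delta_inv u1 u2 h t : delta u1 u2 (comul Q h * t) = counit Q h * delta u1 u2 t.
  by rewrite /delta act2M d_inv.
have E1 u1 u2 h : d (act2 (p_L Q) (u1 ⊗ hact h u2)) =
    d (act2 (p_L Q) (hact (antipode_inv Q h) u1 ⊗ u2)).
  have := invariant_p_L (deltaP u1 u2) (delta_inv u1 u2) h.
  by rewrite /delta !act2M !act2E !hact1.
have E2 u1 u2 : d (act2 (p_L Q) (u1 ⊗ hact (alpha Q) u2)) = d (u1 ⊗ u2).
  have := invariant_p_L_alpha (deltaP u1 u2) (delta_inv u1 u2).
  by rewrite /delta !act2M tensor_oneE !act2E !hact1.
rewrite act2E tswapE -mulrA !hactM E1 antipodeK E2.
pose F u := d (hact X u ⊗ hact Y v).
have FP : linear F by move=> c y z; rewrite /F hact_linearr purePl d_linear.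
rewrite -/(F _) {1}(vec_sum e_bij (hact Z w)) -[LHS]/(mk_linear FP _) linear_sum.
apply: eq_bigr => l _; rewrite linearZ /= zigzagE.
by rewrite [RHS](GRing.scalable_linear (cl l)) /GRing.scale /= mulrC.
Qed.

End Zigzag.

Lemma hunit1 (y : hhom (hunit Q) (htens Q V V)) (c : k) : y (c : k^o) = c *: y (1 : k^o).
Proof. by rewrite -linearZ /= /GRing.scale /= mulr1. Qed.

(** The difference y of the two sides is invariant, so c |-> c y is a morphism from the unit object.
    Every d_i kills it, because counit(l) = 1 and the bases are dual; hence y = 0. *)
Lemma dual_data_projection (r : nat) (b : 'I_r -> hhom (hunit Q) (htens Q V V))
    (d : 'I_r -> hhom (htens Q V V) (hunit Q)) (l : H) x :
  (forall i j, hcomp (d i) (b j) =1 fun c => (i == j)%:R *: c) ->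
  (forall y : hhom (hunit Q) (htens Q V V),
     (forall i, hcomp (d i) y =1 hzero _ _) -> y =1 hzero _ _) ->
  normalized_integral Q l ->
  act2 (comul Q l) x = \sum_i (d i x : k) *: b i (1 : k^o).
Proof.
move=> db sep [hl l1].
apply/eqP; rewrite -subr_eq0; apply/eqP; set y := _ - _.
have hy h : hact h (y : htens Q V V) = (counit Q h : k) *: y.
  rewrite linearB [X in _ - X]linear_sum scalerBr [X in _ = _ - X]scaler_sumr; congr (_ - _).
    have cP : linear (comul Q) by exact: linearP.
    have E : comul Q h * comul Q l = (counit Q h : k) *: comul Q l.
      by rewrite -rmorphM (hl h).1; exact: (GRing.scalable_linear cP).
    rewrite -[LHS]/(act2 (comul Q h) (act2 (comul Q l) x)) -act2M E.
    exact: (GRing.scalable_linear (@act2Pl k H V V x)).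
  apply: eq_bigr => i _.
  transitivity ((d i x : k) *: hact h (b i (1 : k^o))).
    exact: (GRing.scalable_linear (@hact_linearr k H (htens Q V V) h)).
  rewrite -hhom_act (_ : @hact k H (hunit Q) h (1 : k^o) = (counit Q h : k^o));
    last exact: mulr1.
  by rewrite (hunit1 (b i) (counit Q h)) !scalerA mulrC.
have ly : linear (fun c : k^o => (c : k) *: (y : htens Q V V)).
  by move=> a c c'; rewrite scalePl.
have ay h c : ((hact h (c : hunit Q) : k) *: (y : htens Q V V)) = hact h ((c : k) *: (y : htens Q V V)).
  by rewrite hactZr hy scalerA mulrC.
have := sep (mk_hhom (U := hunit Q) (V := htens Q V V) ly ay).
have dy i : d i y = 0.
  rewrite /y linearB [X in _ - X]linear_sum.
  rewrite -[X in X - _]/(d i (hact l (x : htens Q V V))) hhom_act /= l1 mul1r.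
  rewrite (bigD1 i) //= linearZ /= big1 ?addr0 => [|j ji].
    by have := db i i 1; rewrite /= eqxx scale1r => ->; rewrite /GRing.scale /= mulr1 subrr.
  rewrite linearZ /=; have := db i j 1; rewrite /= eq_sym (negPf ji) scale0r => ->.
  by rewrite scaler0.
move=> sy; have := sy _ (1 : k^o); rewrite /= scale1r; apply.
by move=> i c; rewrite /= linearZ /= dy scaler0.
Qed.

Lemma dual_data_zigzag (b : hhom (hunit Q) (htens Q V V))
    (d : hhom (htens Q V V) (hunit Q))
    (w : hhom (htens Q V (hunit Q)) (htens Q (htens Q V V) V)) (a : k) v :
  hcomp (hassoc Q V V V) w =1 htens_hom Q (hid V) b ->
  hcomp (hunitl Q V) (hcomp (htens_hom Q d (hid V)) w) =1 (fun x => a *: hunitr Q V x) ->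
  zigzag d (assoc_inv Q) (b (1 : k^o)) v = a *: v.
Proof.
move=> hw ha.
have wE : w (v ⊗ (1 : k^o)) = act3 (assoc_inv Q) (tassocV (v ⊗ b (1 : k^o))).
  have /= := hw (v ⊗ (1 : k^o)).
  rewrite tmap_pure; [|exact: linearP|exact: linearP].
  rewrite /hassoc_fun => /(congr1 tassocV); rewrite tassocK => <-.
  by rewrite -[tact _ _ _ _]/(act3 (assoc Q) _) -act3M assocK act31.
have := ha (v ⊗ (1 : k^o)).
rewrite /= wE /hunitr_fun tsum_pure ?scale1r; last first.
  by split=> [c|u] t x y /=; rewrite ?scalePl ?scalePr.
move=> <-; rewrite /zigzag /hunitl_fun.
have dl : linear (d : (V ⊗ V)%type -> k^o) by exact: linearP.
have db : bilinear (fun (uv : (V ⊗ V)%type) (w : V) => (d uv : k) *: w).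
  by split=> [c|y] t x z; rewrite /= ?dl ?scalePl ?scalePr.
move: (act3 _ _); apply: tensor_ext => [||uv u].
- exact: tsum_linear.
- have l1 := tmap_linear (fun a => linearP d a) (@linear_id k V).
  apply: linear_cmp l1 _; apply: tsum_linear.
  by split=> [c|u] t x y /=; rewrite ?scalePl ?scalePr.
rewrite tmap_pure; [|exact: linearP|exact: linear_id].
by rewrite !tsum_pure //; split=> [c|y] t x z /=; rewrite ?scalePl ?scalePr.
Qed.

(** Replacing the action of the integral by the sum of the b_i d_i gives the trace of q_L b_i d_i
    p_L composed with the flip. Each summand has rank at most one, so its trace is d_i(p_L flip(q_L
    b_i(1))), to which [zigzag_trace] applies. *)
Lemma character_nu (r : nat) (a : 'I_r -> k) chi :
  dual_data Q V a -> normalized_integral Q (integral Q) ->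
  has_character V chi -> chi (nu Q) = (\sum_i a i) * n%:R.
Proof.
move=> [b [d [w [db sep hw ha]]]] hint hc.
have dinv i h (x : (V ⊗ V)%type) :
    d i (act2 (comul Q h) x) = (counit Q h * d i x : k^o).
  exact: (hhom_act (d i) h (x : htens Q V V)).
have dl i : linear (d i : (V ⊗ V)%type -> k^o) by exact: linearP.
rewrite /nu (character_mul _ hc).
transitivity (\sum_l \sum_m \sum_i
    (d i (act2 (p_L Q) (vec m ⊗ vec l)) : k) *
    coef2 l m (act2 (q_L Q) (b i (1 : k^o)))).
  apply: eq_bigr => l _; apply: eq_bigr => m _.
  rewrite !act2M (dual_data_projection _ db sep hint).
  have lL := linear_cmp (act2Pr (V := V) (q_L Q)) (coef2P l m).
  rewrite -[LHS]/(mk_linear lL _) linear_sum.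
  by apply: eq_bigr => i _; rewrite linearZ.
transitivity (\sum_i (d i (act2 (p_L Q) (tswap (act2 (q_L Q) (b i (1 : k^o))))) : k)).
  under eq_bigr do rewrite exchange_big /=.
  rewrite exchange_big; apply: eq_bigr => i _ /=.
  have lL := linear_cmp (act2Pr (V := V) (p_L Q)) (dl i).
  rewrite tswap_sum -[RHS]/(mk_linear lL _) linear_sum.
  apply: eq_bigr => l _; rewrite linear_sum.
  by apply: eq_bigr => m _; rewrite linearZ /= [RHS]mulrC.
rewrite mulr_suml; apply: eq_bigr => i _.
rewrite (zigzag_trace (dl i) (dinv i)).
under eq_bigr => l _ do rewrite (dual_data_zigzag _ (hw i) (ha i))
   [coef _ _](GRing.scalable_linear (coef_linear e l)) coef_vec eqxx.
by rewrite sumr_const cardT size_enum_ord mulr_natr /= [_ *: _]mulr1.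
Qed.

End TraceFormula.

Section TensorDimension.
Variables (k : fieldType) (U V : lmodType k) (m n : nat).

Lemma has_dim_tensor : has_dim U m -> has_dim V n -> has_dim (U ⊗ V)%type (m * n).
Proof.
move=> [e be] [f bf].
have bl : bilinear (fun u v => e u *m (f v)^T).
  split=> [v|u] a x y; rewrite /= linearP; first by rewrite mulmxDl scalemxAl.
  by rewrite linearP mulmxDr scalemxAr.
have FP := tsum_linear bl.
pose F := tsum (fun u v => e u *m (f v)^T).
pose vu := vec be; pose vv := vec bf.
pose G (M : 'M[k]_(m, n)) := \sum_i \sum_j M i j *: (vu i ⊗ vv j).
have GP : linear G.
  move=> a M N; rewrite /G scaler_sumr -big_split; apply: eq_bigr => i _ /=.
  rewrite scaler_sumr -big_split; apply: eq_bigr => j _ /=.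
  by rewrite !mxE scalerDl scalerA.
have FG : cancel F G.
  apply: tensor_ext => [||u v]; [exact: linear_cmp FP GP | exact: linear_id |].
  rewrite /F tsum_pure // /G [in RHS](vec_sum be u) [in RHS](vec_sum bf v).
  pose pl y := mk_linear ((pure_bilinear U V).1 y).
  pose pr x := mk_linear ((pure_bilinear U V).2 x).
  rewrite -[RHS]/(pl _ _) linear_sum; apply: eq_bigr => i _ /=.
  rewrite -[RHS]/(pr _ _) linear_sum; apply: eq_bigr => j _ /=.
  by rewrite pureZl pureZr scalerA mxE big_ord1 !mxE.
have GF : cancel G F.
  move=> M; rewrite /G -[LHS]/(mk_linear FP _) linear_sum.
  rewrite [RHS]matrix_sum_delta; apply: eq_bigr => i _.
  rewrite linear_sum; apply: eq_bigr => j _; rewrite linearZ /= tsum_pure //.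
  congr (_ *: _); apply/matrixP => i' j'; rewrite mxE big_ord1 !mxE.
  rewrite -[e _ _ _]/(coef e i' (vu i)) -[f _ _ _]/(coef f j' (vv j)) !coef_vec.
  by rewrite -natrM mulnb.
exists (trmx \o mxvec \o mk_linear FP).
exists (G \o vec_mx \o trmx) => [x|x] /=; first by rewrite trmxK mxvecK FG.
by rewrite -[tsum _ _]/(F _) GF vec_mxK trmxK.
Qed.

End TensorDimension.

(** * Existence of dual bases and of the zigzag scalars *)

Section Existence.
Variables (k : closedFieldType) (H : falgType k) (Q : quasi_hopf H).

(** For an eigenvalue a of f, the morphism f - a is not injective, so it vanishes on the simple
    module V. *)
Lemma schur (V : hmod H) (f : hhom V V) : simple_hmod V ->
  exists a : k, forall v, f v = a *: v.
Proof.
move=> Vs; have [n [e be]] := simple_has_dim Vs.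
have n0 : (0 < n)%N by apply: has_dim_neq0 (proj1 Vs); exists e.
have [e' eK e'K] := be.
have le' := can2_is_linear (fun a => linearP e a) eK e'K.
have lg : linear (fun x : 'rV[k]_n => (e (f (e' x^T)))^T).
  by move=> a x y; rewrite linearP le' !linearP.
pose M := lin1_mx (mk_linear lg).
have [a] : exists a, root (char_poly M) a.
  by apply/closed_rootP; rewrite size_char_poly eqSS -lt0n.
rewrite -eigenvalue_root_char => /eigenvalueP[x]; rewrite mul_rV_lin1 /= => xM x0.
exists a => v.
pose g := hcmb (- a) (hid V) f.
have g0 : g (e' x^T) = 0.
  rewrite /= scaleNr addrC; apply/eqP; rewrite subr_eq0; apply/eqP.
  apply: (can_inj eK); apply: trmx_inj; rewrite xM linearZ /= e'K.
  by rewrite linearZ /= trmxK.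
have ex0 : e' x^T != 0.
  apply: contra_neq x0 => E; apply: trmx_inj.
  by rewrite -[LHS]e'K E !linear0.
have : g v = 0.
  apply/eqP/negPn/negP => gv; move/eqP: ex0; apply.
  by apply: (simple_mono Vs gv); rewrite g0 linear0.
rewrite /= scaleNr addrC => /eqP; rewrite subr_eq0 => /eqP; exact.
Qed.

(* A rank factorization of the matrix by which l acts gives bases of the
   invariants and of the invariant functionals which are dual to each other. *)
Lemma integral_dual_bases (U : hmod H) (l : H) (N : nat) :
  normalized_integral Q l -> has_dim U N ->
  exists (r : nat) (b : 'I_r -> hhom (hunit Q) U) (d : 'I_r -> hhom U (hunit Q)),
    (forall i j, hcomp (d i) (b j) =1 fun c => (i == j)%:R *: c) /\
    (forall y : hhom (hunit Q) U,
        (forall i, hcomp (d i) y =1 hzero _ _) -> y =1 hzero _ _).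
Proof.
move=> [hl l1] [e be]; have [e' eK e'K] := be.
have le' := can2_is_linear (fun a => linearP e a) eK e'K.
have lg : linear (fun x : 'rV[k]_N => (e (hact l (e' x^T)))^T).
  by move=> a x y; rewrite linearP le' !linearP.
pose P := (lin1_mx (mk_linear lg))^T.
have PE u : e (hact l u) = P *m e u.
  by apply: trmx_inj; rewrite trmx_mul trmxK mul_rV_lin1 /= trmxK eK.
have PP : P *m P = P.
  apply: trmx_inj; apply/row_matrixP => i; rewrite !rowE.
  apply: trmx_inj; rewrite !trmx_mul !trmxK -mulmxA.
  rewrite -[X in P *m (P *m X)]e'K -[X in _ = P *m X]e'K -!PE -hactM (hl l).1.
  by rewrite l1 scale1r.
pose r := \rank P; pose B := col_base P; pose C := row_base P.
have BC : B *m C = P := mulmx_base P.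
(* P is idempotent, so B (C B) C = B C; the rank conditions allow B to be cancelled on the left and
   C on the right. *)
have CB : C *m B = 1%:M.
  have Cf : row_free C := row_base_free P.
  have Bf : row_full B := col_base_full P.
  apply: (row_full_inj Bf); apply: (row_free_inj Cf).
  by rewrite mulmx1 mulmxA -mulmxA BC PP.
pose bv j := e' (col j B).
pose dv i (u : U) : k^o := (C *m e u) i 0.
have dvP i : linear (dv i).
  by move=> a x y; rewrite /dv linearP mulmxDr -scalemxAr !mxE.
have dbv i j : dv i (bv j) = (i == j)%:R.
  by rewrite /dv /bv e'K colE mulmxA CB mul1mx mxE eqxx andbT.
have lE u : hact l u = \sum_i (dv i u : k) *: bv i.
  apply: (can_inj eK); rewrite PE (_ : P *m e u = B *m (C *m e u)); last by rewrite mulmxA BC.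
  rewrite linear_sum.
  apply/matrixP => i j; rewrite (ord1 j) mxE summxE; apply: eq_bigr => h _.
  by rewrite linearZ /= /bv e'K [RHS]mxE [col _ _ _ _]mxE mulrC.
have ldv i u : dv i (hact l u) = dv i u.
  rewrite lE -[LHS]/(mk_linear (dvP i) _) linear_sum.
  have dvZ j : mk_linear (dvP i) ((dv j u : k) *: bv j) = (dv j u : k) * (i == j)%:R.
    by rewrite linearZ /= dbv.
  rewrite (bigD1 i) // dvZ eqxx mulr1 big1; first by rewrite [LHS]addr0.
  by move=> j ji; rewrite dvZ eq_sym (negPf ji) mulr0.
have lbv j : hact l (bv j) = bv j.
  rewrite lE (bigD1 j) //= dbv eqxx scale1r big1 ?addr0 // => i ij.
  by rewrite dbv (negPf ij) scale0r.
have hb h j : hact h (bv j) = (counit Q h : k) *: bv j.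
  by rewrite -lbv -hactM (hl h).1 hactZl.
have hd i h u : dv i (hact h u) = (counit Q h * dv i u : k^o).
  rewrite -ldv -hactM (hl h).2 hactZl (GRing.scalable_linear (dvP i)) ldv //.
have lb j : linear (fun c : k^o => (c : k) *: bv j).
  by move=> a x y; rewrite scalePl.
have ab j h (c : hunit Q) : ((hact h c : k) *: bv j) = hact h ((c : k) *: bv j).
  by rewrite hactZr hb scalerA mulrC.
exists r, (fun j => mk_hhom (U := hunit Q) (lb j) (ab j)),
  (fun i => mk_hhom (V := hunit Q) (dvP i) (hd i)); split=> [i j c|y y0 c].
  rewrite -[LHS]/(mk_linear (dvP i) _) linearZ /= dbv.
  by rewrite [LHS]mulrC.
have yc : hact l (y c) = y c.
  by rewrite -hhom_act; congr (y _); rewrite /= l1 mul1r.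
rewrite -yc lE big1 // => i _.
by have /= -> := y0 i c; rewrite scale0r.
Qed.

(** w_i is the inverse associator after id (x) b_i. Precomposing the zigzag with the inverse of the
    right unitor gives an endomorphism of V, whose scalar a_i is given by Schur's lemma. *)
Lemma exists_dual_data (V : hmod H) (l : H) :
  normalized_integral Q l -> simple_hmod V ->
  exists (r : nat) (a : 'I_r -> k), dual_data Q V a.
Proof.
move=> hl Vs; have [n dV] := simple_has_dim Vs.
have [r [b [d [db sep]]]] :=
  integral_dual_bases (U := htens Q V V) hl (has_dim_tensor dV dV).
have ha : hiso (hassoc Q V V V).
  apply/hiso_bij; exists (fun x => act3 (assoc_inv Q) (tassocV x)) => x.
    rewrite /= /hassoc_fun tassocK -[tact _ _ _ _]/(act3 (assoc Q) x).
    by rewrite -act3M assocK act31.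
  rewrite /= /hassoc_fun -[tact _ _ _ _]/(act3 (assoc Q) _).
  by rewrite -act3M assocVK act31 tassocVK.
have [g [ga ag]] := ha.
pose w i := hcomp g (htens_hom Q (hid V) (b i)).
have hr : hiso (hunitr Q V).
  have br : bilinear (fun (v : V) (c : k^o) => c *: v).
    by split=> [c|v] t x y /=; rewrite ?scalePl ?scalePr.
  have rP := tsum_linear br.
  apply/hiso_bij; exists (fun v => v ⊗ (1 : k^o)) => [x|v]; last first.
    by rewrite /= /hunitr_fun tsum_pure // scale1r.
  rewrite /= /hunitr_fun; move: x; apply: tensor_ext => [s x y||v c].
  - by rewrite rP purePl.
  - by [].
  - by rewrite tsum_pure // pureZl -pureZr [_ *: _]mulr1.
have [s [sr rs]] := hr.
have ex i : exists a : k, forall v,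
    hcomp (hunitl Q V) (hcomp (htens_hom Q (d i) (hid V)) (w i)) (s v) = a *: v.
  exact: (schur (hcomp (hcomp (hunitl Q V) (hcomp (htens_hom Q (d i) (hid V)) (w i))) s) Vs).
exists r, (fun i => sval (cid (ex i))), b, d, w; split=> // i x.
  exact: (ag (htens_hom Q (hid V) (b i) x)).
case: (cid (ex i)) => a /= aE; rewrite -aE.
by have /= -> := sr x.
Qed.

End Existence.

(** * Equivalences of module categories *)

Arguments fmor {k H H'} F {U V} f : rename.

(** * Left ideals as modules *)

Section LeftIdealModule.
Variables (k : fieldType) (H : falgType k) (I : {vspace H}) (Il : left_ideal I).

Let act (h : H) (x : subvs_of I) : subvs_of I := vsproj I (h * vsval x).
Let vsval_act h x : vsval (act h x) = h * vsval x.
Proof. by rewrite vsprojK // Il // subvsP. Qed.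

Fact ideal_linearl x : linear (act^~ x).
Proof. by move=> a g h; rewrite /act mulrDl -scalerAl linearP. Qed.
Fact ideal_linearr h : linear (act h).
Proof. by move=> a x y; rewrite /act linearP mulrDr -scalerAr linearP. Qed.
Fact ideal_act1 x : act 1 x = x.
Proof. by apply: subvs_inj; rewrite vsval_act mul1r. Qed.
Fact ideal_actM g h x : act (g * h) x = act g (act h x).
Proof. by apply: subvs_inj; rewrite !vsval_act mulrA. Qed.

Definition hideal : hmod H := HMod ideal_linearl ideal_linearr ideal_act1 ideal_actM.

Lemma hideal_actE h (x : hideal) : vsval (hact h x) = h * vsval x.
Proof. exact: vsval_act. Qed.

Definition hideal_incl : hhom hideal (hreg H) :=
  mk_hhom (U := hideal) (V := hreg H) (fun a => linearP vsval a) hideal_actE.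

Let proj e (h : H) : hideal := vsproj I (h * e).
Let proj_linear e : linear (proj e : hreg H -> hideal).
Proof. by move=> a g h; rewrite /proj mulrDl -scalerAl linearP. Qed.
Let proj_act e (eI : e \in I) h (x : hreg H) : proj e (hact h x) = hact h (proj e x).
Proof.
apply: subvs_inj; rewrite hideal_actE !vsprojK /= ?mulrA //; exact: Il.
Qed.

(** Right multiplication by e, with values in I. For the components e_i of 1, these maps followed by
    the inclusions add up to the identity of H. *)
Lemma hideal_proj e : e \in I ->
  exists p : hhom (hreg H) hideal, forall h : H, hideal_incl (p h) = h * e.
Proof.
move=> eI; exists (mk_hhom (proj_linear e) (proj_act eI)) => h.
by rewrite /= vsprojK // Il.
Qed.

Lemma hideal_simple : minimal_left_ideal I -> simple_hmod hideal.
Proof.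
move=> Im; apply: cyclic_simple.
  have [_ I0 _] := Im; exists (vsproj I (vpick I)).
  apply: contra_neq I0 => /(congr1 vsval); rewrite vsprojK ?memv_pick // => E.
  by apply/eqP; rewrite -vpick0 E linear0.
move=> u v u0.
have u0' : vsval u != 0.
  by apply: contra_neq u0 => E; apply: subvs_inj; rewrite E linear0.
have [g E] := minimal_cyclic Im (subvsP u) u0' (subvsP v).
by exists g; apply: subvs_inj; rewrite hideal_actE E.
Qed.

End LeftIdealModule.

(** * Equivalences, and their effect on simple modules and dimensions *)

Section Functors.
Variables (k : fieldType) (H H' : falgType k).
Variables (F : hfunctor H H') (G : hfunctor H' H).
Hypothesis GF : nat_iso (fcomp G F) (fid H).
Hypothesis FG : nat_iso (fcomp F G) (fid H').

(** Naturality recovers f as the conjugate of G(F f) by eta. The separate section makes the lemma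
    available for G as well. *)
Lemma functor_faithful (U V : hmod H) (f g : hhom U V) :
  fmor F f =1 fmor F g -> f =1 g.
Proof.
case: GF => eta [eta_iso eta_nat] /(@hhom_ext _ _ _ _ _ _) E u.
have [et [_ etK]] := eta_iso U.
rewrite -[u]etK; have /= <- := eta_nat _ _ f (et u).
by have /= <- := eta_nat _ _ g (et u); rewrite E.
Qed.

End Functors.

Section Equivalence.
Variables (k : fieldType) (H H' : falgType k).
Variables (F : hfunctor H H') (G : hfunctor H' H).
Hypothesis GF : nat_iso (fcomp G F) (fid H).
Hypothesis FG : nat_iso (fcomp F G) (fid H').

(** For f the conjugate of G(phi) by eta, naturality gives G(F f) = G(phi), and G is faithful. *)
Lemma functor_full (U V : hmod H) (phi : hhom (F U) (F V)) :
  exists f : hhom U V, fmor F f =1 phi.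
Proof.
case: (GF) => eta [eta_iso eta_nat].
have [et [etK _]] := eta_iso U; have [ev [evK _]] := eta_iso V.
exists (hcomp (eta V) (hcomp (fmor G phi) et)).
apply: (functor_faithful FG) => x.
have /= := eta_nat _ _ (hcomp (eta V) (hcomp (fmor G phi) et)) x.
have /= -> := etK x.
move/(congr1 ev).
have /= -> := evK (fmor G (fmor F (hcomp (eta V) (hcomp (fmor G phi) et))) x).
by have /= -> := evK (fmor G phi x).
Qed.

Lemma functor_iso (U V : hmod H) (f : hhom U V) : hiso f -> hiso (fmor F f).
Proof.
move=> [g [gf fg]]; exists (fmor F g); split=> x.
  by rewrite -[LHS]fmor_comp (hhom_ext gf) fmor_id.
by rewrite -[LHS]fmor_comp (hhom_ext fg) fmor_id.
Qed.

Lemma functor_iso_reflect (U V : hmod H) (phi : hhom (F U) (F V)) :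
  hiso phi -> exists f : hhom U V, hiso f.
Proof.
move=> [psi [psiK phiK]].
have [f fE] := functor_full phi; have [g gE] := functor_full psi.
exists f, g; split; apply: (functor_faithful GF) => x.
  by rewrite fmor_comp /= fE gE fmor_id; apply: psiK.
by rewrite fmor_comp /= fE gE fmor_id; apply: phiK.
Qed.

Hypothesis F_lin : klinear F.

Lemma functor_zero (U V : hmod H) (f : hhom U V) :
  f =1 hzero U V -> fmor F f =1 hzero _ _.
Proof.
move=> f0 x; rewrite /= (F_lin (a := -1) (f := f) (g := f)).
  by rewrite scaleN1r addNr.
by move=> u; rewrite f0 /= scaleN1r addNr.
Qed.

Lemma functor_scale (U V : hmod H) a (f g : hhom U V) :
  (forall u, g u = a *: f u) -> forall x, fmor F g x = a *: fmor F f x.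
Proof.
move=> gE x; rewrite (F_lin (a := a) (f := f) (g := hzero U V)) => [|u].
  by rewrite (functor_zero (f := hzero U V)) //= addr0.
by rewrite gE addr0.
Qed.

Lemma functor_sum (U V : hmod H) (n : nat) (f : 'I_n -> hhom U V) (g : hhom U V) :
  (forall u, g u = \sum_i f i u) -> forall x, fmor F g x = \sum_i fmor F (f i) x.
Proof.
elim: n f g => [|n IHn] f g gE x.
  by rewrite big_ord0 functor_zero // => u; rewrite gE big_ord0.
pose tl (u : U) : V := \sum_(i < n) f (lift ord0 i) u.
have tlP : linear tl.
  move=> a u v; rewrite /tl scaler_sumr -big_split; apply: eq_bigr => i _.
  by rewrite linearP.
have tlA h u : tl (hact h u) = hact h (tl u).
  by rewrite /tl linear_sum; apply: eq_bigr => i _; rewrite hhom_act.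
rewrite (F_lin (a := 1) (f := f ord0) (g := mk_hhom tlP tlA)) => [|u].
  rewrite big_ord_recl scale1r; congr (_ + _).
  exact: (IHn (fun i => f (lift ord0 i))).
by rewrite gE big_ord_recl scale1r.
Qed.

(** F is faithful and linear, so the identity may be checked after F, where naturality of eps
    reduces it to the given relation between f, g and s. *)
Lemma inverse_klinear : klinear G.
Proof.
move=> U V a f g s sE x.
case: (FG) => eps [eps_iso eps_nat].
have [ev [evK _]] := eps_iso V.
suff: fmor G s =1 hcmb a (fmor G f) (fmor G g) by move->.
apply: (functor_faithful GF) => y.
rewrite [RHS](F_lin (a := a) (f := fmor G f) (g := fmor G g)) //.
have E (f1 : hhom U V) : eps V (fmor F (fmor G f1) y) = f1 (eps U y).
  exact: (eps_nat _ _ f1 y).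
apply: (can_inj (g := ev) evK); transitivity (s (eps U y)); first exact: E.
rewrite sE -!E; apply/esym; exact: linearP.
Qed.

Lemma functor_nonzero (U : hmod H) : (exists u : U, u != 0) -> exists x : F U, x != 0.
Proof.
move=> [u u0]; apply: contrapT => nx; move/eqP: u0; apply.
apply: (functor_faithful GF (f := hid U) (g := hzero U U)) => x.
rewrite fmor_id (functor_zero (f := hzero U U)) //=.
by apply/eqP/negPn/negP => x0; apply: nx; exists x.
Qed.

End Equivalence.

Section SemisimpleEquivalence.
Variables (k : fieldType) (H H' : falgType k).
Variables (F : hfunctor H H') (G : hfunctor H' H).
Hypothesis GF : nat_iso (fcomp G F) (fid H).
Hypothesis FG : nat_iso (fcomp F G) (fid H').
Hypothesis F_lin : klinear F.
Hypothesis H_ss : semisimple H.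

(* A morphism H' -> F V corresponds to G H' -> V, which splits when V is simple;
   hence it is onto as soon as it is nonzero. *)
Lemma functor_simple (V : hmod H) : simple_hmod V -> simple_hmod (F V).
Proof.
move=> Vs; apply: cyclic_simple; first exact: functor_nonzero GF F_lin _ (proj1 Vs).
move=> x y x0.
have G_lin := inverse_klinear GF FG F_lin.
case: (GF) => eta [eta_iso eta_nat]; have [ev [evK etaK]] := eta_iso V.
have etaI : injective (eta V) := can_inj (g := ev) evK.
pose phi : hhom (hreg H') (F V) := horb x.
pose psi : hhom (G (hreg H')) V := hcomp (eta V) (fmor G phi).
have [w pw0] : exists w, psi w != 0.
  apply: contrapT => nw; move/eqP: x0; apply.
  have phi0 : phi =1 hzero _ _.
    apply: (functor_faithful FG) => w; rewrite (functor_zero G_lin (f := hzero _ _)) //=.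
    apply: etaI; transitivity (0 : V); last exact/esym/linear0.
    by apply/eqP/negPn/negP => pw; apply: nw; exists w.
  by have := phi0 (1 : H'); rewrite /= hact1.
have [s sK] := simple_projective H_ss Vs pw0.
pose sigma : hhom V (G (hreg H')) := hcomp (horb w) s.
have psiK v : psi (sigma v) = v.
  by rewrite /sigma /= -[LHS]/(psi (hact (s v : H) w)) hhom_act sK.
(* Fullness of G turns the splitting sigma into a section tau of phi, so every y equals tau(y) x. *)
have [tau tauE] := functor_full FG GF (hcomp sigma (eta V) : hhom (G (F V)) (G (hreg H'))).
have phiK : hcomp phi tau =1 hid (F V).
  apply: (functor_faithful FG) => v; rewrite fmor_comp fmor_id /= tauE.
  by apply: etaI; exact: psiK.
by exists (tau y : H'); have /= := phiK y.
Qed.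

Hypothesis H'_ss : semisimple H'.

(** The identity of H is the sum of its projections to the minimal left ideals, and F preserves this
    sum. F of each ideal is simple, hence generated by any nonzero element; c is the number of
    ideals. *)
Lemma functor_hreg_generated :
  exists (c : nat) (m : 'I_c -> F (hreg H)),
    forall y, exists g : 'I_c -> H', y = \sum_j hact (g j) (m j).
Proof.
have [n [I [e [Im eI e1]]]] := semisimple_one H_ss.
have Il i : left_ideal (I i) by case: (Im i).
pose p i := sval (cid (hideal_proj (Il i) (eI i))).
have pE i h : hideal_incl (Il i) (p i h) = h * e i :=
  svalP (cid (hideal_proj (Il i) (eI i))) h.
have Fs i : simple_hmod (F (hideal (Il i))).
  exact/functor_simple/hideal_simple.
have ex i : exists u : F (hideal (Il i)), u != 0 by case: (Fs i).
pose u i := sval (cid (ex i)).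
have u0 i : u i != 0 := svalP (cid (ex i)).
exists n, (fun i => fmor F (hideal_incl (Il i)) (u i)) => y.
have gex i : exists g : H', hact g (u i) = fmor F (p i) y.
  exact: simple_cyclic (Fs i) (u0 i).
exists (fun i => sval (cid (gex i))).
rewrite -[LHS](@fmor_id k H H' F (hreg H) y).
rewrite (functor_sum F_lin (f := fun i => hcomp (hideal_incl (Il i)) (p i))) => [|h].
  apply: eq_bigr => i _; rewrite fmor_comp /= -hhom_act; congr (fmor F _ _).
  exact/esym/(svalP (cid (gex i))).
rewrite -[LHS]mulr1 -e1 mulr_sumr; apply: eq_bigr => i _.
by rewrite -pE.
Qed.

(** The maps w |-> F([horb w])(m_j) are jointly injective: if all vanish at w then F([horb w])
    vanishes on generators, so [horb w] = 0 and w = 0. *)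
Lemma functor_dim_bound : exists c : nat, forall (W : hmod H) (p q : nat),
  has_dim W p -> has_dim (F W) q -> (p <= q * c)%N.
Proof.
have [c [m mE]] := functor_hreg_generated.
exists c => W p q dW dFW.
pose g j (w : W) : F W := fmor F (horb w) (m j).
have gP j : linear (g j).
  move=> a x y; rewrite /g (F_lin (a := a) (f := horb x) (g := horb y)) //= => h.
  by rewrite /= linearP.
apply: (has_dim_le (g := fun j => mk_linear (gP j))) dW dFW _ => w w0.
have : horb w =1 hzero (hreg H) W.
  apply: (functor_faithful GF) => y; rewrite (functor_zero F_lin (f := hzero _ _)) //=.
  have [h ->] := mE y; rewrite linear_sum big1 // => j _.
  by rewrite hhom_act -[fmor F _ _]/(g j w) [g j w]w0 linear0.
by move/(_ (1 : H)); rewrite /= hact1.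
Qed.

End SemisimpleEquivalence.

(** * Tensor products of morphisms and tensor powers *)

Section TensorHoms.
Variables (k : fieldType) (H : algType k) (Q : quasi_bialgebra H).

Lemma htens_hom_comp (U U' U'' V V' V'' : hmod H) (f' : hhom U' U'') (f : hhom U U')
    (g' : hhom V' V'') (g : hhom V V') x :
  htens_hom Q f' g' (htens_hom Q f g x) = htens_hom Q (hcomp f' f) (hcomp g' g) x.
Proof.
have lf := tmap_linear (hhom_linear f) (hhom_linear g).
have lf' := tmap_linear (hhom_linear f') (hhom_linear g').
have lc := tmap_linear (hhom_linear (hcomp f' f)) (hhom_linear (hcomp g' g)).
rewrite -[LHS]/(tmap f' g' (tmap f g x)) -[RHS]/(tmap (hcomp f' f) (hcomp g' g) x).
move: x; apply: tensor_ext => [||u v]; [exact: linear_cmp lf lf'|exact: lc|].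
by rewrite !tmap_pure //; exact: hhom_linear.
Qed.

Lemma htens_hom_id (U V : hmod H) x : htens_hom Q (hid U) (hid V) x = x.
Proof.
rewrite /=; move: x; apply: tensor_ext => [||u v].
- exact: tmap_linear (@linear_id k U) (@linear_id k V).
- exact: linear_id.
by rewrite tmap_pure //; exact: linear_id.
Qed.

Lemma htens_hom_ext (U U' V V' : hmod H) (f f' : hhom U U') (g g' : hhom V V') x :
  f =1 f' -> g =1 g' -> htens_hom Q f g x = htens_hom Q f' g' x.
Proof. by move=> /(@hhom_ext _ _ _ _ _ _) -> /(@hhom_ext _ _ _ _ _ _) ->. Qed.

Lemma htens_hom_iso (U U' V V' : hmod H) (f : hhom U U') (g : hhom V V') :
  hiso f -> hiso g -> hiso (htens_hom Q f g).
Proof.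
move=> [f' [f'K fK]] [g' [g'K gK]]; exists (htens_hom Q f' g'); split=> x.
  by rewrite [LHS]htens_hom_comp (htens_hom_ext _ f'K g'K) htens_hom_id.
by rewrite [LHS]htens_hom_comp (htens_hom_ext _ fK gK) htens_hom_id.
Qed.

Lemma hid_iso (U : hmod H) : hiso (hid U).
Proof. by exists (hid U). Qed.

Lemma hcomp_iso (U V W : hmod H) (g : hhom V W) (f : hhom U V) :
  hiso g -> hiso f -> hiso (hcomp g f).
Proof.
move=> /hiso_bij bg /hiso_bij bf; apply/hiso_bij.
exact: (bij_comp bg bf).
Qed.

Fixpoint htens_pow (V : hmod H) (m : nat) : hmod H :=
  if m is m'.+1 then htens Q (htens_pow V m') V else hunit Q.

Lemma htens_pow_dim (V : hmod H) n m : has_dim V n -> has_dim (htens_pow V m) (n ^ m).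
Proof.
move=> dV; elim: m => [|m IHm] /=; first exact: has_dim1.
by rewrite expnSr; apply: has_dim_tensor.
Qed.

End TensorHoms.

(** If p >= q + 1, Bernoulli's inequality with exponent q c + 1 gives p^(q c + 1) >= q^(q c) (q + q
    c + 1), which exceeds q^(q c + 1) c = q^(q c) q c. *)
Lemma leq_of_exp_bound p q c : (0 < q)%N ->
  (forall m, p ^ m <= q ^ m * c)%N -> (p <= q)%N.
Proof.
move=> q0 pq; rewrite leqNgt; apply/negP => qp.
have bern m : (q ^ m.+1 + m.+1 * q ^ m <= q.+1 ^ m.+1)%N.
  elim: m => [|m]; first by rewrite !expn1 expn0 muln1 addn1.
  rewrite [(q.+1 ^ m.+2)%N]expnS !expnS; move: (q ^ m)%N (q.+1 ^ m)%N => a b; nia.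
have := bern (q * c)%N; have := pq (q * c).+1.
have : (q.+1 ^ (q * c).+1 <= p ^ (q * c).+1)%N by rewrite leq_exp2r.
have : (0 < q ^ (q * c))%N by rewrite expn_gt0 q0.
rewrite ![(q ^ _.+1)%N]expnS.
move: (q ^ (q * c))%N (q.+1 ^ _)%N (p ^ _)%N => a b d; nia.
Qed.

(** * Transport along a tensor equivalence *)

Section TensorEquivalence.
Variables (k : fieldType) (H H' : falgType k) (Q : quasi_hopf H) (Q' : quasi_hopf H').
Variables (F : hfunctor H H') (G : hfunctor H' H).
Hypothesis GF : nat_iso (fcomp G F) (fid H).
Hypothesis FG : nat_iso (fcomp F G) (fid H').
Hypothesis F_lin : klinear F.
Variable T : tensor_structure Q Q' F.
Hypothesis H_ss : semisimple H.
Hypothesis H'_ss : semisimple H'.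

Lemma functor_htens_pow_dim (V : hmod H) q m :
  has_dim (F V) q -> has_dim (F (htens_pow Q V m)) (q ^ m).
Proof.
move=> dFV; elim: m => [|m IHm] /=.
  have [i0 [i0K t0K]] := ten0_iso T.
  apply: (has_dim_iso (f := i0)); last exact: has_dim1.
  by exists (ten0 T).
have [i2 [i2K t2K]] := ten2_iso T (htens_pow Q V m) V.
apply: (has_dim_iso (f := i2)); first by exists (ten2 T (htens_pow Q V m) V).
by rewrite expnSr; apply: has_dim_tensor.
Qed.

(* dim F(V)^m and dim V^m are the dimensions of F(V^(x)m) and V^(x)m, so they
   differ by a factor bounded independently of m. *)
Lemma functor_dim (V : hmod H) p q : (exists v : V, v != 0) ->
  has_dim V p -> has_dim (F V) q -> p = q.
Proof.
move=> V0 dV dFV.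
have G_lin := inverse_klinear GF FG F_lin.
have [c cF] := functor_dim_bound GF FG F_lin H_ss.
have [c' cG] := functor_dim_bound FG GF G_lin H'_ss.
have p0 := has_dim_neq0 dV V0.
have q0 := has_dim_neq0 dFV (functor_nonzero GF F_lin V0).
apply/eqP; rewrite eqn_leq; apply/andP; split.
  apply: (leq_of_exp_bound (c := c)) => // m.
  by apply: cF (htens_pow_dim Q m dV) (functor_htens_pow_dim m dFV).
apply: (leq_of_exp_bound (c := c')) => // m.
apply: cG (functor_htens_pow_dim m dFV) _.
case: GF => eta [eta_iso _].
apply: (has_dim_iso (f := eta (htens_pow Q V m))); first exact/hiso_bij.
exact: htens_pow_dim.
Qed.

(** The data are applied to F and conjugated by the structure isomorphisms; J', the inverse of t2
    (t2 (x) id), brings F((V (x) V) (x) V) back to (F V (x) F V) (x) F V. The coherence axioms show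
    that the scalars do not change. *)
Lemma functor_dual_data (V : hmod H) (n : nat) (a : 'I_n -> k) :
  dual_data Q V a -> dual_data Q' (F V) a.
Proof.
move=> [b [d [w [db sep hw ha]]]].
have [i0 [i0K t0K]] := ten0_iso T.
have [i2 [i2K t2K]] := ten2_iso T V V.
pose t0 := ten0 T; pose t2 := ten2 T.
have [J' [J'K JK]] : hiso (hcomp (t2 (htens Q V V) V) (htens_hom Q' (t2 V V) (hid (F V)))).
  apply: hcomp_iso; first exact: ten2_iso.
  by apply: htens_hom_iso; [exact: ten2_iso | exact: hid_iso].
pose b' i := hcomp i2 (hcomp (fmor F (b i)) t0).
pose d' i := hcomp i0 (hcomp (fmor F (d i)) (t2 V V)).
pose w' i := hcomp J' (hcomp (fmor F (w i))
  (hcomp (t2 V (hunit Q)) (htens_hom Q' (hid (F V)) t0))).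
have t2b i : hcomp (t2 V V) (b' i) =1 hcomp (fmor F (b i)) t0.
  by move=> x; exact: (t2K (fmor F (b i) (t0 x))).
have t0d i : hcomp t0 (d' i) =1 hcomp (fmor F (d i)) (t2 V V).
  by move=> x; exact: (t0K (fmor F (d i) (t2 V V x))).
have Jw i x : t2 (htens Q V V) V (htens_hom Q' (t2 V V) (hid (F V)) (w' i x)) =
    fmor F (w i) (t2 V (hunit Q) (htens_hom Q' (hid (F V)) t0 x)).
  exact: (JK (fmor F (w i) (t2 V (hunit Q) (htens_hom Q' (hid (F V)) t0 x)))).
exists b', d', w'; split.
- move=> i j x.
  have E y : hcomp (d i) (b j) y = (i == j)%:R *: hid (hunit Q) y by exact: db.
  transitivity (i0 (fmor F (hcomp (d i) (b j)) (t0 x))).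
    by rewrite fmor_comp; congr (i0 (fmor F (d i) _)); exact: t2b.
  rewrite (functor_scale F_lin (f := hid _) E) fmor_id linearZ.
  by congr (_ *: _); exact: i0K.
(* By fullness y comes from an invariant f of V (x) V; by faithfulness all d_i kill f, so f = 0. *)
- move=> y dy x.
  have [f fE] := functor_full GF FG (hcomp (t2 V V) (hcomp y i0)).
  have f0 : f =1 hzero _ _.
    apply: sep => i; apply: (functor_faithful GF) => z.
    rewrite fmor_comp /= fE (functor_zero F_lin (f := hzero _ _)) //.
    transitivity (t0 (d' i (y (i0 z)))); first exact/esym/t0d.
    have -> : d' i (y (i0 z)) = 0 := dy i (i0 z).
    exact: linear0.
  have := fE (t0 x); rewrite (functor_zero F_lin f0) /= => /esym E.
  have := i2K (y (i0 (t0 x))); rewrite /= -/t2 E linear0 => /esym.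
  by have /= -> := i0K x.
(* After composition with the invertible t2 (id (x) t2), the associativity axiom moves the
   associator under F, where [hw] applies; naturality of t2 then extracts F(b_i). *)
- move=> i x.
  have [J2' [J2'K _]] : hiso (hcomp (t2 V (htens Q V V)) (htens_hom Q' (hid (F V)) (t2 V V))).
    apply: hcomp_iso; first exact: ten2_iso.
    by apply: htens_hom_iso; [exact: hid_iso | exact: ten2_iso].
  apply: (can_inj (g := J2') J2'K).
  transitivity (t2 V (htens Q V V) (htens_hom Q' (hid (F V)) (t2 V V)
    (hassoc Q' (F V) (F V) (F V) (w' i x)))).
    by [].
  transitivity (fmor F (hassoc Q V V V)
    (t2 (htens Q V V) V (htens_hom Q' (t2 V V) (hid (F V)) (w' i x)))).
    apply: esym; exact: (ten2_assoc T (w' i x)).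
  rewrite Jw -[LHS]fmor_comp (hhom_ext (hw i)).
  transitivity (t2 V (htens Q V V) (htens_hom Q' (fmor F (hid V)) (fmor F (b i))
    (htens_hom Q' (hid (F V)) t0 x))).
    apply: esym; exact: (ten2_nat T (hid V) (b i) _).
  congr (t2 V (htens Q V V) _).
  rewrite !htens_hom_comp; apply: htens_hom_ext => z; first by rewrite /= fmor_id.
  exact/esym/t2b.
(* The left unit axiom and naturality collect the composite under F, where it is a_i times the right
   unitor; the right unit axiom translates this back. *)
move=> i x.
transitivity (fmor F (hunitl Q V) (t2 (hunit Q) V (htens_hom Q' t0 (hid (F V))
    (htens_hom Q' (d' i) (hid (F V)) (w' i x))))).
  apply: esym; exact: (ten_unitl T _).
rewrite htens_hom_comp.
have -> : htens_hom Q' (hcomp t0 (d' i)) (hcomp (hid (F V)) (hid (F V))) (w' i x) =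
    htens_hom Q' (fmor F (d i)) (fmor F (hid V)) (htens_hom Q' (t2 V V) (hid (F V)) (w' i x)).
  rewrite htens_hom_comp; apply: htens_hom_ext => z; first exact: t0d.
  by rewrite /= fmor_id.
transitivity (fmor F (hunitl Q V) (fmor F (htens_hom Q (d i) (hid V))
   (t2 (htens Q V V) V (htens_hom Q' (t2 V V) (hid (F V)) (w' i x))))).
  congr (fmor F (hunitl Q V) _); exact: (ten2_nat T (d i) (hid V)).
rewrite Jw.
transitivity (fmor F (hcomp (hunitl Q V) (hcomp (htens_hom Q (d i) (hid V)) (w i)))
   (t2 V (hunit Q) (htens_hom Q' (hid (F V)) t0 x))).
  by rewrite !fmor_comp /= fmor_comp.
rewrite (functor_scale F_lin (f := hunitr Q V) (ha i)).
by congr (_ *: _); exact: (ten_unitr T _).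
Qed.

End TensorEquivalence.

Lemma nu_tensor_functor (k : closedFieldType) (H H' : falgType k)
    (Q : quasi_hopf H) (Q' : quasi_hopf H') (F : hfunctor H H') (G : hfunctor H' H)
    (V : hmod H) (chi : H -> k) (chi' : H' -> k) :
  nat_iso (fcomp G F) (fid H) -> nat_iso (fcomp F G) (fid H') -> klinear F ->
  tensor_structure Q Q' F -> semisimple H -> semisimple H' -> simple_hmod V ->
  has_character V chi -> has_character (F V) chi' -> chi (nu Q) = chi' (nu Q').
Proof.
move=> GF FG F_lin T H_ss H'_ss Vs hc hc'.
have hl : normalized_integral Q (integral Q) := xgetPex 0 (exists_integral Q H_ss).
have hl' : normalized_integral Q' (integral Q') := xgetPex 0 (exists_integral Q' H'_ss).
have [r [a da]] := exists_dual_data hl Vs.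
have [n [e [_ [be _ _]]]] := hc; have [n' [e' [_ [be' _ _]]]] := hc'.
have E : n = n'.
  by apply: (functor_dim GF FG F_lin T H_ss H'_ss (proj1 Vs)); [exists e | exists e'].
rewrite (character_nu be da hl hc).
by rewrite (character_nu be' (functor_dual_data GF FG F_lin T da) hl' hc') E.
Qed.

Theorem theorem4p1 (k : closedFieldType) (k_char0 : [pchar k] =i pred0)
    (H H' : falgType k) (Q : quasi_hopf H) (Q' : quasi_hopf H')
    (H_ss : semisimple H) (H'_ss : semisimple H')
    (QQ' : tensor_equivalent Q Q') :
  exists f : (H -> k) -> (H' -> k),
    set_bij (Irr H) (Irr H') f /\
    forall chi, Irr H chi -> chi (nu Q) = f chi (nu Q').
Proof.
have [F [F_lin [G [GF FG]] [T]]] := QQ'.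
have G_lin := inverse_klinear GF FG F_lin.
pose R chi := [set chi' | exists V : hmod H,
  [/\ simple_hmod V, has_character V chi & has_character (F V) chi']]%classic.
(* A choice of the character of F(V) for some simple V affording chi; by [fP] the default 0 is not
   reached on Irr(H). *)
pose f chi := xget (fun _ => 0) (R chi).
have fP chi : Irr H chi -> R chi (f chi).
  move=> [V [Vs hV]].
  have [chi' hFV] := simple_has_character (functor_simple GF FG F_lin H_ss Vs).
  by apply: (xgetPex (fun _ => 0)); exists chi', V.
exists f; split; last first.
  move=> chi /fP[V [Vs hV hFV]].
  exact: nu_tensor_functor GF FG F_lin T H_ss H'_ss Vs hV hFV.
split=> [chi /fP[V [Vs _ hFV]]|chi psi|chi' [V' [V's hV']]].
- by exists (F V); split=> //; apply: functor_simple GF FG F_lin H_ss _ Vs.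
(* Equal characters make F(V) and F(W) isomorphic, and F reflects isomorphisms. *)
- rewrite !inE => /fP[V [Vs hV hFV]] /fP[W [Ws hW hFW]] E.
  rewrite -E in hFW.
  have [phi phi_iso] := character_inj k_char0 H'_ss
    (functor_simple GF FG F_lin H_ss Vs) (functor_simple GF FG F_lin H_ss Ws) hFV hFW.
  have [g g_iso] := functor_iso_reflect GF FG phi_iso.
  exact: character_iso g_iso hV hW.
(* The preimage of chi' is the character of G(V'). The module V chosen by f need not be G(V'), but
   it is isomorphic to it, so F(V) is isomorphic to F(G(V')) and to V'. *)
have GVs := functor_simple FG GF G_lin H'_ss V's.
have [chi hG] := simple_has_character GVs.
have Ichi : Irr H chi by exists (G V').
exists chi => //.
have [V [Vs hV hFV]] := fP _ Ichi.
have [g g_iso] := character_inj k_char0 H_ss Vs GVs hV hG.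
case: FG => eps [eps_iso _].
have i1 := functor_iso F g_iso.
have i2 : hiso (hcomp (eps V') (fmor F g)) := hcomp_iso (eps_iso V') i1.
exact: character_iso i2 hFV hV'.
Qed.
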